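(* Let $k\in\mathbb{C}$ with $\operatorname{Re}k\ge 0$, let $1\le p\le\infty$ and let $f\in\mathcal{S}(\mathbb{R})$. Then, in the extended positive real numbers $[0,\infty]$, the following limit exists and $$\lim_{n\to\infty}\|T_k^nf\|_{\operatorname{Re}k,p}^{1/n}=\sup\{|\lambda| : \lambda\in\operatorname{supp}D_kf\}.$$
   Context: $\mathcal{S}(\mathbb{R})$ is the Schwartz space of complex-valued functions. For $k\in\mathbb{C}$, the Dunkl operator $T_k$ acts on smooth (or holomorphic) functions by $T_kf(x)=f'(x)+k\,\frac{f(x)-f(-x)}{x}$, equivalently $T_kf(x)=f'(x)+k\int_{-1}^1 f'(tx)\,dt$ (which gives the value at $x=0$); it maps $\mathcal{S}(\mathbb{R})$ into itself. For $\operatorname{Re}k\ge0$ and each $\lambda\in\mathbb{C}$ there is a unique holomorphic function $\psi_\lambda^k:\mathbb{C}\to\mathbb{C}$ with $T_k\psi_\lambda^k=i\lambda\psi_\lambda^k$ and $\psi_\lambda^k(0)=1$; for $\lambda\in\mathbb{R}$ it is bounded on $\mathbb{R}$. Put $w_k(x)=|x|^{2k}$ (complex-valued) and $c_k=\int_{\mathbb{R}}e^{-x^2/2}w_k(x)\,dx\ne0$. The Dunkl transform of $f\in L^1(\mathbb{R},|w_k(x)|dx)$ is $$D_kf(\lambda)=\frac{1}{c_k}\int_{\mathbb{R}}f(x)\,\psi_{-\lambda}^k(x)\,w_k(x)\,dx\qquad(\lambda\in\mathbb{R}).$$ $\|\cdot\|_{\operatorname{Re}k,p}$ denotes the norm of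 $L^p(\mathbb{R},|w_k(x)|dx)$, where $|w_k(x)|=|x|^{2\operatorname{Re}k}$. The supremum is taken in $[0,\infty]$, so the supremum of the empty set is $0$. *)

(* Defs.v *)
From HB Require Import structures.
From mathcomp Require Import all_boot all_order all_algebra.
From mathcomp Require Import complex.
From mathcomp Require Import all_classical all_reals all_analysis.
From mathcomp Require Import measurable_realfun.
Set Implicit Arguments.
Unset Strict Implicit.
Unset Printing Implicit Defensive.
Import Order.TTheory GRing.Theory Num.Theory.
Import numFieldNormedType.Exports.
Local Open Scope classical_set_scope.
Local Open Scope ring_scope.
Local Open Scope complex_scope.

(* The modulus as an element of [R]; the norm [`|z|] of [R[i]] is valued in
   [R[i]]. *)
Definition cmod (R : realType) (z : R[i]) : R := complex.Re `|z|.

(* Derivative of a complex-valued function of a real variable: MathComp-Analysis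
   has no normed [R]-module structure on [R[i]], hence the componentwise form. *)
Definition derive1c (R : realType) (f : R -> R[i]) (x : R) : R[i] :=
  derive1 (fun y => complex.Re (f y)) x +i*
  derive1 (fun y => complex.Im (f y)) x.

Definition smoothc (R : realType) (f : R -> R[i]) : Prop :=
  forall (n : nat) (x : R),
    derivable (fun y => complex.Re (iter n (@derive1c R) f y)) x 1 /\
    derivable (fun y => complex.Im (iter n (@derive1c R) f y)) x 1.

Definition schwartz (R : realType) (f : R -> R[i]) : Prop :=
  smoothc f /\
  forall m n : nat, exists M : R, forall x : R,
    `|x| ^+ m * cmod (iter n (@derive1c R) f x) <= M.

(* Lebesgue integral over the real line; only meaningful for integrable [g]. *)
Definition integralc (R : realType) (g : R -> R[i]) : R[i] :=
  (\int[lebesgue_measure]_x complex.Re (g x)) +i*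
  (\int[lebesgue_measure]_x complex.Im (g x)).

(* [(f x - f (- x)) / x] extends continuously to [0] by [2 f'(0)]: this is the
   value of [\int_(-1)^1 f'(t x) dt] there. *)
Definition dunkl (R : realType) (k : R[i]) (f : R -> R[i]) (x : R) : R[i] :=
  derive1c f x +
  k * (if x == 0 then 2%:R * derive1c f 0 else (f x - f (- x)) / x%:C).

Definition holomorphic (R : realType) (f : R[i] -> R[i]) : Prop :=
  forall z : R[i], derivable (f : R[i]^o -> R[i]^o) z 1.

Definition holo_dunkl (R : realType) (k : R[i]) (f : R[i] -> R[i]) (z : R[i]) :
    R[i] :=
  let f' (u : R[i]) : R[i] := derive1 (f : R[i]^o -> R[i]^o) u in
  f' z + k * (if z == 0 then 2%:R * f' 0 else (f z - f (- z)) / z).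

Definition dunkl_eigenfunction (R : realType) (k lambda : R[i])
    (f : R[i] -> R[i]) : Prop :=
  [/\ holomorphic f,
      forall z : R[i], holo_dunkl k f z = (0 +i* 1) * lambda * f z &
      f 0 = 1].

(* The function [psi_lambda^k]: [dunkl_eigenfunction k lambda] has exactly one
   element when [0 <= Re k], and the default value [0] is then irrelevant. *)
Definition dunkl_kernel (R : realType) (k lambda : R[i]) : R[i] -> R[i] :=
  xget (fun=> 0) [set f : R[i] -> R[i] | dunkl_eigenfunction k lambda f].

(* [|x|^(2k) = |x|^(2 Re k) * exp (2 i (Im k) (ln |x|))] for [x != 0]; the value
   at the single point [0] plays no role. *)
Definition dunkl_weight (R : realType) (k : R[i]) (x : R) : R[i] :=
  let r := `|x| `^ (2 * complex.Re k) in
  let theta := 2 * complex.Im k * ln `|x| in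
  (r * cos theta) +i* (r * sin theta).

Definition dunkl_const (R : realType) (k : R[i]) : R[i] :=
  integralc (fun x => (expR (- (x ^+ 2 / 2)))%:C * dunkl_weight k x).

Definition dunkl_transform (R : realType) (k : R[i]) (f : R -> R[i])
    (lambda : R) : R[i] :=
  (dunkl_const k)^-1 *
  integralc (fun x =>
    f x * dunkl_kernel k (- lambda%:C) x%:C * dunkl_weight k x).

Definition supp (R : realType) (g : R -> R[i]) : set R :=
  closure [set x | g x != 0].

(* Supremum in [[0, +oo]] of the absolute values of the elements of [A];
   [ereal_sup set0] is [-oo], hence the maximum with [0]. *)
Definition sup_abs (R : realType) (A : set R) : \bar R :=
  maxe 0%E (ereal_sup [set `|x|%:E | x in A]).

Definition weighted_measure (R : realType) (a : R) (A : set R) : \bar R :=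
  (\int[lebesgue_measure]_(x in A) (`|x| `^ (2 * a))%:E)%E.

Lemma weighted_measure0 (R : realType) (a : R) : weighted_measure a set0 = 0%E.
Proof. exact: integral_set0. Qed.

Lemma weighted_measure_ge0 (R : realType) (a : R) (A : set R) :
  (0 <= weighted_measure a A)%E.
Proof. by apply: integral_ge0 => x _; rewrite lee_fin powR_ge0. Qed.

Lemma weighted_measure_sigma_additive (R : realType) (a : R) :
  semi_sigma_additive
    (weighted_measure a : set (measurableTypeR R) -> \bar R).
Proof.
move=> /= F mF tF mUF; rewrite /weighted_measure ge0_integral_bigcup//=.
- apply: is_cvg_ereal_nneg_natsum_cond => n _ _.
  by apply: integral_ge0 => x _; rewrite lee_fin powR_ge0.
- apply: measurable_funTS; apply/measurable_EFinP.
  exact: (measurableT_comp (measurable_powR _)).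
Qed.

HB.instance Definition _ (R : realType) (a : R) :=
  isMeasure.Build _ (measurableTypeR R) R
    (weighted_measure a : set (measurableTypeR R) -> \bar R)
    (weighted_measure0 a) (weighted_measure_ge0 a)
    (@weighted_measure_sigma_additive R a).

Definition weighted_norm (R : realType) (a : R) (p : \bar R) (f : R -> R[i]) :
    \bar R :=
  Lnorm (weighted_measure a : {measure set (measurableTypeR R) -> \bar R}) p
    (fun x => (cmod (f x))%:E).

(* Main.v *)
Require Import Defs.
From HB Require Import structures.
From mathcomp Require Import all_boot all_order all_algebra.
From mathcomp Require Import complex.
From mathcomp Require Import all_classical all_reals all_analysis.
From mathcomp Require Import measurable_realfun ess_sup_inf ring lra.
Set Implicit Arguments.
Unset Strict Implicit.
Unset Printing Implicit Defensive.
Import Order.TTheory GRing.Theory Num.Theory.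
Import numFieldNormedType.Exports.
Local Open Scope classical_set_scope.
Local Open Scope ring_scope.
Local Open Scope complex_scope.

(* Write [D f l] for the integral of [f x * psi_(-l) x * w_k x].  Integration by
   parts gives [D (T^n f) l = (i l)^n D f l], and as [Re k >= 0] the energy
   [|psi x|^2 + |psi (- x)|^2] decreases away from [0], so that [psi] is bounded.
   Completeness of the Gaussians, whose transforms are explicit, gives [c_k <> 0]
   and the inversion formula [D (D f) x = c_k^2 f (- x)].

   Upper bound: if [D f] vanishes outside [[-s, s]], inversion yields
   [|T^n f| <= C s^n].  This class of functions is stable under multiplication by
   [x], since [T (D f) = D (- i x f)], so the commutator of [x] with [T^n] yields
   [|x|^m |T^n f| <= C (n+1)^m s^n], which bounds every weighted norm.

   Lower bound: if [D f] does not vanish at some [l0] with [|l0| > r], there is a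
   bump [phi], of finite smoothness and supported in an annulus [a <= |l| <= b]
   with [a > r], such that the integral of [D f * phi * w_k] is nonzero.  By
   adjointness this integral equals [i^(-n)] times that of
   [T^n f * D (l^(-n) phi) * w_k].  As [T^q (l^(-n) phi)] is bounded by
   [C (n+1)^q a^(-n)], the function [D (l^(-n) phi)] decays fast enough for this
   integral to be at most [C (n+1)^q a^(-n)] times the norm of [T^n f]. *)

(** * Complex-valued functions of a real variable *)

(** The weight is complex-valued, so pairing with it is not an inner product and no Plancherel
    theorem is at hand. Even the nonvanishing of [dunkl_const k] needs an argument, and lower
    estimates of integrals start by rotating the phase of the integrand. Completeness is reduced to
    even functions, which on [x > 0] are functions of [u = exp (- x^2 / 2)]; Gaussians with integer
    parameters are powers of [u], so polynomials in [u] concentrated at one point detect every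
    value.

    The exponent [p] is absorbed by one auxiliary function: [1 / growth L] lies in every weighted
    Lebesgue space, so a pointwise bound by it controls the norm from above, and the integral
    against it is controlled by the norm. Losses that are constant or polynomial in [n] disappear in
    the [n]-th root.

    The bumps are truncated polynomials times integer powers of [x]: [T] acts on them by explicit
    formulas in which [n] enters through one coefficient, linear in [n]. Finitely many derivatives
    suffice because a fixed order of decay, [L + 2], is needed. *)

Section Modulus.
Context {R : realType}.
Implicit Types z u : R[i].

Lemma cmodE z : cmod z = Num.sqrt (complex.Re z ^+ 2 + complex.Im z ^+ 2).
Proof. by case: z. Qed.

Lemma cmod_ge0 z : 0 <= cmod z.
Proof. by rewrite cmodE sqrtr_ge0. Qed.

Lemma cmod0 : cmod (0 : R[i]) = 0.
Proof. by rewrite cmodE /= expr0n /= addr0 sqrtr0. Qed.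

Lemma cmodM z u : cmod (z * u) = cmod z * cmod u.
Proof. exact: ComplexField.Normc.normcM. Qed.

Lemma ler_cmodD z u : cmod (z + u) <= cmod z + cmod u.
Proof. exact: le_normcD. Qed.

Lemma cmodN z : cmod (- z) = cmod z.
Proof. exact: normcN. Qed.

Lemma ler_cmodB z u : cmod (z - u) <= cmod z + cmod u.
Proof. by rewrite -(cmodN u) ler_cmodD. Qed.

Lemma cmod_real (x : R) : cmod x%:C = `|x|.
Proof. by rewrite cmodE /= expr0n /= addr0 sqrtr_sqr. Qed.

Lemma cmod_sqr z : cmod z ^+ 2 = complex.Re z ^+ 2 + complex.Im z ^+ 2.
Proof. by rewrite cmodE sqr_sqrtr // addr_ge0 // sqr_ge0. Qed.

Lemma normr_Re_le z : `|complex.Re z| <= cmod z.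
Proof. by rewrite cmodE -sqrtr_sqr ler_wsqrtr // lerDl sqr_ge0. Qed.

Lemma normr_Im_le z : `|complex.Im z| <= cmod z.
Proof. by rewrite cmodE -sqrtr_sqr ler_wsqrtr // lerDr sqr_ge0. Qed.

Lemma cmod_le_ReIm z : cmod z <= `|complex.Re z| + `|complex.Im z|.
Proof.
rewrite -(@ler_pXn2r _ 2) ?nnegrE ?cmod_ge0 ?addr_ge0 //.
rewrite cmod_sqr sqrrD -[X in X <= _]addr0 !real_normK ?num_real//.
have : 0 <= `|complex.Re z| * `|complex.Im z| by rewrite mulr_ge0.
by rewrite !mulr2n; nra.
Qed.

Lemma cmod_eq0 z : (cmod z == 0) = (z == 0).
Proof.
apply/eqP/eqP => [/ComplexField.Normc.eq0_normc //|->]; exact: cmod0.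
Qed.

Lemma cmodi : cmod (0 +i* 1 : R[i]) = 1.
Proof. by rewrite cmodE /= expr0n expr1n add0r sqrtr1. Qed.

Lemma cmod_nat n : cmod (n%:R : R[i]) = n%:R.
Proof.
have -> : (n%:R : R[i]) = (n%:R : R)%:C by rewrite rmorph_nat.
by rewrite cmod_real normr_nat.
Qed.

Lemma cmodX z n : cmod (z ^+ n) = cmod z ^+ n.
Proof.
by elim: n => [|n IH]; [rewrite !expr0 (cmod_nat 1)|rewrite !exprS cmodM IH].
Qed.

Lemma cmodV z : cmod z^-1 = (cmod z)^-1.
Proof. exact: ComplexField.Normc.normcV. Qed.

Lemma complex_ReIm z : z = complex.Re z +i* complex.Im z.
Proof. by case: z. Qed.

Lemma cReD z u : complex.Re (z + u) = complex.Re z + complex.Re u.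
Proof. by case: z; case: u. Qed.
Lemma cImD z u : complex.Im (z + u) = complex.Im z + complex.Im u.
Proof. by case: z; case: u. Qed.
Lemma cReN z : complex.Re (- z) = - complex.Re z.
Proof. by case: z. Qed.
Lemma cImN z : complex.Im (- z) = - complex.Im z.
Proof. by case: z. Qed.
Lemma cReM z u :
  complex.Re (z * u) = complex.Re z * complex.Re u - complex.Im z * complex.Im u.
Proof. by case: z; case: u. Qed.
Lemma cImM z u :
  complex.Im (z * u) = complex.Re z * complex.Im u + complex.Im z * complex.Re u.
Proof. by case: z; case: u. Qed.
Lemma eqcP z u : complex.Re z = complex.Re u -> complex.Im z = complex.Im u ->
  z = u.
Proof. by case: z; case: u => /= ? ? ? ? -> ->. Qed.

Lemma real_complexN (x : R) : (- x)%:C = - x%:C :> R[i].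
Proof. exact: rmorphN. Qed.
Lemma real_complexD (x y : R) : (x + y)%:C = x%:C + y%:C :> R[i].
Proof. exact: rmorphD. Qed.
Lemma real_complexM (x y : R) : (x * y)%:C = x%:C * y%:C :> R[i].
Proof. exact: rmorphM. Qed.
Lemma real_complexV (x : R) : (x^-1)%:C = (x%:C)^-1 :> R[i].
Proof. exact: fmorphV. Qed.
Lemma real_complex_eq0 (x : R) : (x%:C == 0 :> R[i]) = (x == 0).
Proof. exact: fmorph_eq0. Qed.

End Modulus.

Definition Rec {R : realType} {T : Type} (f : T -> R[i]) x : R := complex.Re (f x).
Definition Imc {R : realType} {T : Type} (f : T -> R[i]) x : R := complex.Im (f x).

Section ReImFun.
Context {R : realType} {T : Type}.
Implicit Types f g : T -> R[i].

Lemma RecD f g : Rec (fun x => f x + g x) = (fun x => Rec f x + Rec g x).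
Proof. by apply/funext => x; exact: cReD. Qed.
Lemma ImcD f g : Imc (fun x => f x + g x) = (fun x => Imc f x + Imc g x).
Proof. by apply/funext => x; exact: cImD. Qed.
Lemma RecM f g : Rec (fun x => f x * g x) =
  (fun x => Rec f x * Rec g x - Imc f x * Imc g x).
Proof. by apply/funext => x; exact: cReM. Qed.
Lemma ImcM f g : Imc (fun x => f x * g x) =
  (fun x => Rec f x * Imc g x + Imc f x * Rec g x).
Proof. by apply/funext => x; exact: cImM. Qed.

End ReImFun.

Section Derivative.
Context {R : realType}.
Implicit Types (f g : R -> R[i]) (x : R) (c : R[i]).

Definition is_derivec x f (d : R[i]) :=
  is_derive x 1 (Rec f) (complex.Re d) /\ is_derive x 1 (Imc f) (complex.Im d).

Definition continuousc f := continuous (Rec f) /\ continuous (Imc f).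

Lemma is_derivec_val x f d : is_derivec x f d -> derive1c f x = d.
Proof.
case=> h1 h2; rewrite [RHS]complex_ReIm; congr (_ +i* _); rewrite derive1E.
  by have := @derive_val _ _ _ _ _ _ _ h1.
by have := @derive_val _ _ _ _ _ _ _ h2.
Qed.

Lemma is_derivecP x f : derivable (Rec f) x 1 -> derivable (Imc f) x 1 ->
  is_derivec x f (derive1c f x).
Proof. by move=> h1 h2; split; rewrite /= derive1E; apply/derivableP. Qed.

Lemma is_derivec_eq x f d d' : is_derivec x f d -> d = d' -> is_derivec x f d'.
Proof. by move=> ? <-. Qed.

Lemma eq_is_derivec x f g d : is_derivec x f d -> f =1 g -> is_derivec x g d.
Proof. by move=> ? /funext <-. Qed.

Lemma is_derivec_cst x c : is_derivec x (fun=> c) 0.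
Proof. by split; rewrite /=; apply: is_derive_cst. Qed.

Lemma is_derivecD x f g df dg : is_derivec x f df -> is_derivec x g dg ->
  is_derivec x (fun y => f y + g y) (df + dg).
Proof.
move=> [f1 f2] [g1 g2]; split.
  by rewrite RecD cReD; apply: is_deriveD.
by rewrite ImcD cImD; apply: is_deriveD.
Qed.

Lemma is_derivecN x f df : is_derivec x f df ->
  is_derivec x (fun y => - f y) (- df).
Proof.
move=> [f1 f2]; split.
  have -> : Rec (fun y => - f y) = - Rec f.
    by apply/funext => y; rewrite /Rec cReN.
  by rewrite cReN; apply: is_deriveN.
have -> : Imc (fun y => - f y) = - Imc f.
  by apply/funext => y; rewrite /Imc cImN.
by rewrite cImN; apply: is_deriveN.
Qed.

Lemma is_derivecB x f g df dg : is_derivec x f df -> is_derivec x g dg ->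
  is_derivec x (fun y => f y - g y) (df - dg).
Proof. by move=> hf hg; apply: is_derivecD => //; apply: is_derivecN. Qed.

Lemma is_derivecM x f g df dg : is_derivec x f df -> is_derivec x g dg ->
  is_derivec x (fun y => f y * g y) (df * g x + f x * dg).
Proof.
move=> [f1 f2] [g1 g2]; split.
  rewrite RecM; apply: is_derive_eq; rewrite /Rec /Imc !cReD !cReM -![_ *: _]/(_ * _); ring.
rewrite ImcM; apply: is_derive_eq; rewrite /Rec /Imc !cImD !cImM -![_ *: _]/(_ * _); ring.
Qed.

Lemma is_derivecZ x c f df : is_derivec x f df ->
  is_derivec x (fun y => c * f y) (c * df).
Proof.
by move=> h; apply: (is_derivec_eq (is_derivecM (is_derivec_cst x c) h)); ring.
Qed.

Lemma is_derivec_real x (f : R -> R) df : is_derive x 1 f df ->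
  is_derivec x (fun y => (f y)%:C) df%:C.
Proof. by move=> h; split => //=; apply: is_derive_cst. Qed.

Lemma is_derivec_scale x a f df : is_derivec (a * x) f df ->
  is_derivec x (fun y => f (a * y)) (a%:C * df).
Proof.
have h0 : is_derive x 1 (fun y : R => a * y) a.
  by apply: is_derive_eq; rewrite -![_ *: _]/(_ * _) mulr1.
move=> [f1 f2]; split.
  have := @is_derive1_comp R (Rec f) (fun y => a * y) x _ _ f1 h0.
  by move=> h; apply: is_derive_eq; rewrite cReM /= mul0r subr0 mulrC.
have := @is_derive1_comp R (Imc f) (fun y => a * y) x _ _ f2 h0.
by move=> h; apply: is_derive_eq; rewrite cImM /= mul0r addr0 mulrC.
Qed.

Lemma is_derivec_opp x f df : is_derivec (- x) f df ->
  is_derivec x (fun y => f (- y)) (- df).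
Proof.
move=> h; apply: eq_is_derivec; last first.
  by move=> y; rewrite -mulN1r; reflexivity.
by apply: (is_derivec_eq (is_derivec_scale (a := -1) (x := x) (df := df) _));
  rewrite ?mulN1r // rmorphN rmorph1 mulN1r.
Qed.

Lemma is_derivec_continuous f f' : (forall x, is_derivec x f (f' x)) ->
  continuousc f.
Proof.
move=> h; split=> x; apply: differentiable_continuous; apply/derivable1_diffP.
  by case: (h x) => [[]].
by case: (h x) => [_ []].
Qed.

Lemma continuousc_cst c : continuousc (fun=> c).
Proof. by split=> x; apply: cvg_cst. Qed.

Lemma continuousc_real (f : R -> R) : continuous f ->
  continuousc (fun x => (f x)%:C).
Proof. by split => // x; apply: cvg_cst. Qed.

Lemma continuouscD f g : continuousc f -> continuousc g ->
  continuousc (fun x => f x + g x).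
Proof.
move=> [f1 f2] [g1 g2]; split=> x.
  rewrite RecD /continuous_at.
  by apply: cvgD; [apply: f1|apply: g1].
rewrite ImcD /continuous_at.
by apply: cvgD; [apply: f2|apply: g2].
Qed.

Lemma continuouscM f g : continuousc f -> continuousc g ->
  continuousc (fun x => f x * g x).
Proof.
move=> [f1 f2] [g1 g2]; split=> x.
  rewrite RecM /continuous_at.
  by apply: cvgB; apply: cvgM;
    [apply: f1|apply: g1|apply: f2|apply: g2].
rewrite ImcM /continuous_at.
by apply: cvgD; apply: cvgM;
  [apply: f1|apply: g2|apply: f2|apply: g1].
Qed.

Lemma continuousc_comp f (h : R -> R) : continuousc f -> continuous h ->
  continuousc (fun x => f (h x)).
Proof.
move=> [f1 f2] hh; split=> x.
  by apply: (@continuous_comp _ _ _ h (Rec f)); [apply: hh|apply: f1].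
by apply: (@continuous_comp _ _ _ h (Imc f)); [apply: hh|apply: f2].
Qed.

Lemma continuousc_cmod f : continuousc f -> continuous (fun x => cmod (f x)).
Proof.
move=> [f1 f2] x.
rewrite (_ : (fun x => cmod (f x)) =
  Num.sqrt \o (fun x => Rec f x ^+ 2 + Imc f x ^+ 2)); last first.
  by apply/funext => y; rewrite /= cmodE.
apply: continuous_comp; last exact: sqrt_continuous.
apply: cvgD.
  by under eq_fun do rewrite expr2; rewrite expr2; apply: cvgM; apply: f1.
by under eq_fun do rewrite expr2; rewrite expr2; apply: cvgM; apply: f2.
Qed.

End Derivative.

(** * Integration of complex-valued functions *)

Definition integrableR {R : realType} (f : R -> R) : Prop :=
  (@lebesgue_measure R).-integrable setT (EFin \o f).
Definition integrablec {R : realType} (f : R -> R[i]) : Prop :=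
  integrableR (Rec f) /\ integrableR (Imc f).
Definition measurablec {R : realType} (f : R -> R[i]) : Prop :=
  measurable_fun setT (Rec f) /\ measurable_fun setT (Imc f).

Section Integral.
Context {R : realType}.
Local Notation mu := (@lebesgue_measure R).
Implicit Types (f g : R -> R[i]) (h : R -> R) (c : R[i]).

Lemma integrableR_le (f g : R -> R) : measurable_fun setT f ->
  (forall x, `|f x| <= g x) -> integrableR g -> integrableR f.
Proof.
move=> mf fg; apply: le_integrable => //; first exact/measurable_EFinP.
by move=> x _ /=; rewrite lee_fin (le_trans (fg x)) // ler_norm.
Qed.

Lemma integrableR_measurable h : integrableR h -> measurable_fun setT h.
Proof. by move=> /integrableP[/measurable_EFinP]. Qed.

Lemma integrableRD (f g : R -> R) : integrableR f -> integrableR g ->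
  integrableR (fun x => f x + g x).
Proof. by move=> hf hg; exact: (integrableD measurableT hf hg). Qed.

Lemma integrableRZ a (f : R -> R) : integrableR f ->
  integrableR (fun x => a * f x).
Proof. by move=> hf; exact: (integrableZl measurableT a hf). Qed.

Lemma integrableRB (f g : R -> R) : integrableR f -> integrableR g ->
  integrableR (fun x => f x - g x).
Proof. by move=> hf hg; exact: (integrableB measurableT hf hg). Qed.

Lemma measurablecD f g : measurablec f -> measurablec g ->
  measurablec (fun x => f x + g x).
Proof.
move=> [f1 f2] [g1 g2]; split.
  by rewrite RecD; apply: measurable_funD.
by rewrite ImcD; apply: measurable_funD.
Qed.

Lemma measurablecM f g : measurablec f -> measurablec g ->
  measurablec (fun x => f x * g x).
Proof.
move=> [f1 f2] [g1 g2]; split.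
  rewrite RecM.
  by apply: measurable_funB; apply: measurable_funM.
rewrite ImcM.
by apply: measurable_funD; apply: measurable_funM.
Qed.

Lemma measurablec_cst c : measurablec (fun _ : R => c).
Proof. by split; exact: measurable_cst. Qed.

Lemma measurablecZ c f : measurablec f -> measurablec (fun x => c * f x).
Proof. by move=> hf; apply: measurablecM => //; exact: measurablec_cst. Qed.

Lemma measurablec_real h : measurable_fun setT h ->
  measurablec (fun x => (h x)%:C).
Proof. by move=> ?; split => //; exact: measurable_cst. Qed.

Lemma measurablec_cmod f : measurablec f ->
  measurable_fun setT (fun x => cmod (f x)).
Proof.
move=> [f1 f2].
rewrite (_ : (fun x => cmod (f x)) =
  Num.sqrt \o (fun x => Rec f x ^+ 2 + Imc f x ^+ 2)); last first.
  by apply/funext => y; rewrite /= cmodE.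
apply: measurableT_comp; last first.
  by apply: measurable_funD; apply: measurable_funX.
by apply: continuous_measurable_fun => ?; exact: sqrt_continuous.
Qed.

Lemma continuous_measurablec f : continuousc f -> measurablec f.
Proof. by move=> [f1 f2]; split; exact: continuous_measurable_fun. Qed.

Lemma integrablec_le f h : measurablec f -> (forall x, cmod (f x) <= h x) ->
  integrableR h -> integrablec f.
Proof.
move=> [m1 m2] fh ih; split; apply: integrableR_le ih => // x.
  exact: le_trans (normr_Re_le _) (fh x).
exact: le_trans (normr_Im_le _) (fh x).
Qed.

Lemma integrablec_measurable f : integrablec f -> measurablec f.
Proof. by move=> [f1 f2]; split; exact: integrableR_measurable. Qed.

Lemma integrablec_cmod f : integrablec f -> integrableR (fun x => cmod (f x)).
Proof.
move=> hf; have [f1 f2] := hf.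
apply: (@integrableR_le _ (fun x => `|Rec f x| + `|Imc f x|)).
- by apply: measurablec_cmod; exact: integrablec_measurable.
- by move=> x; rewrite ger0_norm ?cmod_ge0 //; exact: cmod_le_ReIm.
- by apply: integrableRD; apply: integrable_norm.
Qed.

Lemma integrablecD f g : integrablec f -> integrablec g ->
  integrablec (fun x => f x + g x).
Proof.
move=> [f1 f2] [g1 g2]; split.
  by rewrite RecD; exact: integrableRD.
by rewrite ImcD; exact: integrableRD.
Qed.

Lemma integrablecZ c f : integrablec f -> integrablec (fun x => c * f x).
Proof.
move=> [f1 f2]; split.
  by rewrite RecM;
    apply: integrableRB; exact: integrableRZ.
by rewrite ImcM;
  apply: integrableRD; exact: integrableRZ.
Qed.

Lemma integralcD f g : integrablec f -> integrablec g ->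
  integralc (fun x => f x + g x) = integralc f + integralc g.
Proof.
move=> [f1 f2] [g1 g2]; apply: eqcP; [rewrite [RHS]cReD|rewrite [RHS]cImD] => /=.
  by rewrite -RintegralD //; apply: eq_Rintegral => x _; rewrite cReD.
by rewrite -RintegralD //; apply: eq_Rintegral => x _; rewrite cImD.
Qed.

Lemma integralcZ c f : integrablec f ->
  integralc (fun x => c * f x) = c * integralc f.
Proof.
move=> [f1 f2]; apply: eqcP; [rewrite [RHS]cReM|rewrite [RHS]cImM] => /=.
  rewrite -!RintegralZl // -RintegralB //; try exact: integrableRZ.
  by apply: eq_Rintegral => x _; rewrite cReM.
rewrite -!RintegralZl // -RintegralD //; try exact: integrableRZ.
by apply: eq_Rintegral => x _; rewrite cImM.
Qed.

Lemma integrablecN f : integrablec f -> integrablec (fun x => - f x).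
Proof.
move=> /(integrablecZ (-1)); congr integrablec.
by apply/funext => x; rewrite mulN1r.
Qed.

Lemma integralcN f : integrablec f ->
  integralc (fun x => - f x) = - integralc f.
Proof.
move=> hf; rewrite -mulN1r -integralcZ //; congr integralc.
by apply/funext => x; rewrite mulN1r.
Qed.

Lemma integralcB f g : integrablec f -> integrablec g ->
  integralc (fun x => f x - g x) = integralc f - integralc g.
Proof.
move=> hf hg; rewrite integralcD ?integralcN //; exact: integrablecN.
Qed.

(** Real and imaginary parts are bounded separately, whence the factor 2; constants are harmless for
    the final limit. *)
Lemma cmod_integralc_le f h : integrablec f -> (forall x, cmod (f x) <= h x) ->
  integrableR h -> cmod (integralc f) <= 2 * \int[mu]_x h x.
Proof.
move=> hf fh ih; have [f1 f2] := hf.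
rewrite (le_trans (cmod_le_ReIm _)) //= mulr_natl mulr2n.
apply: lerD; (rewrite (le_trans (le_normr_Rintegral _ _)) //;
  apply: le_Rintegral => //; first exact: integrable_norm) => x _.
  exact: le_trans (normr_Re_le _) (fh x).
exact: le_trans (normr_Im_le _) (fh x).
Qed.

Let mscaleT (a : R) : measurable_fun setT
  (fun x : measurableTypeR R => (a * x : measurableTypeR R)).
Proof. exact: measurable_funM. Qed.

Let dilation (a : R) : {measure set (measurableTypeR R) -> \bar R} :=
  measure_function_pushforward__canonical__measure_function_Measure
    lebesgue_measure (mscaleT a).

(** Both measures agree on half-open intervals, and this determines the Lebesgue measure. It yields
    the change of variables [x -> a * x]. *)
Lemma lebesgue_measure_scale (a : R) (a0 : 0 < a) (A : set (measurableTypeR R)) :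
  measurable A -> lebesgue_measure A = mscale (NngNum (ltW a0)) (dilation a) A.
Proof.
move=> mA; apply: lebesgue_measure_unique => //.
move=> _ [[b c]] _ <- /=.
rewrite /mscale /= /pushforward.
rewrite (_ : _ @^-1` _ = `](b / a), (c / a)]%classic); last first.
  apply/seteqP; split=> x /=; rewrite !in_itv /=;
    by rewrite ltr_pdivrMr // ler_pdivlMr // mulrC.
rewrite !lebesgue_measure_itv /= !lte_fin ltr_pM2r ?invr_gt0 //.
case: ifPn => _; last by rewrite mule0.
by rewrite -!EFinB -EFinM; congr EFin; field; rewrite gt_eqF.
Qed.

Lemma ge0_integral_scale (a : R) (h : R -> \bar R) : 0 < a ->
  measurable_fun setT h -> (forall x, 0 <= h x)%E ->
  (\int[mu]_x h x = a%:E * \int[mu]_x h (a * x)%R)%E.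
Proof.
move=> a0 mh h0.
rewrite (eq_measure_integral _ (fun A mA _ => lebesgue_measure_scale a0 mA)).
rewrite (ge0_integral_mscale (dilation a) measurableT (NngNum (ltW a0)) mh) //.
by rewrite ge0_integral_pushforward.
Qed.

Lemma integrableR_scale (a : R) h : 0 < a -> integrableR h ->
  integrableR (fun x => h (a * x)).
Proof.
move=> a0 hh; have mh := integrableR_measurable hh.
have mha : measurable_fun setT (fun x => h (a * x)).
  exact: (measurable_comp measurableT _ mh (mscaleT a)).
apply/integrableP; split; first exact/measurable_EFinP.
move/integrableP : hh => [_].
rewrite (@ge0_integral_scale a (fun x => `|(h x)%:E|%E)) //; last first.
  by apply: measurableT_comp => //; exact/measurable_EFinP.
set I := (\int[_]_ _ _)%E; rewrite -/I.
have : (0 <= I)%E by apply: integral_ge0.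
case: I => [r _ _| _|//]; first by rewrite ltry.
by rewrite gt0_muley ?lte_fin // ltxx.
Qed.

Lemma Rintegral_scale (a : R) h : 0 < a -> integrableR h ->
  \int[mu]_x h x = a * \int[mu]_x h (a * x).
Proof.
move=> a0 hh; have hha := integrableR_scale a0 hh.
have mh := integrableR_measurable hh.
rewrite /Rintegral [in LHS]integralE [in RHS]integralE.
rewrite (@ge0_integral_scale a _ a0 (measurable_funepos _)) //; last first.
  exact/measurable_EFinP.
rewrite (@ge0_integral_scale a _ a0 (measurable_funeneg _)) //; last first.
  exact/measurable_EFinP.
have -> : (\int[mu]_x ((EFin \o h)^\+ (a * x)%R) =
          \int[mu]_x ((EFin \o (fun x => h (a * x)%R))^\+ x))%E.
  by apply: eq_integral => x _; rewrite !funeposE.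
have -> : (\int[mu]_x ((EFin \o h)^\- (a * x)%R) =
          \int[mu]_x ((EFin \o (fun x => h (a * x)%R))^\- x))%E.
  by apply: eq_integral => x _; rewrite !funenegE.
have /fineK <- := integrable_pos_fin_num measurableT hha.
have /fineK <- := integrable_neg_fin_num measurableT hha.
by rewrite /= mulrBr.
Qed.

Lemma ge0_integral_opp (h : R -> \bar R) :
  measurable_fun setT h -> (forall x, 0 <= h x)%E ->
  (\int[mu]_x h x = \int[mu]_x h (- x)%R)%E.
Proof.
move=> mh h0.
rewrite (eq_measure_integral (pushforward mu (-%R : _ -> measurableTypeR R)));
  last by move=> A mA _; rewrite -[LHS]lebesgue_measureN.
by rewrite ge0_integral_pushforward.
Qed.

Lemma integrableR_opp h : integrableR h -> integrableR (fun x => h (- x)).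
Proof.
move=> hh; have mh := integrableR_measurable hh.
have mha : measurable_fun setT (fun x : R => h (- x)).
  exact: (measurable_comp measurableT _ mh).
apply/integrableP; split; first exact/measurable_EFinP.
move/integrableP : hh => [_].
rewrite (@ge0_integral_opp (fun x => `|(h x)%:E|%E)) //.
by apply: measurableT_comp => //; exact/measurable_EFinP.
Qed.

Lemma Rintegral_opp h : integrableR h ->
  \int[mu]_x h x = \int[mu]_x h (- x).
Proof.
move=> hh.
have mh := integrableR_measurable hh.
rewrite /Rintegral [in LHS]integralE [in RHS]integralE.
rewrite (@ge0_integral_opp _ (measurable_funepos _)) //; last first.
  exact/measurable_EFinP.
rewrite (@ge0_integral_opp _ (measurable_funeneg _)) //; last first.
  exact/measurable_EFinP.
by congr (fine (_ - _)); apply: eq_integral => x _; rewrite ?funeposE ?funenegE.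
Qed.

Lemma integralc_scale (a : R) f : 0 < a -> integrablec f ->
  integralc f = a%:C * integralc (fun x => f (a * x)).
Proof.
move=> a0 [f1 f2]; apply: eqcP; rewrite ?cReM ?cImM /= mul0r ?subr0 ?addr0.
  exact: Rintegral_scale.
exact: Rintegral_scale.
Qed.

Lemma integralc_opp f : integrablec f ->
  integralc f = integralc (fun x => f (- x)).
Proof. by move=> [f1 f2]; congr (_ +i* _); exact: Rintegral_opp. Qed.

Lemma integrablec_opp f : integrablec f -> integrablec (fun x => f (- x)).
Proof. by move=> [f1 f2]; split;
  [exact: (integrableR_opp f1)|exact: (integrableR_opp f2)]. Qed.

Lemma integrablec_scale (a : R) f : 0 < a -> integrablec f ->
  integrablec (fun x => f (a * x)).
Proof. by move=> a0 [f1 f2]; split;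
  [exact: (integrableR_scale a0 f1)|exact: (integrableR_scale a0 f2)]. Qed.

End Integral.

(** * Rapid decay and the weight *)

Section Decay.
Context {R : realType}.
Local Notation mu := (@lebesgue_measure R).
Implicit Types (f g : R -> R[i]) (h : R -> R) (c : R[i]).

(** The decay half of the Schwartz condition, kept apart from regularity because it also has to be
    stated for transforms and for bumps of finite smoothness. *)
Definition rapid f := forall m : nat, exists M : R, forall x : R,
  `|x| ^+ m * cmod (f x) <= M.

Lemma rapid_le f g M : rapid g -> (forall x, cmod (f x) <= M * cmod (g x)) ->
  rapid f.
Proof.
move=> hg fg m; have [A hA] := hg m; exists (`|M| * A) => x.
apply: (@le_trans _ _ (`|x| ^+ m * (`|M| * cmod (g x)))).
  rewrite ler_wpM2l ?exprn_ge0 // (le_trans (fg x)) // ler_wpM2r ?cmod_ge0 //.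
  exact: ler_norm.
by rewrite mulrCA ler_wpM2l.
Qed.

Lemma rapidD f g : rapid f -> rapid g -> rapid (fun x => f x + g x).
Proof.
move=> hf hg m; have [A hA] := hf m; have [B hB] := hg m.
exists (A + B) => x; apply: le_trans (lerD (hA x) (hB x)).
by rewrite -mulrDr ler_wpM2l ?exprn_ge0 // ler_cmodD.
Qed.

Lemma rapidZ c f : rapid f -> rapid (fun x => c * f x).
Proof.
by move=> hf; apply: (rapid_le (M := cmod c) hf) => x; rewrite cmodM.
Qed.

Lemma rapidMl f (b : R -> R[i]) M : rapid f -> (forall x, cmod (b x) <= M) ->
  rapid (fun x => f x * b x).
Proof.
move=> hf hb; apply: (rapid_le (M := M) hf) => x.
by rewrite cmodM mulrC ler_wpM2r ?cmod_ge0.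
Qed.

Lemma rapidX f n : rapid f -> rapid (fun x => x%:C ^+ n * f x).
Proof.
move=> hf m; have [A hA] := hf (m + n)%N; exists A => x.
by rewrite cmodM cmodX cmod_real mulrA -exprD.
Qed.

Lemma rapid_opp f : rapid f -> rapid (fun x => f (- x)).
Proof.
by move=> hf m; have [A hA] := hf m; exists A => x; rewrite -normrN.
Qed.

Lemma integrableR_oneDsqrV : integrableR (fun x : R => (1 + x ^+ 2)^-1).
Proof.
have mf : measurable_fun setT (fun x : R => (1 + x ^+ 2)^-1).
  apply: continuous_measurable_fun => x; exact: (@continuous_oneDsqrV R).
apply/integrableP; split; first exact/measurable_EFinP.
have f0 x : 0 <= (1 + x ^+ 2 : R)^-1 by rewrite invr_ge0 addr_ge0 // sqr_ge0.
under eq_integral do rewrite gee0_abs ?lee_fin //.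
rewrite (@ge0_symfun_integralT R (fun x => (1 + x ^+ 2)^-1)) //.
- by rewrite -set_itvcy (@integral0y_oneDsqr R) -EFinM ltry.
- by move=> x; exact: (@continuous_oneDsqrV R).
- by move=> x /=; rewrite sqrrN.
Qed.

Variable k : R[i].
Hypothesis hk : 0 <= complex.Re k.
Local Notation w := (dunkl_weight k).
Local Notation a := (complex.Re k).

Lemma cmod_weight x : cmod (w x) = `|x| `^ (2 * a).
Proof.
by rewrite cmodE /= !exprMn -mulrDr cos2Dsin2 mulr1 sqrtr_sqr ger0_norm // powR_ge0.
Qed.

Lemma weightN x : w (- x) = w x.
Proof. by rewrite /dunkl_weight normrN. Qed.

Lemma weight_measurable : measurablec w.
Proof.
have m1 : measurable_fun setT (fun x : R => `|x| `^ (2 * a)).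
  exact: (measurableT_comp (measurable_powR _)).
have m2 : measurable_fun setT (fun x : R => 2 * complex.Im k * ln `|x|).
  have ml : measurable_fun setT (fun x : R => ln `|x|).
    exact: (measurableT_comp (@measurable_ln R)).
  exact: (measurable_funM (measurable_cst _) ml).
have mc : measurable_fun setT (fun x : R => cos (2 * complex.Im k * ln `|x|)).
  apply: (measurable_comp measurableT _ _ m2) => //.
  by apply: continuous_measurable_fun; exact: continuous_cos.
have ms : measurable_fun setT (fun x : R => sin (2 * complex.Im k * ln `|x|)).
  apply: (measurable_comp measurableT _ _ m2) => //.
  by apply: continuous_measurable_fun; exact: continuous_sin.
by split; [exact: (measurable_funM m1 mc)|exact: (measurable_funM m1 ms)].
Qed.

Lemma weightM s x : 0 < s -> x != 0 -> w (s * x) = w s * w x.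
Proof.
move=> s0 x0; have nx0 : 0 < `|x| by rewrite normr_gt0.
rewrite /dunkl_weight normrM (gtr0_norm s0) powRM ?ltW // lnM ?posrE //.
rewrite mulrDr cosD sinD; apply: eqcP; rewrite ?cReM ?cImM /=; ring.
Qed.

Lemma weight_neq0 x : x != 0 -> w x != 0.
Proof.
by move=> x0; rewrite -cmod_eq0 cmod_weight gt_eqF // powR_gt0 // normr_gt0.
Qed.

(** On [|x| <= 1] the power is at most 1 because its exponent is nonnegative; beyond, the exponent
    is rounded up to an integer. This [L] fixes the orders of decay needed for integrability against
    the weight. *)
Lemma weight_exponent : exists L : nat, forall x : R, `|x| `^ (2 * a) <= 1 + `|x| ^+ L.
Proof.
have a0 : 0 <= 2 * a by rewrite mulr_ge0.
exists (Num.bound (2 * a)) => x.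
have [x1|x1] := leP `|x| 1.
  rewrite (@le_trans _ _ 1) ?lerDl ?exprn_ge0 //.
  have e1 : (1 : R) `^ (2 * a) = 1 by rewrite powR1.
  by rewrite -[leRHS]e1; apply: ge0_ler_powR; rewrite ?nnegrE.
rewrite (@le_trans _ _ (`|x| ^+ (Num.bound (2 * a)))) ?lerDr //.
rewrite -powR_mulrn // ler_powR ?(ltW x1) //.
exact: ltW (archi_boundP a0).
Qed.

Lemma rapid_weight_le f : rapid f -> exists2 M, 0 <= M & forall x : R,
  cmod (f x) * `|x| `^ (2 * a) <= M * (1 + x ^+ 2)^-1.
Proof.
move=> hf; have [L hL] := weight_exponent.
(* The orders 0, 2, [L] and [L + 2] are the monomials of [(1 + |x|^2) * (1 + |x|^L)]. *)
have [A hA] := hf 0; have [B hB] := hf 2; have [C hC] := hf L.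
have [D hD] := hf (L + 2)%N.
exists (`|A + B + C + D|) => // x.
have c0 := cmod_ge0 (f x).
have x20 : 0 < 1 + x ^+ 2 by rewrite ltr_pwDl // sqr_ge0.
rewrite ler_pdivlMr // (le_trans _ (ler_norm _)) //.
apply: (@le_trans _ _ (cmod (f x) * (1 + `|x| ^+ L) * (1 + x ^+ 2))).
  by rewrite ler_wpM2r ?(ltW x20) // ler_wpM2l.
have := lerD (lerD (lerD (hA x) (hB x)) (hC x)) (hD x).
apply: le_trans; rewrite exprD expr0 real_normK ?num_real //.
rewrite le_eqVlt; apply/orP; left; apply/eqP; ring.
Qed.

Lemma rapid_weight_integrable f : measurablec f -> rapid f ->
  integrablec (fun x => f x * w x).
Proof.
move=> mf /rapid_weight_le[M M0 hM].
apply: (@integrablec_le _ _ (fun x => M * (1 + x ^+ 2)^-1)).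
- by apply: measurablecM => //; exact: weight_measurable.
- by move=> x; rewrite cmodM cmod_weight.
- by apply: integrableRZ; exact: integrableR_oneDsqrV.
Qed.

End Decay.

(** * The Dunkl kernel *)

Section Energy.
Context {R : realType}.
Variables (k : R[i]) (l : R).
Hypothesis hk : 0 <= complex.Re k.

(* By the equation, [|u x|^2 + |u (- x)|^2] has derivative
   [- 2 Re k |u x - u (- x)|^2 / x] at [x > 0]. *)
Lemma eigen_energy (u u' : R -> R[i]) :
  (forall x, is_derivec x u (u' x)) ->
  (forall x : R, x != 0 ->
    u' x + k * ((u x - u (- x)) / x%:C) = (0 +i* 1) * l%:C * u x) ->
  forall x, cmod (u x) ^+ 2 + cmod (u (- x)) ^+ 2 <= 2 * cmod (u 0) ^+ 2.
Proof.
move=> du hu.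
pose v x := u (- x).
have dv x : is_derivec x v (- u' (- x)) by exact: is_derivec_opp.
pose E x := Rec u x * Rec u x + Imc u x * Imc u x +
  (Rec v x * Rec v x + Imc v x * Imc v x).
have EE x : E x = cmod (u x) ^+ 2 + cmod (u (- x)) ^+ 2.
  by rewrite !cmod_sqr /E /v /Rec /Imc !expr2.
pose E' x := 2 * (Rec u x * complex.Re (u' x) + Imc u x * complex.Im (u' x)) -
  2 * (Rec v x * complex.Re (u' (- x)) + Imc v x * complex.Im (u' (- x))).
have dE (x : R) : is_derive x 1 E (E' x).
  have [d1 d2] := du x; have [d3 d4] := dv x.
  apply: is_derive_eq; rewrite /E' cReN cImN -![_ *: _]/(_ * _); ring.
have E'le (x : R) : 0 < x -> E' x <= 0.
  move=> x0; have x0' : x != 0 by rewrite gt_eqF.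
  have Nx0 : - x != 0 by rewrite oppr_eq0.
  have ix0 : 0 <= x^-1 by rewrite invr_ge0 ltW.
  have e1 : u' x = (0 +i* 1) * l%:C * u x - k * ((u x - v x) * (x^-1)%:C).
    by rewrite -(hu _ x0') /v fmorphV; ring.
  have e2 : u' (- x) = (0 +i* 1) * l%:C * v x - k * ((u x - v x) * (x^-1)%:C).
    rewrite /v -(hu _ Nx0) opprK fmorphV rmorphN invrN; ring.
  have -> : E' x = - (2 * complex.Re k * x^-1 *
      ((Rec u x - Rec v x) ^+ 2 + (Imc u x - Imc v x) ^+ 2)).
    rewrite /E' e1 e2 /Rec /Imc.
    case: (k) => ka kb; case: (u x) => p q; case: (v x) => r s.
    by rewrite !(cReM, cImM, cReD, cImD, cReN, cImN) /=; field.
  rewrite oppr_le0; apply: mulr_ge0; last by rewrite addr_ge0 ?sqr_ge0.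
  have h2 : 0 <= 2 * complex.Re k by rewrite mulr_ge0.
  exact: mulr_ge0 h2 ix0.
have EN (x : R) : E (- x) = E x by rewrite !EE opprK addrC.
have Epos (x : R) : 0 <= x -> E x <= E 0.
  move=> x0; apply: (@ler0_derive1_nincry _ E 0) => //.
  - move=> y; rewrite in_itv /= andbT => y0.
    by rewrite derive1E (@derive_val _ _ _ _ _ _ _ (dE y)) E'le.
  - apply: continuous_subspaceT => y.
    apply: differentiable_continuous; apply/derivable1_diffP.
    by have [? _] := dE y.
move=> x; rewrite -EE.
have -> : 2 * cmod (u 0) ^+ 2 = E 0 by rewrite EE oppr0 mulr_natl mulr2n.
have [x0|x0] := leP 0 x; first exact: Epos.
by rewrite -EN Epos // oppr_ge0 ltW.
Qed.

(** A solution vanishing at 0 vanishes identically, so this bound also gives the uniqueness of the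
    kernel. The constant 2 is [sqrt 2] rounded up. *)
Lemma eigen_bound (u u' : R -> R[i]) :
  (forall x, is_derivec x u (u' x)) ->
  (forall x : R, x != 0 ->
    u' x + k * ((u x - u (- x)) / x%:C) = (0 +i* 1) * l%:C * u x) ->
  forall x, cmod (u x) <= 2 * cmod (u 0).
Proof.
move=> du hu x; have := eigen_energy du hu x => h.
rewrite -(@ler_pXn2r _ 2) ?nnegrE ?cmod_ge0 ?mulr_ge0 ?cmod_ge0 //.
rewrite exprMn; have := sqr_ge0 (cmod (u (- x))).
have := sqr_ge0 (cmod (u 0)); lra.
Qed.

End Energy.

Section ComplexDerivative.
Context {R : realType}.
Implicit Types (f : R[i] -> R[i]).

Lemma cderivable_expansion f (z : R[i]) :
  derivable (f : R[i]^o -> R[i]^o) z 1 ->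
  forall e : R, 0 < e -> exists2 d : R, 0 < d & forall h : R[i], cmod h < d ->
    cmod (f (z + h) - f z - h * derive1 (f : R[i]^o -> R[i]^o) z) <= e * cmod h.
Proof.
move=> df e e0.
have /cvgrPdist_le := df => /(_ e%:C).
rewrite ltcR => /(_ e0) [d /= d0 H].
(* The radius is an element of [R[i]]; being positive, it is real. *)
have dr : d = (complex.Re d)%:C.
  by move: d0; rewrite ltcE /= => /andP[/eqP]; case: (d) => x y /= ->.
exists (complex.Re d); first by move: d0; rewrite dr ltcR.
move=> h hd; have [->|h0] := eqVneq h 0.
  by rewrite addr0 subrr mul0r subr0 cmod0 mulr0.
have := H h; rewrite /= sub0r normrN.
have nE (x : R[i]) : `|x| = (cmod x)%:C by rewrite normc_def cmodE.
rewrite nE [X in _ < X -> _]dr ltcR => /(_ hd h0).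
rewrite nE lecR.
rewrite -[lim _]/('D_1 (f : R[i]^o -> R[i]^o) z) -derive1E.
set D := derive1 _ _ => le.
rewrite -(ler_pM2r (_ : 0 < cmod h)) in le; last first.
  by rewrite lt_def cmod_ge0 cmod_eq0 h0.
apply: le_trans le; rewrite -cmodM -cmodN.
rewrite (_ : - _ = (D - h^-1 *: (((f : R[i]^o -> R[i]^o) \o shift z) (h *: 1) - f z)) * h) //.
rewrite -![_ *: _]/(_ * _) /= mulr1 (addrC h z); field.
exact: h0.
Qed.

(** A converse of the expansion above, from a quadratic remainder, which is what the power series
    delivers. *)
Lemma is_cderive f (z D : R[i]) (C d : R) : 0 < d ->
  (forall h : R[i], cmod h < d ->
    cmod (f (z + h) - f z - h * D) <= C * cmod h ^+ 2) ->
  is_derive (z : R[i]^o) (1 : R[i]^o) (f : R[i]^o -> R[i]^o) (D : R[i]^o).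
Proof.
move=> d0 hf.
have nE (x : R[i]) : `|x| = (cmod x)%:C by rewrite normc_def cmodE.
suff H : (fun h : R[i]^o => (h : R[i])^-1 *: (((f : R[i]^o -> R[i]^o) \o shift z) (h *: 1) - f z))
    @ ((0 : R[i]^o)^') --> (D : R[i]^o).
  by apply: DeriveDef; [apply/cvg_ex; exists D|exact/cvg_lim].
apply/cvgrPdist_le => e e0.
have er : e = (complex.Re e)%:C.
  by move: e0; rewrite ltcE /= => /andP[/eqP]; case: (e) => x y /= ->.
have re0 : 0 < complex.Re e by move: e0; rewrite er ltcR.
(* Within [r] the error [C * cmod h] is at most [e]; adding 1 avoids a division by zero. *)
pose r := Num.min d (complex.Re e / (`|C| + 1)).
have C1 : 0 < `|C| + 1 by rewrite ltr_wpDl.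
have r0 : 0 < r by rewrite lt_min d0 divr_gt0.
exists r%:C; first by rewrite /= ltcR.
move=> h /=; rewrite sub0r normrN nE ltcR lt_min => /andP[hd hr] h0.
have ch0 : 0 < cmod h by rewrite lt_def cmod_ge0 cmod_eq0 h0.
rewrite nE [leRHS]er lecR -(ler_pM2r ch0) -cmodM -cmodN.
rewrite (_ : - _ = f (z + h) - f z - h * D); last first.
  rewrite -![_ *: _]/(_ * _) /= mulr1 (addrC h z); field; exact: h0.
apply: le_trans (hf h hd) _.
rewrite expr2 mulrA ler_wpM2r ?(ltW ch0) //.
move: hr; rewrite ltr_pdivlMr // => /ltW; apply: le_trans.
by rewrite mulrC ler_wpM2l ?cmod_ge0 // ler_wpDr // ler_norm.
Qed.

Lemma is_derivec_complex f (x : R) :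
  derivable (f : R[i]^o -> R[i]^o) x%:C 1 ->
  is_derivec x (fun y : R => f y%:C) (derive1 (f : R[i]^o -> R[i]^o) x%:C).
Proof.
move=> df; set D := derive1 _ _.
(* [P] stands for the real or the imaginary part, seen as a real-linear map bounded by the
   modulus. *)
have key (P : R[i] -> R) : (forall z, `|P z| <= cmod z) ->
    (forall z u, P (z - u) = P z - P u) ->
    (forall (t : R) z, P (t%:C * z) = t * P z) ->
    is_derive x 1 (fun y : R => P (f y%:C)) (P D).
  move=> Ple PB PM.
  suff H : (fun h : R => h^-1 *: (((fun y : R => P (f y%:C)) \o shift x) (h *: 1)
     - P (f x%:C))) @ 0^' --> P D.
    by apply: DeriveDef; [apply/cvg_ex; exists (P D)|exact/cvg_lim].
  apply/cvgrPdist_le => e e0.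
  have [d d0 hd] := cderivable_expansion df e0.
  exists d => // h /=; rewrite sub0r normrN => hhd h0.
  have nh0 : 0 < `|h| by rewrite normr_gt0.
  have := hd h%:C; rewrite cmod_real => /(_ hhd) => le.
  rewrite -(ler_pM2r nh0) -normrM -[leLHS]normrN.
  apply: le_trans le; apply: le_trans (Ple _).
  rewrite PB PB PM -/D -![_ *: _]/(_ * _) /= mulr1 (addrC h x) rmorphD.
  rewrite le_eqVlt; apply/orP; left; apply/eqP; congr `|_|.
  by field.
split.
  apply: key => [z|z u|t z]; first exact: normr_Re_le.
    by rewrite cReD cReN.
  by rewrite cReM /= mul0r subr0.
apply: key => [z|z u|t z]; first exact: normr_Im_le.
  by rewrite cImD cImN.
by rewrite cImM /= mul0r addr0.
Qed.

End ComplexDerivative.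

Section ComplexSeries.
Context {R : realType}.
Implicit Types (u v : nat -> R[i]) (b : nat -> R).

Definition csum u : R[i] := limn (series (Rec u)) +i* limn (series (Imc u)).

(** The majorant [b] is explicit, since the modulus of the sum is later bounded by the sum of
    [b]. *)
Definition summable u b := (forall n, cmod (u n) <= b n) /\ cvgn (series b).

Let normed_dom (f : nat -> R) b : (forall n, `|f n| <= b n) ->
  cvgn (series b) -> cvgn [normed series f].
Proof.
move=> fb cb; have b0 n : 0 <= b n by exact: le_trans (normr_ge0 _) (fb n).
by apply: series_le_cvg cb => n //=.
Qed.

Lemma summable_Re u b : summable u b -> cvgn (series (Rec u)).
Proof.
move=> [h c]; apply: (@normed_cvg _ R^o); apply: normed_dom c => n.
exact: le_trans (normr_Re_le _) (h n).
Qed.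

Lemma summable_Im u b : summable u b -> cvgn (series (Imc u)).
Proof.
move=> [h c]; apply: (@normed_cvg _ R^o); apply: normed_dom c => n.
exact: le_trans (normr_Im_le _) (h n).
Qed.

Lemma cmod_csum_le u b : summable u b -> cmod (csum u) <= 2 * limn (series b).
Proof.
move=> [h c]; have key (f : nat -> R) : (forall n, `|f n| <= cmod (u n)) ->
    `|limn (series f)| <= limn (series b).
  move=> fu; have fb n : `|f n| <= b n by exact: le_trans (fu n) (h n).
  have nf := normed_dom fb c.
  apply: le_trans (@lim_series_norm _ R^o f nf) _.
  exact: lim_series_le.
rewrite (le_trans (cmod_le_ReIm _)) //= mulr_natl mulr2n; apply: lerD; apply: key => n.
  exact: normr_Re_le.
exact: normr_Im_le.
Qed.

Lemma csumD u v b c : summable u b -> summable v c ->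
  csum (fun n => u n + v n) = csum u + csum v.
Proof.
move=> hu hv; rewrite /csum RecD ImcD; apply: eqcP; rewrite ?cReD ?cImD /=.
  exact: (lim_seriesD (summable_Re hu) (summable_Re hv)).
exact: (lim_seriesD (summable_Im hu) (summable_Im hv)).
Qed.

Lemma csumZ (z : R[i]) u b : summable u b ->
  csum (fun n => z * u n) = z * csum u.
Proof.
move=> hu; have cr := summable_Re hu; have ci := summable_Im hu.
have cr' (t : R) : cvgn (series (t *: Rec u)) by exact: is_cvg_seriesZ.
have ci' (t : R) : cvgn (series (t *: Imc u)) by exact: is_cvg_seriesZ.
rewrite /csum RecM ImcM; apply: eqcP; rewrite ?cReM ?cImM /=.
  rewrite -[X in limn (series X)]/(complex.Re z *: Rec u - complex.Im z *: Imc u).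
  by rewrite (lim_seriesB (cr' _) (ci' _)) !lim_seriesZ.
rewrite -[X in limn (series X)]/(complex.Re z *: Imc u + complex.Im z *: Rec u).
by rewrite (lim_seriesD (ci' _) (cr' _)) !lim_seriesZ.
Qed.

(** [T] lowers the degree of a power by one, so the eigenvalue equation compares each term with its
    predecessor; prepending a zero term aligns the two series. *)
Lemma csumS u b : summable u b ->
  csum (fun n => if n is m.+1 then u m else 0) = csum u.
Proof.
move=> hu; have cr := summable_Re hu; have ci := summable_Im hu.
have key (f g : nat -> R) : cvgn (series f) -> g 0%N = 0 ->
    (forall n, g n.+1 = f n) -> limn (series g) = limn (series f).
  move=> cf g0 gS; apply/cvg_lim => //; rewrite -cvg_shiftS /=.
  suff -> : (fun n => series g n.+1) = series f by [].
  apply/funext => n; rewrite /series /= big_nat_recl // g0 add0r.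
  by apply: eq_bigr => i _.
by rewrite /csum; congr (_ +i* _); apply: key.
Qed.

Lemma summableD u v b c : summable u b -> summable v c ->
  summable (fun n => u n + v n) (fun n => b n + c n).
Proof.
move=> [h1 c1] [h2 c2]; split=> [n|].
  exact: le_trans (ler_cmodD _ _) (lerD (h1 n) (h2 n)).
exact: (is_cvg_seriesD c1 c2).
Qed.

Lemma summableZ (z : R[i]) u b : summable u b ->
  summable (fun n => z * u n) (fun n => cmod z * b n).
Proof.
move=> [h1 c1]; split=> [n|]; first by rewrite cmodM ler_wpM2l ?cmod_ge0.
by have : cvgn (series (cmod z *: b)) by exact: is_cvg_seriesZ.
Qed.

End ComplexSeries.

(** The factor with index [j] is the scalar in [T z^(j+1) = (j + 1 + 2 k [j even]) z^j]. Hence [T]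
    sends [z^n / dunkl_fact k n] to its predecessor, and the sum of these terms is the eigenfunction
    with eigenvalue 1. *)
Definition dunkl_fact {R : realType} (k : R[i]) (n : nat) : R[i] :=
  \prod_(j < n) (j.+1%:R + 2 * (~~ odd j)%:R * k).

(* Locked because failing conversion tests would unfold the series. *)
HB.lock Definition dunkl_exp {R : realType} (k z : R[i]) : R[i] :=
  csum (fun n => z ^+ n / dunkl_fact k n).
HB.lock Definition dunkl_exp' {R : realType} (k z : R[i]) : R[i] :=
  csum (fun n => n%:R * z ^+ n.-1 / dunkl_fact k n).

Section PowerSeries.
Context {R : realType}.
Variable k : R[i].
Hypothesis hk : 0 <= complex.Re k.
Local Notation dunkl_fact := (dunkl_fact k).
Local Notation dunkl_exp := (dunkl_exp k).
Local Notation dunkl_exp' := (dunkl_exp' k).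

Lemma dunkl_fact0 : dunkl_fact 0 = 1.
Proof. by rewrite /dunkl_fact big_ord0. Qed.

Lemma dunkl_factS n :
  dunkl_fact n.+1 = dunkl_fact n * (n.+1%:R + 2 * (~~ odd n)%:R * k).
Proof. by rewrite /dunkl_fact big_ord_recr. Qed.

Let factor_le n : n.+1%:R <= cmod (n.+1%:R + 2 * (~~ odd n)%:R * k).
Proof.
apply: le_trans (ler_norm _) _; apply: le_trans (normr_Re_le _); rewrite normr_nat.
have e : (n.+1%:R + 2 * (~~ odd n)%:R * k : R[i]) =
    (n.+1%:R)%:C + (2 * (~~ odd n)%:R)%:C * k.
  by rewrite rmorphM /= !rmorph_nat.
rewrite e cReD cReM /= mul0r subr0 ger0_norm ?lerDl; last first.
  by rewrite addr_ge0 // !mulr_ge0.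
by rewrite !mulr_ge0.
Qed.

(** As [0 <= Re k], the factor with index [n] has real part at least [n + 1]. Hence the exponential
    series majorises that of the kernel. *)
Lemma fact_le_dunkl_fact n : n`!%:R <= cmod (dunkl_fact n).
Proof.
elim: n => [|n IH]; first by rewrite dunkl_fact0 (cmod_nat 1).
rewrite factS natrM dunkl_factS cmodM mulrC.
exact: ler_pM.
Qed.

Lemma dunkl_fact_neq0 n : dunkl_fact n != 0.
Proof.
by rewrite -cmod_eq0 gt_eqF // (lt_le_trans _ (fact_le_dunkl_fact n)) // ltr0n fact_gt0.
Qed.

Let dom (x : R[i]) (y : R) n : cmod x <= y -> cmod (x / dunkl_fact n) <= y / n`!%:R.
Proof.
move=> xy; rewrite cmodM cmodV; apply: ler_pM; rewrite ?cmod_ge0 ?invr_ge0 ?cmod_ge0 //.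
rewrite lef_pV2 ?fact_le_dunkl_fact // ?posrE ?ltr0n ?fact_gt0 //.
by rewrite lt_def cmod_ge0 cmod_eq0 dunkl_fact_neq0.
Qed.

Lemma dunkl_exp_summable z : summable (fun n => z ^+ n / dunkl_fact n) (exp_coeff (cmod z)).
Proof.
split=> [n|]; last exact: is_cvg_series_exp_coeff.
by rewrite /exp_coeff /=; apply: dom; rewrite cmodX.
Qed.

(** Crude, but it keeps the differentiated series below an exponential series, taken at
    [cmod z + 1]. *)
Let natX_le (r : R) n : 0 <= r -> n%:R * r ^+ n.-1 <= (r + 1) ^+ n.
Proof.
move=> r0; elim: n => [|n IH]; first by rewrite mul0r expr0.
rewrite /= exprS mulrDl mul1r -natr1 mulrDl mul1r; apply: lerD; last first.
  by apply: lerXn2r; rewrite ?nnegrE ?addr_ge0 ?lerDl.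
case: n IH => [|n] IH; first by rewrite mul0r mulr_ge0 // expr0.
by rewrite exprS mulrCA ler_wpM2l.
Qed.

Lemma dunkl_exp'_summable z :
  summable (fun n => n%:R * z ^+ n.-1 / dunkl_fact n) (exp_coeff (cmod z + 1)).
Proof.
split=> [n|]; last exact: is_cvg_series_exp_coeff.
rewrite /exp_coeff /=; apply: dom; rewrite cmodM cmod_nat cmodX.
by apply: natX_le; exact: cmod_ge0.
Qed.

(** Induction on [n]: the remainder of order [n + 1] is [z + h] times that of order [n], plus
    [h^2 * n * z^(n-1)]. The base [cmod z + 2] absorbs [cmod (z + h) <= cmod z + 1] and one more
    unit for the last term. *)
Let remainder_le (z h : R[i]) n : cmod h <= 1 ->
  cmod ((z + h) ^+ n - z ^+ n - h * (n%:R * z ^+ n.-1)) <=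
  cmod h ^+ 2 * (cmod z + 2) ^+ n.
Proof.
move=> h1; have z0 := cmod_ge0 z; have h0 := cmod_ge0 h.
elim: n => [|n IH].
  by rewrite !expr0 subrr mul0r mulr0 subr0 cmod0 mulr1 exprn_ge0.
have -> : (z + h) ^+ n.+1 - z ^+ n.+1 - h * (n.+1%:R * z ^+ n.+1.-1) =
   (z + h) * ((z + h) ^+ n - z ^+ n - h * (n%:R * z ^+ n.-1)) +
   h ^+ 2 * (n%:R * z ^+ n.-1).
  case: n {IH} => [|n]; first by rewrite /= !expr0 !expr1; ring.
  by rewrite /= -!natr1 !exprS; ring.
apply: le_trans (ler_cmodD _ _) _.
rewrite (cmodM (z + h)) (cmodM (h ^+ 2)) (cmodX h) (cmodM n%:R) cmod_nat (cmodX z).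
have e1 : cmod (z + h) <= cmod z + 1.
  by apply: le_trans (ler_cmodD _ _) _; rewrite lerD2l.
have e2 : n%:R * cmod z ^+ n.-1 <= (cmod z + 2) ^+ n.
  apply: le_trans (natX_le _ z0) _.
  by apply: lerXn2r; rewrite ?nnegrE ?addr_ge0 // lerD2l ler1n.
apply: (@le_trans _ _ ((cmod z + 1) * (cmod h ^+ 2 * (cmod z + 2) ^+ n) +
   cmod h ^+ 2 * (cmod z + 2) ^+ n)).
  apply: lerD; last by rewrite ler_wpM2l ?exprn_ge0.
  by apply: ler_pM => //; exact: cmod_ge0.
by rewrite (exprS (cmod z + 2)) le_eqVlt; apply/orP; left; apply/eqP; ring.
Qed.

(** Obtained by summing the termwise remainders. It gives the differentiability of the series and,
    used at two points, the continuity of the derivative. *)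
Lemma dunkl_exp_expansion (z h : R[i]) : cmod h <= 1 ->
  cmod (dunkl_exp (z + h) - dunkl_exp z - h * dunkl_exp' z) <=
  2 * expR (cmod z + 2) * cmod h ^+ 2.
Proof.
move=> h1.
have s1 := dunkl_exp_summable (z + h); have s2 := dunkl_exp_summable z.
have s3 := dunkl_exp'_summable z.
have -> : dunkl_exp (z + h) - dunkl_exp z - h * dunkl_exp' z =
   csum (fun n => ((z + h) ^+ n - z ^+ n - h * (n%:R * z ^+ n.-1)) / dunkl_fact n).
  rewrite dunkl_exp.unlock dunkl_exp'.unlock -mulN1r -mulNr.
  rewrite -(csumZ _ s2) -(csumZ _ s3) -(csumD s1 (summableZ _ s2)).
  rewrite -(csumD (summableD s1 (summableZ _ s2)) (summableZ _ s3)).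
  by congr csum; apply/funext => n; ring.
have s : summable
    (fun n => ((z + h) ^+ n - z ^+ n - h * (n%:R * z ^+ n.-1)) / dunkl_fact n)
    (fun n => cmod h ^+ 2 * exp_coeff (cmod z + 2) n).
  split=> [n|]; last by have : cvgn (series (cmod h ^+ 2 *: exp_coeff (cmod z + 2)))
    by apply: is_cvg_seriesZ; exact: is_cvg_series_exp_coeff.
  by rewrite /exp_coeff /= [leRHS]mulrA; apply: dom; exact: remainder_le.
apply: le_trans (cmod_csum_le s) _.
rewrite -[X in limn (series X)]/(cmod h ^+ 2 *: exp_coeff (cmod z + 2)).
rewrite lim_seriesZ; last exact: is_cvg_series_exp_coeff.
by rewrite -mulrA ler_wpM2l // mulrC.
Qed.

Lemma dunkl_exp0 : dunkl_exp 0 = 1.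
Proof.
have h := dunkl_exp_summable 0; rewrite dunkl_exp.unlock /csum.
have key (f : nat -> R) : (forall n, f n.+1 = 0) -> limn (series f) = f 0%N.
  move=> fS; apply/cvg_lim => //; rewrite -cvg_shiftS /=.
  rewrite (_ : (fun n => series f n.+1) = (fun=> f 0%N)); first exact: cvg_cst.
  apply/funext => n; rewrite /series /= big_nat_recl // big1 ?addr0 //.
by rewrite !key => [|n|n]; rewrite /Rec /Imc ?expr0 ?dunkl_fact0 ?divr1 // exprS !mul0r.
Qed.

(** Coefficientwise: only odd powers survive in the difference, and [n + 1 + 2 k [n even]] is the
    last factor of [dunkl_fact k n.+1]. *)
Lemma dunkl_exp_eq (z : R[i]) : z != 0 ->
  dunkl_exp' z + k * ((dunkl_exp z - dunkl_exp (- z)) / z) = dunkl_exp z.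
Proof.
move=> z0.
have s1 := dunkl_exp'_summable z; have s2 := dunkl_exp_summable z.
have s3 := dunkl_exp_summable (- z).
have -> : dunkl_exp' z + k * ((dunkl_exp z - dunkl_exp (- z)) / z) =
  dunkl_exp' z + (k / z * dunkl_exp z + - (k / z) * dunkl_exp (- z)) by ring.
rewrite dunkl_exp.unlock dunkl_exp'.unlock -(csumZ (k / z) s2) -(csumZ _ s3).
rewrite -(csumD (summableZ _ s2) (summableZ _ s3)).
rewrite -(csumD s1 (summableD (summableZ _ s2) (summableZ _ s3))).
rewrite -(csumS s2); congr csum; apply/funext => -[|n].
  by rewrite mul0r !expr0; ring.
have f0 := dunkl_fact_neq0 n; have f1 := dunkl_fact_neq0 n.+1.
rewrite exprNn dunkl_factS /=.
have fS0 : n.+1%:R + 2 * (~~ odd n)%:R * k != 0.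
  by move: f1; rewrite dunkl_factS mulf_eq0 negb_or => /andP[].
rewrite -signr_odd /=; case: (odd n) fS0 => /= fS0; rewrite !exprS /=.
  move: fS0; rewrite mulr0 mul0r addr0 expr0; move: (n.+1%:R) => N N0.
  by field; rewrite f0 N0 z0.
move: fS0; rewrite mulr1 expr0; move: (n.+1%:R) => N N0.
by field; rewrite f0 N0 z0.
Qed.

Lemma dunkl_exp'0 : dunkl_exp' 0 = (1 + 2 * k)^-1.
Proof.
have h := dunkl_exp'_summable 0; rewrite dunkl_exp'.unlock /csum.
have key (f : nat -> R) : f 0%N = 0 -> (forall n, f n.+2 = 0) ->
    limn (series f) = f 1%N.
  move=> f0 fS; apply/cvg_lim => //; rewrite -(cvg_shiftn 2) /=.
  rewrite (_ : (fun n => series f (n + 2)%N) = (fun=> f 1%N)); first exact: cvg_cst.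
  apply/funext => n; rewrite /series /= addn2 !big_nat_recl // f0 add0r big1 ?addr0 //.
pose t n : R[i] := n%:R * 0 ^+ n.-1 / dunkl_fact n.
have t0 : t 0%N = 0 by rewrite /t mul0r mul0r.
have tS n : t n.+2 = 0 by rewrite /t /= expr0n /= mulr0 mul0r.
have eR : limn (series (Rec t)) = complex.Re (t 1%N).
  by apply: key => [|n]; rewrite /Rec ?t0 ?tS.
have eI : limn (series (Imc t)) = complex.Im (t 1%N).
  by apply: key => [|n]; rewrite /Imc ?t0 ?tS.
rewrite -/t eR eI -complex_ReIm /t dunkl_factS dunkl_fact0 /=.
by rewrite expr0 !mulr1 !mul1r.
Qed.

Lemma dunkl_exp_eq0 : dunkl_exp' 0 + k * (2 * dunkl_exp' 0) = 1.
Proof.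
rewrite dunkl_exp'0.
have : 1 + 2 * k != 0.
  by have := dunkl_fact_neq0 1; rewrite dunkl_factS dunkl_fact0 /= mulr1 mul1r.
by move=> h; field.
Qed.

End PowerSeries.

(* [dunkl_wave k (l * x)] is [psi_l^k x] for real [l] and [x]. *)
HB.lock Definition dunkl_wave {R : realType} (k : R[i]) (x : R) : R[i] :=
  dunkl_exp k ((0 +i* 1) * x%:C).
HB.lock Definition dunkl_wave' {R : realType} (k : R[i]) (x : R) : R[i] :=
  (0 +i* 1) * dunkl_exp' k ((0 +i* 1) * x%:C).

Section Kernel.
Context {R : realType}.
Variable k : R[i].
Hypothesis hk : 0 <= complex.Re k.
Local Notation ii := (0 +i* 1 : R[i]).

Lemma dunkl_exp_scale_derive (c z : R[i]) :
  is_derive (z : R[i]^o) (1 : R[i]^o)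
    ((fun u => dunkl_exp k (c * u)) : R[i]^o -> R[i]^o)
    ((c * dunkl_exp' k (c * z) : R[i]) : R[i]^o).
Proof.
have c1 : 0 < cmod c + 1 by rewrite ltr_wpDl // cmod_ge0.
apply: (@is_cderive _ _ _ _ (2 * expR (cmod (c * z) + 2) * cmod c ^+ 2)
  (cmod c + 1)^-1); first by rewrite invr_gt0.
move=> h hd; rewrite mulrDr.
have -> : h * (c * dunkl_exp' k (c * z)) = c * h * dunkl_exp' k (c * z) by ring.
rewrite -[leRHS]mulrA -exprMn -cmodM; apply: (dunkl_exp_expansion hk).
move: hd; rewrite -[X in _ < X]mul1r ltr_pdivlMr // cmodM mulrDr mulr1 mulrC.
move=> /ltW; apply: le_trans; by rewrite lerDl cmod_ge0.
Qed.

Lemma dunkl_exp_eigenfunction (l : R[i]) :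
  dunkl_eigenfunction k l (fun z => dunkl_exp k (ii * l * z)).
Proof.
have dv z : derive1 ((fun u => dunkl_exp k (ii * l * u)) : R[i]^o -> R[i]^o) z =
    ii * l * dunkl_exp' k (ii * l * z).
  by rewrite derive1E (@derive_val _ _ _ _ _ _ _ (dunkl_exp_scale_derive (ii * l) z)).
split.
- by move=> z; case: (dunkl_exp_scale_derive (ii * l) z).
- move=> z; rewrite /holo_dunkl !dv.
  set c := ii * l; have [->|z0] := eqVneq z 0.
    rewrite mulr0 dunkl_exp0 // mulr1.
    have h := dunkl_exp_eq0 hk.
    transitivity (c * (dunkl_exp' k 0 + k * (2 * dunkl_exp' k 0))); first by ring.
    by rewrite h mulr1.
  have [c0|c0] := eqVneq c 0.
    by rewrite c0 !mul0r subrr mul0r mulr0 addr0.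
  have cz0 : c * z != 0 by rewrite mulf_neq0.
  rewrite -[in RHS](dunkl_exp_eq hk cz0) mulrN; field.
  by rewrite c0 z0.
- by rewrite mulr0 dunkl_exp0.
Qed.

Local Notation dunkl_wave := (dunkl_wave k).
Local Notation dunkl_wave' := (dunkl_wave' k).

Lemma dunkl_wave_derive x : is_derivec x dunkl_wave (dunkl_wave' x).
Proof.
rewrite dunkl_wave.unlock dunkl_wave'.unlock.
have h := dunkl_exp_scale_derive ii x%:C.
have := @is_derivec_complex _ (fun u => dunkl_exp k (ii * u)) x.
rewrite derive1E (@derive_val _ _ _ _ _ _ _ h); apply.
by case: h.
Qed.

Lemma dunkl_wave0 : dunkl_wave 0 = 1.
Proof. by rewrite dunkl_wave.unlock mulr0 dunkl_exp0. Qed.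

Lemma dunkl_wave_eq (x : R) : x != 0 ->
  dunkl_wave' x + k * ((dunkl_wave x - dunkl_wave (- x)) / x%:C) = ii * dunkl_wave x.
Proof.
move=> x0; have x0' : x%:C != 0 :> R[i] by rewrite real_complex_eq0.
have i0 : ii != 0 by rewrite eq_complex /= oner_eq0 andbF.
have ix0 : ii * x%:C != 0 by rewrite mulf_neq0.
rewrite dunkl_wave.unlock dunkl_wave'.unlock real_complexN mulrN -[in RHS](dunkl_exp_eq hk ix0).
have aux (F : fieldType) (i z p a b c : F) : i != 0 -> z != 0 ->
    i * p + c * ((a - b) / z) = i * (p + c * ((a - b) / (i * z))).
  by move=> i0' z0; field; rewrite z0 i0'.
apply: aux; [exact: i0|exact: x0'].
Qed.

Lemma dunkl_wave'0 : dunkl_wave' 0 + k * (2%:R * dunkl_wave' 0) = ii.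
Proof.
have h := dunkl_exp_eq0 hk.
transitivity (ii * (dunkl_exp' k 0 + k * (2 * dunkl_exp' k 0))); last by rewrite h mulr1.
by rewrite dunkl_wave'.unlock mulr0; move: (ii) (dunkl_exp' _ _) => i p; ring.
Qed.

Lemma dunkl_wave_bound x : cmod (dunkl_wave x) <= 2.
Proof.
have h (y : R) : y != 0 -> dunkl_wave' y +
    k * ((dunkl_wave y - dunkl_wave (- y)) / y%:C) = ii * (1 : R)%:C * dunkl_wave y.
  by move=> y0; rewrite dunkl_wave_eq // mulr1.
have := eigen_bound hk dunkl_wave_derive h x.
by rewrite dunkl_wave0 (cmod_nat 1) mulr1.
Qed.

(** Near 0 the bound comes from the series, where [cmod z + 1 <= 2]; for [|x| > 1] it comes from the
    equation, with 2 bounding the wave and 4 the difference of two of its values. *)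
Lemma dunkl_wave'_bound : exists2 M, 0 <= M & forall x, cmod (dunkl_wave' x) <= M.
Proof.
exists (2 * expR 2 + (2 + cmod k * 4)).
  by rewrite !addr_ge0 ?mulr_ge0 ?cmod_ge0 ?expR_ge0.
move=> x; have [x1|x1] := leP `|x| 1.
  apply: (@le_trans _ _ (2 * expR 2)); last first.
    by rewrite lerDl addr_ge0 ?mulr_ge0 ?cmod_ge0.
  rewrite dunkl_wave'.unlock dunkl_exp'.unlock cmodM cmodi mul1r.
  apply: le_trans (cmod_csum_le (dunkl_exp'_summable hk _)) _.
  rewrite ler_wpM2l // -/(expR _) ler_expR cmodM cmodi mul1r cmod_real.
  lra.
have x0 : x != 0 by rewrite -normr_gt0 (lt_trans ltr01).
have -> : dunkl_wave' x = ii * dunkl_wave x +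
    - (k * ((dunkl_wave x - dunkl_wave (- x)) / x%:C)).
  by rewrite -dunkl_wave_eq // addrK.
apply: (@le_trans _ _ (2 + cmod k * 4)); last by rewrite lerDr mulr_ge0 ?expR_ge0.
apply: le_trans (ler_cmodD _ _) _; rewrite cmodN !cmodM cmodi mul1r.
apply: lerD; first exact: dunkl_wave_bound.
rewrite ler_wpM2l ?cmod_ge0 // cmodV cmod_real ler_pdivrMr ?(lt_trans ltr01) //.
apply: le_trans (ler_cmodB _ _) _.
move: x1 (dunkl_wave_bound x) (dunkl_wave_bound (- x)).
move: (cmod (dunkl_wave x)) (cmod (dunkl_wave (- x))) `|x| => p q r; lra.
Qed.

Lemma dunkl_wave_continuous : continuousc dunkl_wave.
Proof. exact: is_derivec_continuous dunkl_wave_derive. Qed.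

(** The expansion is used at [z] with step [h] and at [z + h] with step [- h]; in the sum the values
    cancel and [h] times the difference of the derivatives remains. *)
Lemma dunkl_exp'_lipschitz (z h : R[i]) : cmod h <= 1 ->
  cmod (dunkl_exp' k (z + h) - dunkl_exp' k z) <= 4 * expR (cmod z + 3) * cmod h.
Proof.
move=> h1; have [->|h0] := eqVneq h 0.
  by rewrite addr0 subrr cmod0 mulr0.
have ch0 : 0 < cmod h by rewrite lt_def cmod_ge0 cmod_eq0 h0.
have b1 := dunkl_exp_expansion hk z h1.
have Nh1 : cmod (- h) <= 1 by rewrite cmodN.
have b2 := dunkl_exp_expansion hk (z + h) Nh1.
rewrite addrK cmodN in b2.
have e1 : expR (cmod z + 2) <= expR (cmod z + 3) by rewrite ler_expR lerD2l; lra.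
have e2 : expR (cmod (z + h) + 2) <= expR (cmod z + 3).
  by rewrite ler_expR; have := ler_cmodD z h; move: h1; lra.
rewrite -(ler_pM2l ch0) -cmodM.
have -> : h * (dunkl_exp' k (z + h) - dunkl_exp' k z) =
    (dunkl_exp k (z + h) - dunkl_exp k z - h * dunkl_exp' k z) +
    (dunkl_exp k z - dunkl_exp k (z + h) - - h * dunkl_exp' k (z + h)).
  by move: (dunkl_exp _ _) (dunkl_exp _ _) (dunkl_exp' _ _) (dunkl_exp' _ _) => *; ring.
apply: le_trans (ler_cmodD _ _) _; apply: le_trans (lerD b1 b2) _.
have h2 := sqr_ge0 (cmod h).
apply: (@le_trans _ _ (4 * expR (cmod z + 3) * cmod h ^+ 2)); last first.
  by rewrite le_eqVlt; apply/orP; left; apply/eqP; ring.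
rewrite -mulrDl ler_wpM2r //; move: e1 e2; move: (expR _) (expR _) (expR _) => *; lra.
Qed.

Lemma dunkl_wave'_continuous : continuousc dunkl_wave'.
Proof.
have lip (x h : R) : `|h| <= 1 -> cmod (dunkl_wave' (x + h) - dunkl_wave' x) <=
    4 * expR (`|x| + 3) * `|h|.
  move=> h1; rewrite dunkl_wave'.unlock -mulrBr cmodM cmodi mul1r.
  rewrite real_complexD mulrDr.
  have := @dunkl_exp'_lipschitz (ii * x%:C) (ii * h%:C).
  by rewrite !cmodM !cmodi !mul1r !cmod_real; apply.
have key (P : R[i] -> R) x : (forall z, `|P z| <= cmod z) ->
    (forall z u, P (z - u) = P z - P u) ->
    {for x, continuous (fun y => P (dunkl_wave' y))}.
  move=> Ple PB; apply/cvgrPdist_le => e e0.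
  set C := 4 * expR (`|x| + 3).
  have C0 : 0 < C by rewrite mulr_gt0 ?expR_gt0.
  exists (Num.min 1 (e / C)); first by rewrite /= lt_min ltr01 divr_gt0.
  move=> y /=; rewrite lt_min distrC => /andP[h1 h2].
  rewrite distrC -PB (le_trans (Ple _)) //.
  have := lip x (y - x) (ltW h1); rewrite (addrC x) subrK => /le_trans -> //.
  by rewrite mulrC -ler_pdivlMr // ltW.
split=> x; apply: (key _ x).
- exact: normr_Re_le.
- by move=> z u; rewrite cReD cReN.
- exact: normr_Im_le.
- by move=> z u; rewrite cImD cImN.
Qed.

(** On the real line the difference with the wave solves the same equation and vanishes at 0, so
    [eigen_bound] makes it zero. Hence, whatever eigenfunction [dunkl_kernel] selects, its values on
    the line are known. *)
Lemma eigenfunction_on_line (l : R) (f : R[i] -> R[i]) :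
  dunkl_eigenfunction k l%:C f -> forall x : R, f x%:C = dunkl_wave (l * x).
Proof.
move=> [hf ef f0] x.
pose u (y : R) := f y%:C - dunkl_wave (l * y).
pose u' (y : R) := derive1 (f : R[i]^o -> R[i]^o) y%:C - l%:C * dunkl_wave' (l * y).
have du y : is_derivec y u (u' y).
  apply: is_derivecB; first exact: is_derivec_complex.
  by apply: is_derivec_scale; exact: dunkl_wave_derive.
have hu (y : R) : y != 0 -> u' y + k * ((u y - u (- y)) / y%:C) = ii * l%:C * u y.
  move=> y0; have y0' : y%:C != 0 :> R[i] by rewrite real_complex_eq0.
  have := ef y%:C; rewrite /holo_dunkl (negbTE y0') => e1.
  rewrite /u /u' mulrBr -e1 mulrN real_complexN.
  (* The wave equation is stated off the origin, while [l * y] vanishes for [l = 0]. *)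
  have [->|l0] := eqVneq l 0.
    have aux (p q r : R[i]) : p - r - (q - r) = p - q by ring.
    by rewrite !mul0r !oppr0 ?mulr0 ?mul0r ?subr0 addr0 aux.
  have ly0 : l * y != 0 by rewrite mulf_neq0.
  have l0' : l%:C != 0 :> R[i] by rewrite real_complex_eq0.
  have e2 : ii * dunkl_wave (l * y) = dunkl_wave' (l * y) +
      k * ((dunkl_wave (l * y) - dunkl_wave (- (l * y))) / (l%:C * y%:C)).
    by rewrite -real_complexM dunkl_wave_eq.
  rewrite -(mulrA ii l%:C (dunkl_wave _)) (mulrCA ii) e2.
  move: (l%:C) (y%:C) l0' y0' => c z c0 z0; by field; rewrite c0 z0.
have := eigen_bound hk du hu x.
rewrite /u mulr0 f0 dunkl_wave0 // subrr cmod0 mulr0 => le0.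
by apply/eqP; rewrite -subr_eq0 -cmod_eq0 eq_le le0 cmod_ge0.
Qed.

Lemma dunkl_kernelE (l x : R) : dunkl_kernel k (- l%:C) x%:C = dunkl_wave (- (l * x)).
Proof.
rewrite /dunkl_kernel -real_complexN -mulNr; apply: eigenfunction_on_line.
by case: xgetP => [f -> // | /(_ _ (dunkl_exp_eigenfunction (- l)%:C))].
Qed.

End Kernel.

(** * Limits of integrals and integrals over the half line *)

Section RealIntegral.
Context {R : realType}.
Local Notation mu := (@lebesgue_measure R).

Lemma Rintegral_dominated_cvg (f_ : nat -> R -> R) (f g : R -> R) :
  (forall n, measurable_fun setT (f_ n)) -> measurable_fun setT f ->
  (forall x, f_ n x @[n --> \oo] --> f x) ->
  integrableR g -> (forall n x, `|f_ n x| <= g x) ->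
  \int[mu]_x f_ n x @[n --> \oo] --> \int[mu]_x f x.
Proof.
move=> mf_ mf cf ig fg.
have m1 n : measurable_fun setT (fun x => (f_ n x)%:E) by exact/measurable_EFinP.
have m2 : measurable_fun setT (fun x => (f x)%:E) by exact/measurable_EFinP.
have cv : {ae mu, forall x, setT x -> (f_ n x)%:E @[n --> \oo] --> (f x)%:E}.
  by apply: aeW => x _; apply: cvg_EFin; [exact: nearW|exact: cf].
have bd : {ae mu, forall x n, setT x -> (`|(f_ n x)%:E| <= (g x)%:E)%E}.
  by apply: aeW => x n _; rewrite lee_fin.
have [i1 _ h] := @dominated_convergence _ _ _ mu setT measurableT
  (fun n x => (f_ n x)%:E) (fun x => (f x)%:E) (fun x => (g x)%:E)
  m1 m2 cv ig bd.
apply: fine_cvg; rewrite fineK //.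
exact: integrable_fin_num.
Qed.

(** The derivative of the weight may be singular at 0, so the fundamental theorem is applied on
    compact intervals exhausting the half line; the boundary values enter as limits along two
    sequences. *)
Lemma half_line_FTC (J H : R -> R) :
  (forall x : R, 0 < x -> is_derive x 1 H (J x)) ->
  (forall x : R, 0 < x -> {for x, continuous J}) ->
  integrableR (fun x : R => if 0 < x then J x else 0) ->
  H (n.+1%:R^-1) @[n --> \oo] --> 0 -> H (n.+1%:R) @[n --> \oo] --> 0 ->
  \int[mu]_x (if 0 < x then J x else 0) = 0.
Proof.
move=> dH cJ iJ H0 Hy.
(* The right end is [n + 2], so that the interval is nondegenerate already for [n = 0]. *)
pose D n : set R := `[n.+1%:R^-1, n.+2%:R]%classic.
pose Jp (x : R) : R := if 0 < x then J x else 0.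
have mJ : measurable_fun setT Jp := integrableR_measurable iJ.
have ab n : (n.+1%:R^-1 : R) < n.+2%:R.
  by rewrite (@le_lt_trans _ _ 1) ?invf_le1 ?ler1n ?ltr1n.
have c1 : \int[mu]_x (Jp \_ (D n)) x @[n --> \oo] --> \int[mu]_x Jp x.
  apply: (@Rintegral_dominated_cvg _ _ (fun x => `|Jp x|)) => //.
  - move=> n; have h : measurable_fun (D n) Jp by exact: measurable_funTS.
    exact: (measurable_restrictT Jp (measurable_itv _)).1 h.
  - move=> x; have [x0|x0] := ltP 0 x; last first.
      rewrite (_ : (fun n => (Jp \_ (D n)) x) = fun=> Jp x); first exact: cvg_cst.
      by apply/funext => n; rewrite patchE /Jp ltNge x0 /=; case: ifP.
    apply: (@cvg_trans _ ((fun=> Jp x) @ \oo)); last exact: cvg_cst.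
    apply: near_eq_cvg.
    near=> n; rewrite patchE mem_set //= /D /= in_itv /=; apply/andP; split.
      rewrite invf_ple ?posrE //.
      near: n; exists (Num.bound x^-1) => // n /= hn.
      apply: ltW; apply: lt_le_trans (archi_boundP _) _; first by rewrite invr_ge0 ltW.
      by rewrite ler_nat (leq_trans hn).
    near: n; exists (Num.bound x) => // n /= hn.
    apply: ltW; apply: lt_le_trans (archi_boundP (ltW x0)) _.
    by rewrite ler_nat (leq_trans hn) // ltnW.
  - exact: integrable_norm.
  - by move=> n x; rewrite patchE; case: ifP => // _; rewrite normr0.
have e n : \int[mu]_x (Jp \_ (D n)) x = H n.+2%:R - H n.+1%:R^-1.
  rewrite -Rintegral_mkcond.
  have n0 : (0 : R) < n.+1%:R^-1 by rewrite invr_gt0.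
  have gt0 x : x \in `[n.+1%:R^-1, n.+2%:R] -> 0 < x :> R.
    by rewrite in_itv /= => /andP[h _]; exact: lt_le_trans h.
  have cH x : 0 < x -> {for x, continuous H}.
    move=> x0; apply: differentiable_continuous; apply/derivable1_diffP.
    by have [? _] := dH _ x0.
  rewrite (@eq_Rintegral _ _ _ mu (D n) J); last first.
    by move=> x /set_mem /= /gt0 x0; rewrite /Jp x0.
  rewrite /Rintegral (@continuous_FTC2 _ J H) //.
  - apply: continuous_in_subspaceT => x /set_mem /= /gt0; exact: cJ.
  - split.
    + move=> x /subset_itv_oo_cc /gt0 x0; by have [? _] := dH _ x0.
    + by apply: cvg_at_right_filter; exact: cH.
    + by apply: cvg_at_left_filter; apply: cH; rewrite ltr0n.
  - move=> x /subset_itv_oo_cc /gt0 x0.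
    by rewrite derive1E (@derive_val _ _ _ _ _ _ _ (dH _ x0)).
have c2 : \int[mu]_x (Jp \_ (D n)) x @[n --> \oo] --> (0 : R).
  under eq_fun do rewrite e.
  rewrite -(subr0 0); apply: cvgB => //.
  by rewrite -(cvg_shiftS (fun n => H n.+1%:R)) in Hy.
exact: (cvg_unique _ c1 c2).
Unshelve. all: by end_near. Qed.

Lemma Rintegral_fold (F : R -> R) : integrableR F ->
  \int[mu]_x F x = \int[mu]_x (if 0 < x then F x + F (- x) else 0).
Proof.
move=> iF; have mF := integrableR_measurable iF.
have iP (A : set R) : measurable A -> integrableR (F \_ A).
  move=> mA; apply: (@integrableR_le _ _ (fun x => `|F x|)); last exact: integrable_norm.
  - have h : measurable_fun A F by exact: measurable_funTS.
    exact: (measurable_restrictT F mA).1 h.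
  - by move=> x; rewrite patchE; case: ifP => // _; rewrite normr0.
pose P : set R := `]0, +oo[%classic; pose N : set R := `]-oo, 0[%classic.
have iFP := iP P (measurable_itv _); have iFN := iP N (measurable_itv _).
have iF0 := iP [set 0] (measurable_set1 _).
have e : F = (fun x => (F \_ P) x + (F \_ N) x + (F \_ [set 0]) x).
  apply/funext => x; rewrite !patchE.
  have -> : (x \in P) = (0 < x) by rewrite mem_setE in_itv /= andbT.
  have -> : (x \in N) = (x < 0) by rewrite mem_setE in_itv.
  have -> : (x \in [set 0]) = (x == 0) by apply/idP/eqP => [/set_mem|/mem_set].
  by case: ltgtP; rewrite ?addr0 ?add0r.
have -> : \int[mu]_x F x = \int[mu]_x (F \_ P) x + \int[mu]_x (F \_ N) x.
  rewrite {1}e RintegralD //; last exact: integrableRD.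
  rewrite RintegralD // -(Rintegral_mkcond _ ([set 0] : set (measurableTypeR R))) Rintegral_set1 addr0 //.
rewrite (Rintegral_opp iFN) -RintegralD //; last exact: integrableR_opp.
apply: eq_Rintegral => x _; rewrite !patchE.
have -> : (x \in P) = (0 < x) by rewrite mem_setE in_itv /= andbT.
have -> : (- x \in N) = (0 < x) by rewrite mem_setE in_itv /= oppr_lt0.
by case: ifP; rewrite ?addr0.
Qed.

Lemma integrableR_fold (F : R -> R) : integrableR F ->
  integrableR (fun x => if 0 < x then F x + F (- x) else 0).
Proof.
move=> iF; have mF := integrableR_measurable iF.
have i2 := integrableRD iF (integrableR_opp iF).
apply: (@integrableR_le _ _ (fun x => `|F x + F (- x)|)); last exact: integrable_norm.
- apply: measurable_fun_ifT => //; last exact: integrableR_measurable.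
  by apply: measurable_fun_ltr.
- by move=> x; case: ifP => // _; rewrite normr0.
Qed.

End RealIntegral.

(** * The Dunkl operator *)

Section PointwiseContinuity.
Context {R : realType}.
Implicit Types f g : R -> R[i].

Definition continuousc_at x f :=
  {for x, continuous (Rec f)} /\ {for x, continuous (Imc f)}.

Lemma continuousc_atD x f g : continuousc_at x f -> continuousc_at x g ->
  continuousc_at x (fun y => f y + g y).
Proof.
by move=> [f1 f2] [g1 g2]; split; rewrite ?RecD ?ImcD; exact: cvgD.
Qed.

Lemma continuousc_atM x f g : continuousc_at x f -> continuousc_at x g ->
  continuousc_at x (fun y => f y * g y).
Proof.
move=> [f1 f2] [g1 g2]; split; rewrite ?RecM ?ImcM.
  by apply: cvgB; apply: cvgM.
by apply: cvgD; apply: cvgM.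
Qed.

Lemma is_derivec_continuous_at x f d : is_derivec x f d -> continuousc_at x f.
Proof.
move=> [[f1 _] [f2 _]].
by split; apply: differentiable_continuous; apply/derivable1_diffP.
Qed.

End PointwiseContinuity.

Section WeightDerivative.
Context {R : realType}.
Variable k : R[i].
Local Notation w := (dunkl_weight k).

Lemma weight_derive (x : R) : 0 < x ->
  is_derivec x w (2 * k * (x^-1)%:C * w x).
Proof.
move=> x0.
(* [c] stands for the cosine or the sine: near [x > 0] the weight is the exponential of [2 k ln x],
   split into real and imaginary parts. *)
have near_eq : \near x, forall c, (expR (2 * complex.Re k * ln x) * c (2 * complex.Im k * ln x)
    = `|x| `^ (2 * complex.Re k) * c (2 * complex.Im k * ln `|x|) :> R).
  near=> y => c; have y0 : 0 < y by near: y; exact: lt_nbhsr.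
  by rewrite gtr0_norm // /powR gt_eqF.
have dl := is_derive1_ln x0.
have de : is_derive x 1 (fun y => expR (2 * complex.Re k * ln y))
    (expR (2 * complex.Re k * ln x) * (2 * complex.Re k * x^-1)).
  have h : is_derive x 1 (fun y => 2 * complex.Re k * ln y) (2 * complex.Re k * x^-1).
    by apply: is_derive_eq; rewrite -[LHS]/(_ * _).
  exact: (@is_derive1_comp R expR _ x _ _ (is_derive_expR _) h).
have dt : is_derive x 1 (fun y => 2 * complex.Im k * ln y) (2 * complex.Im k * x^-1).
  by apply: is_derive_eq; rewrite -[LHS]/(_ * _).
have dc := @is_derive1_comp R (@cos R) _ x _ _ (is_derive_cos _) dt.
have ds := @is_derive1_comp R (@sin R) _ x _ _ (is_derive_sin _) dt.
have wE : w x = expR (2 * complex.Re k * ln x) * cos (2 * complex.Im k * ln x) +i*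
    (expR (2 * complex.Re k * ln x) * sin (2 * complex.Im k * ln x)).
  by have h := nbhs_singleton near_eq; rewrite !h.
have kE : 2 * k * (x^-1)%:C = (2 * complex.Re k * x^-1) +i* (2 * complex.Im k * x^-1).
  case: (k) => p q; apply: eqcP; rewrite !(cReM, cImM) /=; ring.
rewrite wE kE; split.
  apply: (@near_eq_is_derive _ _ _ (fun y => expR (2 * complex.Re k * ln y) *
    cos (2 * complex.Im k * ln y))).
    by near=> y; rewrite /Rec /=; apply: (near near_eq).
  apply: is_derive_eq; rewrite /= -![_ *: _]/(_ * _); ring.
apply: (@near_eq_is_derive _ _ _ (fun y => expR (2 * complex.Re k * ln y) *
    sin (2 * complex.Im k * ln y))).
  by near=> y; rewrite /Imc /=; apply: (near near_eq).
apply: is_derive_eq; rewrite /= -![_ *: _]/(_ * _); ring.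
Unshelve. all: by end_near. Qed.

End WeightDerivative.

Section DunklOperator.
Context {R : realType}.
Variable k : R[i].
Implicit Types f g : R -> R[i].

(** A formula without case distinction: at 0 the quotient term vanishes because [f 0 - f (- 0) = 0],
    and the indicator of 0 supplies the limit of the quotient. Identities then follow by [ring] with
    [x^-1] and the indicator generalised. *)
Lemma dunklE f f' x : (forall x, is_derivec x f (f' x)) ->
  dunkl k f x = f' x + k * ((f x - f (- x)) * (x^-1)%:C + (x == 0)%:R * (2 * f' 0)).
Proof.
move=> df; rewrite /dunkl !(is_derivec_val (df _)).
have [->|x0] := eqVneq x 0.
  by rewrite oppr0 subrr mul0r add0r mul1r.
by rewrite mul0r addr0 -real_complexV.
Qed.

Lemma dunkl_neq0 f f' x : (forall x, is_derivec x f (f' x)) -> x != 0 ->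
  dunkl k f x = f' x + k * ((f x - f (- x)) * (x^-1)%:C).
Proof. by move=> df x0; rewrite (dunklE _ df) (negbTE x0) mul0r addr0. Qed.

Lemma inv_measurable : measurable_fun setT (fun x : R => x^-1).
Proof.
have e : [set: R] = ~` [set 0] `|` [set 0] by rewrite setUC setUv.
have o0 : open (~` [set (0 : R)]) by apply: closed_openC; exact: closed_eq.
rewrite [X in measurable_fun X]e; apply/measurable_funU => //.
  exact: open_measurable.
split; last exact: measurable_fun_set1.
apply: open_continuous_measurable_fun => // x; rewrite inE /= => /eqP x0.
exact: inv_continuous.
Qed.

Lemma dunkl_measurable f f' : (forall x, is_derivec x f (f' x)) ->
  continuousc f' -> measurablec (dunkl k f).
Proof.
move=> df cf'; have cf := is_derivec_continuous df.
have -> : dunkl k f = fun x => f' x + k * ((f x + (-1) * f (- 1 * x)) * (x^-1)%:C +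
   ((\1_[set 0] x : R)%:C * (2 * f' 0))).
  apply/funext => x; rewrite (dunklE _ df) mulN1r indicE.
  have -> : (x \in [set 0]) = (x == 0) by apply/idP/eqP => [/set_mem|/mem_set].
  by rewrite rmorph_nat mulN1r.
apply: measurablecD; first exact: continuous_measurablec.
apply: measurablecZ; apply: measurablecD.
  apply: measurablecM; last exact: measurablec_real inv_measurable.
  apply: measurablecD; first exact: continuous_measurablec.
  apply: measurablecZ; apply: continuous_measurablec.
  by apply: continuousc_comp => // x; apply: cvgM; [exact: cvg_cst|exact: cvg_id].
by apply: measurablecM; [exact: measurablec_real|exact: measurablec_cst].
Qed.

Lemma difference_le f f' M : (forall x, is_derivec x f (f' x)) ->
  (forall x, cmod (f' x) <= M) ->
  forall x y, cmod (f y - f x) <= 2 * M * `|y - x|.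
Proof.
move=> df bf.
have key (h h' : R -> R) : (forall x : R, is_derive x 1 h (h' x)) ->
    (forall x : R, `|h' x| <= M) -> forall x y : R, x <= y -> `|h y - h x| <= M * `|y - x|.
  move=> dh bh x y; rewrite le_eqVlt => /predU1P[->|xy].
    by rewrite !subrr normr0 mulr0.
  have cw : {within `[x, y], continuous h}.
    apply: continuous_subspaceT => z; apply: differentiable_continuous.
    by apply/derivable1_diffP; case: (dh z).
  have [c _ ->] := @MVT _ h h' _ _ xy (fun z _ => dh z) cw.
  by rewrite normrM ler_wpM2r.
have key2 (x y : R) : x <= y -> cmod (f y - f x) <= 2 * M * `|y - x|.
  move=> xy; apply: le_trans (cmod_le_ReIm _) _.
  rewrite -mulrA mulr_natl mulr2n cReD cReN cImD cImN; apply: lerD.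
    apply: (key (Rec f) (fun x => complex.Re (f' x))) => //.
      by move=> z; case: (df z).
    by move=> z; exact: le_trans (normr_Re_le _) (bf z).
  apply: (key (Imc f) (fun x => complex.Im (f' x))) => //.
    by move=> z; case: (df z).
  by move=> z; exact: le_trans (normr_Im_le _) (bf z).
move=> x y; have [xy|/ltW xy] := leP x y; first exact: key2.
by rewrite -cmodN opprB distrC key2.
Qed.

(** The difference [f x - f (- x)] is at most [2 M * |2 x|], since [difference_le] loses a factor 2
    on the two components; whence the 4. *)
Lemma dunkl_bound f f' M : (forall x, is_derivec x f (f' x)) ->
  (forall x, cmod (f' x) <= M) ->
  forall x, cmod (dunkl k f x) <= (1 + cmod k * 4) * M.
Proof.
move=> df bf' x.
have M0 : 0 <= M by exact: le_trans (cmod_ge0 _) (bf' 0).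
have [->|x0] := eqVneq x 0.
  rewrite (dunklE _ df) oppr0 subrr mul0r add0r eqxx mul1r.
  apply: le_trans (ler_cmodD _ _) _; rewrite !cmodM cmod_nat [leRHS]mulrDl mul1r.
  apply: lerD => //; rewrite -[leRHS]mulrA ler_wpM2l ?cmod_ge0 //.
  by have := bf' 0; lra.
rewrite (dunkl_neq0 df x0).
apply: le_trans (ler_cmodD _ _) _; rewrite !cmodM cmod_real [leRHS]mulrDl mul1r.
apply: lerD => //; rewrite -[leRHS]mulrA ler_wpM2l ?cmod_ge0 // normfV.
rewrite ler_pdivrMr ?normr_gt0 //.
apply: le_trans (difference_le df bf' (- x) x) _; rewrite opprK -mulr2n normrMn.
by rewrite mulr2n; lra.
Qed.

Lemma rapid_bounded f : rapid f -> exists2 M, 0 <= M & forall x, cmod (f x) <= M.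
Proof.
move=> /(_ 0%N)[M hM].
have h x : cmod (f x) <= M by have := hM x; rewrite expr0 mul1r.
by exists M => //; exact: le_trans (cmod_ge0 _) (h 0).
Qed.

(** For [|x| <= 1] the bound by the derivative suffices; beyond, division by [x] only helps. *)
Lemma dunkl_rapid f f' : (forall x, is_derivec x f (f' x)) ->
  rapid f -> rapid f' -> rapid (dunkl k f).
Proof.
move=> df rf rf' m.
have [M M0 hM] := rapid_bounded rf'; have [A hA] := rf' m; have [B hB] := rf m.
have b := dunkl_bound df hM.
have k0 := cmod_ge0 k.
have A0 : 0 <= A by exact: le_trans (mulr_ge0 (exprn_ge0 _ (normr_ge0 _)) (cmod_ge0 _)) (hA 0).
have B0 : 0 <= B by exact: le_trans (mulr_ge0 (exprn_ge0 _ (normr_ge0 _)) (cmod_ge0 _)) (hB 0).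
exists ((1 + cmod k * 4) * M + (A + cmod k * (2 * B))) => x.
have [x1|x1] := leP `|x| 1.
  apply: (@le_trans _ _ ((1 + cmod k * 4) * M)); last first.
    by rewrite lerDl addr_ge0 // mulr_ge0 // mulr_ge0.
  apply: le_trans (b x); rewrite ler_piMl ?cmod_ge0 //.
  exact: exprn_ile1.
apply: (@le_trans _ _ (A + cmod k * (2 * B))); last first.
  by rewrite lerDr mulr_ge0 // addr_ge0 // mulr_ge0.
have x0 : x != 0 by rewrite -normr_gt0 (lt_trans ltr01).
rewrite (dunkl_neq0 df x0).
apply: (@le_trans _ _ (`|x| ^+ m * (cmod (f' x) + cmod k * (cmod (f x) + cmod (f (- x)))))).
  rewrite ler_wpM2l ?exprn_ge0 // (le_trans (ler_cmodD _ _)) // lerD2l.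
  rewrite cmodM ler_wpM2l // cmodM cmod_real normfV.
  rewrite ler_pdivrMr ?normr_gt0 // (le_trans (ler_cmodB _ _)) //.
  by rewrite ler_peMr ?addr_ge0 ?cmod_ge0 // ltW.
rewrite mulrDr mulrCA; apply: lerD => //; rewrite ler_wpM2l // mulrDr mulr_natl mulr2n.
by apply: lerD => //; have := hB (- x); rewrite normrN.
Qed.

Lemma dunklZ c f f' x : (forall x, is_derivec x f (f' x)) ->
  dunkl k (fun y => c * f y) x = c * dunkl k f x.
Proof.
move=> df; have dcf y := is_derivecZ c (df y).
by rewrite (dunklE _ dcf) (dunklE _ df); move: (x^-1)%:C ((x == 0)%:R : R[i]) => i e; ring.
Qed.

End DunklOperator.

Section IntegrationByParts.
Context {R : realType}.
Variable k : R[i].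
Hypothesis hk : 0 <= complex.Re k.
Implicit Types f g : R -> R[i].
Local Notation w := (dunkl_weight k).

(** The weight has modulus at most 1 on []0, 1]] because [0 <= Re k], but for [Re k = 0] it does not
    tend to 0 at the origin: the limit comes from [Q 0 = 0]. [P] stands for the real or the
    imaginary part. *)
Let vanish_at_0 (Q : R -> R[i]) : continuousc Q -> Q 0 = 0 ->
  (forall P : R[i] -> R, (forall z, `|P z| <= cmod z) ->
  P (Q (n.+1%:R^-1) * w (n.+1%:R^-1)) @[n --> \oo] --> (0 : R)).
Proof.
move=> cQ Q0 P hP; have cmQ := continuousc_cmod cQ.
have c0 : cmod (Q (n.+1%:R^-1)) @[n --> \oo] --> (0 : R).
  have -> : (0 : R) = cmod (Q 0) by rewrite Q0 cmod0.
  apply: (@cvg_comp _ _ _ (fun n : nat => (n.+1%:R^-1 : R)) (fun x => cmod (Q x)) _ (nbhs (0 : R))).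
    exact: (@cvg_harmonic R).
  exact: cmQ.
apply: (@norm_cvg0 _ R^o).
apply: (@squeeze_cvgr _ _ _ _ (cst 0) _ _ _ _ _ c0); last exact: cvg_cst.
apply: nearW => n; rewrite normr_ge0 /= (le_trans (hP _)) // cmodM.
rewrite ler_piMr ?cmod_ge0 // cmod_weight ger0_norm ?invr_ge0 //.
have e1 : (1 : R) `^ (2 * complex.Re k) = 1 by rewrite powR1.
rewrite -[leRHS]e1; apply: ge0_ler_powR; rewrite ?nnegrE ?invr_ge0 ?mulr_ge0 //.
by rewrite invf_le1 ?ltr0n // ler1n.
Qed.

Let vanish_at_y (Q : R -> R[i]) : rapid Q ->
  (forall P : R[i] -> R, (forall z, `|P z| <= cmod z) ->
  P (Q (n.+1%:R) * w (n.+1%:R)) @[n --> \oo] --> (0 : R)).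
Proof.
move=> rQ P hP; have [M M0 hM] := rapid_weight_le hk rQ.
apply: (@norm_cvg0 _ R^o).
have c0 : M * n.+1%:R^-1 @[n --> \oo] --> (0 : R).
  by rewrite -(mulr0 M); apply: cvgM; [exact: cvg_cst|exact: (@cvg_harmonic R)].
apply: (@squeeze_cvgr _ _ _ _ (cst 0) _ _ _ _ _ c0); last exact: cvg_cst.
apply: nearW => n; rewrite normr_ge0 /= (le_trans (hP _)) // cmodM cmod_weight.
apply: (le_trans (hM _)); rewrite ler_wpM2l // lef_pV2 ?posrE ?ltr0n ?ltr_pwDl ?sqr_ge0 //.
have : (1 : R) <= n.+1%:R by rewrite ler1n.
by move: (n.+1%:R : R) => t; nra.
Qed.

(* On [x > 0] the even part of the integrand is the derivative of [Q w], where
   [Q] is the odd part (up to a factor 2) of [f g]. *)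
Lemma dunkl_integration_by_parts f f' g g' Mg :
  (forall x, is_derivec x f (f' x)) -> (forall x, is_derivec x g (g' x)) ->
  continuousc f' -> continuousc g' -> rapid f -> rapid f' ->
  (forall x, cmod (g x) <= Mg) -> (forall x, cmod (g' x) <= Mg) ->
  integralc (fun x => (dunkl k f x * g x + f x * dunkl k g x) * w x) = 0.
Proof.
move=> df dg cf' cg' rf rf' bg bg'.
have cf := is_derivec_continuous df; have cg := is_derivec_continuous dg.
pose F x := (dunkl k f x * g x + f x * dunkl k g x) * w x.
have iF : integrablec F.
  apply: rapid_weight_integrable => //.
    apply: measurablecD; apply: measurablecM.
    - exact: dunkl_measurable df cf'.
    - exact: continuous_measurablec.
    - exact: continuous_measurablec.
    - exact: dunkl_measurable dg cg'.
  apply: rapidD.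
    exact: rapidMl (dunkl_rapid k df rf rf') bg.
  exact: rapidMl rf (dunkl_bound k dg bg').
pose P x := f x * g x; pose P' x := f' x * g x + f x * g' x.
pose Q x := P x - P (- x); pose Q' x := P' x + P' (- x).
have dP x : is_derivec x P (P' x) by exact: is_derivecM.
have dQ x : is_derivec x Q (Q' x).
  rewrite /Q'; apply: is_derivec_eq; first by apply: is_derivecB; [exact: dP|exact: is_derivec_opp].
  by rewrite opprK.
have cP' : continuousc P' by apply: continuouscD; apply: continuouscM.
have cQ' : continuousc Q'.
  by apply: continuouscD => //; apply: continuousc_comp => // x; exact: opp_continuous.
pose J x := (Q' x + Q x * (2 * k * (x^-1)%:C)) * w x.
have dH (x : R) : 0 < x -> is_derivec x (fun y => Q y * w y) (J x).
  move=> x0; apply: (is_derivec_eq (is_derivecM (dQ x) (weight_derive k x0))).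
  by rewrite /J; move: (w x) (x^-1)%:C => p q; ring.
have cJ (x : R) : 0 < x -> continuousc_at x J.
  move=> x0; apply: continuousc_atM; last exact: is_derivec_continuous_at (weight_derive k x0).
  apply: continuousc_atD; first by split; [exact: cQ'.1|exact: cQ'.2].
  apply: continuousc_atM; first exact: is_derivec_continuous_at (dQ x).
  apply: continuousc_atM; first by split; exact: cvg_cst.
  split; last exact: cvg_cst.
  by apply: inv_continuous; rewrite gt_eqF.
(* The reflection terms at [x] and [- x] add up to [2 k * Q x / x], which is exactly what the
   logarithmic derivative of the weight contributes to the derivative of [Q w]. *)
have FJ (x : R) : 0 < x -> F x + F (- x) = J x.
  move=> x0; have xn0 : x != 0 by rewrite gt_eqF.
  have Nxn0 : - x != 0 by rewrite oppr_eq0.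
  rewrite /F /J /Q /Q' /P /P' weightN (dunkl_neq0 _ df xn0) (dunkl_neq0 _ df Nxn0).
  rewrite (dunkl_neq0 _ dg xn0) (dunkl_neq0 _ dg Nxn0) opprK invrN real_complexN.
  by move: (w x) (x^-1)%:C => p q; ring.
have rQ : rapid Q.
  have rP : rapid P by exact: rapidMl rf bg.
  have -> : Q = fun x => P x + (-1) * P (- x) by apply/funext => x; rewrite mulN1r.
  by apply: rapidD => //; apply: rapidZ; exact: rapid_opp.
have cQ := is_derivec_continuous dQ.
have Q0 : Q 0 = 0 by rewrite /Q oppr0 subrr.
have [F1 F2] := iF.
have FJr : (fun x => if 0 < x then Rec F x + Rec F (- x) else 0) =
    (fun x : R => if 0 < x then Rec J x else 0).
  apply/funext => x; case: ifP => // x0; rewrite /Rec -FJ //.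
  by rewrite cReD.
have FJi : (fun x => if 0 < x then Imc F x + Imc F (- x) else 0) =
    (fun x : R => if 0 < x then Imc J x else 0).
  apply/funext => x; case: ifP => // x0; rewrite /Imc -FJ //.
  by rewrite cImD.
apply: eqcP => /=.
  rewrite -/(Rec F) Rintegral_fold // FJr.
  apply: (@half_line_FTC _ _ (Rec (fun y => Q y * w y))).
  - by move=> x /dH[].
  - by move=> x /cJ[].
  - by rewrite -FJr; exact: integrableR_fold.
  - exact: (vanish_at_0 cQ Q0 (@normr_Re_le R)).
  - exact: (vanish_at_y rQ (@normr_Re_le R)).
rewrite -/(Imc F) Rintegral_fold // FJi.
apply: (@half_line_FTC _ _ (Imc (fun y => Q y * w y))).
- by move=> x /dH[].
- by move=> x /cJ[].
- by rewrite -FJi; exact: integrableR_fold.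
- exact: (vanish_at_0 cQ Q0 (@normr_Im_le R)).
- exact: (vanish_at_y rQ (@normr_Im_le R)).
Qed.

End IntegrationByParts.

(** * The Dunkl transform *)

Section UnderIntegral.
Context {R : realType}.
Local Notation mu := (@lebesgue_measure R).

Lemma integralc_derive (K K' : R -> R -> R[i]) (G : R -> R) :
  (forall l, integrablec (K l)) ->
  (forall l x, is_derivec l (K^~ x) (K' l x)) ->
  (forall l x, cmod (K' l x) <= G x) -> integrableR G ->
  forall l, is_derivec l (fun l => integralc (K l)) (integralc (K' l)).
Proof.
move=> iK dK bK iG l.
have key (h h' : R -> R -> R) : (forall l, integrableR (h l)) ->
    (forall l x : R, is_derive l 1 (h^~ x) (h' l x)) ->
    (forall l x, `|h' l x| <= G x) ->
    is_derive l 1 (fun l => \int[mu]_x h l x) (\int[mu]_x h' l x).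
  move=> ih dh bh.
  have dE (t x : R) : derive1 (h^~ x) t = h' t x.
    by rewrite derive1E (@derive_val _ _ _ _ _ _ _ (dh t x)).
  have ll : `]l - 1, l + 1[%classic l.
    by rewrite /= in_itv /= ltrBlDr ltrDl ltr01.
  have H1 x y : `]l - 1, l + 1[%classic x -> setT y -> derivable (h^~ y) x 1.
    by move=> _ _; case: (dh x y).
  have G0 y : 0 <= G y by exact: le_trans (normr_ge0 _) (bh 0 y).
  have Gub x y : `]l - 1, l + 1[%classic x -> setT y ->
      `|partial1of2 h x y| <= G y.
    by move=> _ _; rewrite /partial1of2 dE.
  have d := @derivable_under_integral _ _ _ mu h setT measurableT l (l - 1) (l + 1)
    ll (fun x _ => ih x) H1 G G0 iG Gub.
  have e := @differentiation_under_integral _ _ _ mu h setT measurableT l (l - 1) (l + 1)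
    ll (fun x _ => ih x) H1 G G0 iG Gub.
  apply: DeriveDef => //; rewrite -derive1E e.
  by apply: eq_Rintegral => x _; exact: dE.
split.
  apply: (key (fun l x => Rec (K l) x) (fun l x => Rec (K' l) x)) => [t|t x|t x].
  - by case: (iK t).
  - by case: (dK t x).
  - exact: le_trans (normr_Re_le _) (bK t x).
apply: (key (fun l x => Imc (K l) x) (fun l x => Imc (K' l) x)) => [t|t x|t x].
- by case: (iK t).
- by case: (dK t x).
- exact: le_trans (normr_Im_le _) (bK t x).
Qed.

End UnderIntegral.

HB.lock Definition dunkl_integral {R : realType} (k : R[i]) (f : R -> R[i])
    (l : R) : R[i] :=
  integralc (fun x => f x * dunkl_wave k (- (l * x)) * dunkl_weight k x).

Section Transform.
Context {R : realType}.
Variable k : R[i].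
Hypothesis hk : 0 <= complex.Re k.
Implicit Types f g : R -> R[i].
Local Notation w := (dunkl_weight k).
Local Notation ii := (0 +i* 1 : R[i]).

Local Notation dunkl_integral := (dunkl_integral k).

Lemma dunkl_integralE f (l : R) : dunkl_integral f l =
  integralc (fun x => f x * dunkl_wave k (- (l * x)) * w x).
Proof. by rewrite dunkl_integral.unlock. Qed.

Lemma dunkl_transformE f l :
  dunkl_transform k f l = (dunkl_const k)^-1 * dunkl_integral f l.
Proof.
rewrite dunkl_integralE; congr (_ * integralc _); apply/funext => x; by rewrite (dunkl_kernelE hk).
Qed.

Lemma wave_scale_derive (c x : R) :
  is_derivec x (fun y => dunkl_wave k (c * y)) (c%:C * dunkl_wave' k (c * x)).
Proof. exact/is_derivec_scale/dunkl_wave_derive. Qed.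

Lemma dunkl_wave_scale (c x : R) :
  dunkl k (fun y => dunkl_wave k (c * y)) x = ii * c%:C * dunkl_wave k (c * x).
Proof.
have df := wave_scale_derive c.
have [->|x0] := eqVneq x 0.
  rewrite (dunklE _ _ df) !mulr0 oppr0 mulr0 subrr mul0r add0r eqxx mul1r dunkl_wave0 //.
  have h := dunkl_wave'0 hk; rewrite mulr1 -[in RHS]h.
  by move: (dunkl_wave' k 0) c%:C => p q; ring.
rewrite (dunkl_neq0 _ df x0) mulrN.
have [->|c0] := eqVneq c 0.
  by rewrite !mul0r oppr0 subrr !mul0r !mulr0 mul0r addr0.
have cx0 : c * x != 0 by rewrite mulf_neq0.
have := dunkl_wave_eq hk cx0.
rewrite -mulrA (mulrCA ii) => <-; rewrite real_complexM real_complexV.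
have c0' : c%:C != 0 :> R[i] by rewrite real_complex_eq0.
have x0' : x%:C != 0 :> R[i] by rewrite real_complex_eq0.
move: c%:C x%:C c0' x0' (dunkl_wave' _ _) (dunkl_wave _ (c * x)) (dunkl_wave _ (- _)).
by move=> p q p0 q0 r s t; field; rewrite p0 q0.
Qed.

Let waveN (l x : R) : dunkl_wave k (- (l * x)) = dunkl_wave k ((- l) * x).
Proof. by rewrite mulNr. Qed.

Lemma wave_scale_continuous (c : R) : continuousc (fun y => dunkl_wave k (c * y)).
Proof. exact: is_derivec_continuous (wave_scale_derive c). Qed.

Lemma wave_measurable (l : R) : measurablec (fun x => dunkl_wave k (- (l * x))).
Proof.
rewrite (_ : (fun x => _) = fun x => dunkl_wave k ((- l) * x)); last exact/funext.
exact/continuous_measurablec/wave_scale_continuous.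
Qed.

Lemma dunkl_integrand_integrable f l : measurablec f -> rapid f ->
  integrablec (fun x => f x * dunkl_wave k (- (l * x)) * w x).
Proof.
move=> mf rf; apply: rapid_weight_integrable => //.
  by apply: measurablecM => //; exact: wave_measurable.
by apply: (rapidMl (M := 2) rf) => x; exact: dunkl_wave_bound.
Qed.

Lemma dunkl_integralZ c f l : measurablec f -> rapid f ->
  dunkl_integral (fun x => c * f x) l = c * dunkl_integral f l.
Proof.
move=> mf rf; rewrite !dunkl_integralE -integralcZ; last exact: dunkl_integrand_integrable.
by congr integralc; apply/funext => x; rewrite !mulrA.
Qed.

Lemma dunkl_integral_bound f : measurablec f -> rapid f ->
  exists2 M, 0 <= M & forall l, cmod (dunkl_integral f l) <= M.
Proof.
move=> mf rf; have [M M0 hM] := rapid_weight_le hk rf.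
pose h (x : R) := 2 * (M * (1 + x ^+ 2)^-1).
have ih : integrableR h by do 2 apply: integrableRZ; exact: integrableR_oneDsqrV.
have b l : cmod (dunkl_integral f l) <= 2 * \int[lebesgue_measure]_x h x.
  rewrite dunkl_integralE; apply: cmod_integralc_le => //; first exact: dunkl_integrand_integrable.
  move=> x; rewrite !cmodM cmod_weight mulrAC mulrC; apply: ler_pM => //.
  - exact: cmod_ge0.
  - by rewrite mulr_ge0 ?cmod_ge0 ?powR_ge0.
  - exact: dunkl_wave_bound.
by eexists; [exact: le_trans (cmod_ge0 _) (b 0)|exact: b].
Qed.

Lemma dunkl_integral_dunkl f f' l :
  (forall x, is_derivec x f (f' x)) -> continuousc f' -> rapid f -> rapid f' ->
  dunkl_integral (dunkl k f) l = ii * l%:C * dunkl_integral f l.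
Proof.
move=> df cf' rf rf'.
pose g x := dunkl_wave k ((- l) * x).
have dg := wave_scale_derive (- l).
have cg' : continuousc (fun x => (- l)%:C * dunkl_wave' k ((- l) * x)).
  apply: continuouscM; first exact: continuousc_cst.
  apply: continuousc_comp; first exact: dunkl_wave'_continuous.
  by move=> x; apply: cvgM; [exact: cvg_cst|exact: cvg_id].
have [M M0 hM] := dunkl_wave'_bound hk.
have mf := dunkl_measurable k df cf'; have rTf := dunkl_rapid k df rf rf'.
have mf0 := continuous_measurablec (is_derivec_continuous df).
have := @dunkl_integration_by_parts _ k hk f f' g _ (2 + cmod (- l)%:C * M)
  df dg cf' cg' rf rf' _ _.
rewrite /g => h; apply/eqP; rewrite -subr_eq0; apply/eqP; rewrite -[RHS]h.
- rewrite -dunkl_integralZ // !dunkl_integralE -integralcB.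
  + congr integralc; apply/funext => x; rewrite dunkl_wave_scale real_complexN waveN.
    by move: (w x) (dunkl_wave _ _) (dunkl k f x) (f x) l%:C => p q r s t; ring.
  + exact: dunkl_integrand_integrable.
  + apply: dunkl_integrand_integrable; last exact: rapidZ.
    exact: measurablecZ.
- move=> x; apply: le_trans (dunkl_wave_bound hk _) _.
  by rewrite lerDl mulr_ge0 ?cmod_ge0.
- move=> x; rewrite cmodM; apply: (@le_trans _ _ (cmod (- l)%:C * M)).
    by rewrite ler_wpM2l ?cmod_ge0.
  by rewrite lerDr.
Qed.

Lemma dunkl_integral_derive f l : measurablec f -> rapid f ->
  is_derivec l (dunkl_integral f)
    (integralc (fun x => f x * (- x%:C * dunkl_wave' k (- (l * x))) * w x)).
Proof.
move=> mf rf; have [M M0 hM] := dunkl_wave'_bound hk.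
have rxf := rapidX 1 rf.
have [A A0 hA] := rapid_weight_le hk rxf.
rewrite dunkl_integral.unlock.
apply: (@integralc_derive _ (fun l x => f x * dunkl_wave k (- (l * x)) * w x)
  (fun l x => f x * (- x%:C * dunkl_wave' k (- (l * x))) * w x)
  (fun x => M * (A * (1 + x ^+ 2)^-1))).
- by move=> t; exact: dunkl_integrand_integrable.
- move=> t x.
  have := is_derivec_scale (dunkl_wave_derive hk ((- x) * t)).
  move=> /(is_derivecZ (f x * w x)) h.
  apply: (@eq_is_derivec _ _ (fun y => f x * w x * dunkl_wave k (- x * y))).
    apply: (is_derivec_eq h); rewrite real_complexN (_ : - x * t = - (t * x)); last by rewrite mulNr mulrC.
    by move: (w x) (dunkl_wave' _ _) (f x) x%:C => *; ring.
  move=> y; rewrite [RHS]mulrAC; congr (_ * dunkl_wave k _).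
  by rewrite mulNr mulrC.
- move=> t x; have := hA x; rewrite expr1 !cmodM cmodN cmod_weight => h.
  have -> : cmod (f x) * (cmod x%:C * cmod (dunkl_wave' k (- (t * x)))) *
      `|x| `^ (2 * complex.Re k) = cmod (dunkl_wave' k (- (t * x))) *
      (cmod x%:C * cmod (f x) * `|x| `^ (2 * complex.Re k)).
    by move: (cmod _) (cmod _) (cmod _) (_ `^ _) => *; ring.
  by apply: ler_pM => //; rewrite ?mulr_ge0 ?cmod_ge0 ?powR_ge0.
- by do 2 apply: integrableRZ; exact: integrableR_oneDsqrV.
Qed.

Lemma dunkl_integral_continuous f : measurablec f -> rapid f ->
  continuousc (dunkl_integral f).
Proof.
by move=> mf rf; apply: is_derivec_continuous => l; exact: dunkl_integral_derive.
Qed.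

Let mulX_measurable f : measurablec f -> measurablec (fun x => - ii * (x%:C ^+ 1 * f x)).
Proof.
move=> mf; apply: measurablecZ; apply: measurablecM => //.
rewrite (_ : (fun x => _) = fun x : R => x%:C); first exact: measurablec_real.
by apply/funext => x; rewrite expr1.
Qed.

(** The kernel depends on the product [l * x], so its equation in [x] can be read as one in [l],
    with eigenvalue [- ii * x]; [T] is then applied in [l] under the integral. At [l = 0] the value
    of [T] at the origin is used instead. *)
Lemma dunkl_dunkl_integral f l : measurablec f -> rapid f ->
  dunkl k (dunkl_integral f) l = dunkl_integral (fun x => - ii * (x%:C * f x)) l.
Proof.
move=> mf rf; pose D' l := integralc (fun x => f x * (- x%:C * dunkl_wave' k (- (l * x))) * w x).
have dD t : is_derivec t (dunkl_integral f) (D' t) by exact: dunkl_integral_derive.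
have rxf : rapid (fun x => - ii * (x%:C ^+ 1 * f x)) by apply: rapidZ; exact: rapidX.
have iD' t : integrablec (fun x => f x * (- x%:C * dunkl_wave' k (- (t * x))) * w x).
  have [M M0 hM] := dunkl_wave'_bound hk.
  (* The factor [- x] is split as [- ii * x] times [- ii], so that the rapidly decreasing function
     [- ii * x * f x] appears. *)
  have -> : (fun x => f x * (- x%:C * dunkl_wave' k (- (t * x))) * w x) =
      (fun x => (- ii * (x%:C ^+ 1 * f x)) * (- ii * dunkl_wave' k (- t * x)) * w x).
    apply/funext => x; rewrite expr1.
    have e : dunkl_wave' k (- t * x) = dunkl_wave' k (- (t * x)) by rewrite mulNr.
    have i2 : ii * ii = -1 by apply: eqcP; rewrite !(cReM, cImM) /=; ring.
    rewrite e; transitivity (ii * ii * (x%:C * f x * dunkl_wave' k (- (t * x)) * w x)).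
      by rewrite i2; move: (w x) (dunkl_wave' _ _) x%:C => *; ring.
    by move: (w x) (dunkl_wave' _ _) (ii) x%:C => *; ring.
  have mw : measurablec (fun x => - ii * dunkl_wave' k (- t * x)).
    apply: measurablecZ; apply: continuous_measurablec.
    apply: continuousc_comp; first exact: dunkl_wave'_continuous.
    by move=> x; apply: cvgM; [exact: cvg_cst|exact: cvg_id].
  apply: rapid_weight_integrable => //.
    by apply: measurablecM => //; exact: mulX_measurable.
  apply: (rapidMl (M := M) rxf) => x.
  by rewrite cmodM cmodN cmodi mul1r.
have eX : (fun x => - ii * (x%:C * f x)) = (fun x => - ii * (x%:C ^+ 1 * f x)).
  by apply/funext => x; rewrite expr1.
rewrite eX; have iW t := dunkl_integrand_integrable t mf rf.
have [->|l0] := eqVneq l 0.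
  rewrite (dunklE _ _ dD) oppr0 subrr mul0r add0r eqxx mul1r /D'.
  have -> (z : R[i]) : z + k * (2 * z) = (1 + 2 * k) * z by ring.
  rewrite dunkl_integralE -integralcZ //; congr integralc; apply/funext => x.
  rewrite mul0r oppr0 dunkl_wave0 // expr1; have h := dunkl_wave'0 hk.
  rewrite -{1}h; move: (w x) (dunkl_wave' _ _) => *; ring.
rewrite (dunkl_neq0 _ dD l0) /D'.
have -> (p q r : R[i]) : k * ((p - q) * r) = k * r * p + - (k * r) * q by ring.
have iWN := iW (- l).
rewrite !dunkl_integralE -integralcZ // -integralcZ // -integralcD; try exact: integrablecZ.
rewrite -integralcD //; last by apply: integrablecD; exact: integrablecZ.
congr integralc; apply/funext => x; rewrite expr1.
have [->|x0] := eqVneq x 0.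
  by rewrite !mulr0 oppr0 !(mul0r, mulr0) add0r mulNr addrN.
have lx0 : - (l * x) != 0 by rewrite oppr_eq0 mulf_neq0.
have := dunkl_wave_eq hk lx0.
rewrite opprK (_ : - (- l * x) = l * x); last by rewrite mulNr opprK.
rewrite real_complexN real_complexM real_complexV.
have l0' : l%:C != 0 :> R[i] by rewrite real_complex_eq0.
have x0' : x%:C != 0 :> R[i] by rewrite real_complex_eq0.
move: l%:C x%:C l0' x0' (w x) (f x) (dunkl_wave' _ _) (dunkl_wave _ (- (l * x)))
  (dunkl_wave _ (l * x)) (ii) => p q p0 q0 r s t u v i e.
have -> : - i * (q * s) * u * r = - (q * s * r) * (i * u) by ring.
by rewrite -e; field; rewrite p0 q0.
Qed.

Lemma dunkl_integralN f l : measurablec f -> rapid f ->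
  dunkl_integral f (- l) = dunkl_integral (fun x => f (- x)) l.
Proof.
move=> mf rf; rewrite !dunkl_integralE integralc_opp; last exact: dunkl_integrand_integrable.
by congr integralc; apply/funext => x; rewrite weightN mulrNN.
Qed.

End Transform.

Section Fubini.
Context {R : realType}.
Local Notation mu := (@lebesgue_measure R).

Lemma Rintegral_Fubini (K : R -> R -> R) (a b : R -> R) :
  measurable_fun setT (fun z : R * R => K z.1 z.2) ->
  (forall x y, `|K x y| <= a x * b y) -> integrableR a -> integrableR b ->
  \int[mu]_x \int[mu]_y K x y = \int[mu]_y \int[mu]_x K x y.
Proof.
move=> mK bK ia ib.
have iK : (mu \x mu)%E.-integrable setT (fun z : R * R => (K z.1 z.2)%:E).
  apply/integrable12ltyP; first exact/measurable_EFinP.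
  have ia' := integrable_norm ia; have ib' := integrable_norm ib.
  apply: (@le_lt_trans _ _ (\int[mu]_x (`|a x| * \int[mu]_y `|b y|)%:E)%E).
    apply: ge0_le_integral => //.
    - by move=> x _; apply: integral_ge0.
    - have m0 : measurable_fun setT (abse \o (fun z : R * R => (K z.1 z.2)%:E)).
        by apply: measurableT_comp => //; exact/measurable_EFinP.
      exact: (measurable_fun_fubini_tonelli_F (m2 := mu) _ m0 (fun z => abse_ge0 _)).
    - apply/measurable_EFinP; apply: measurable_funM => //.
      exact: integrableR_measurable ia'.
    - move=> x _; rewrite EFinM /Rintegral fineK; last first.
        exact: integrable_fin_num.
      rewrite -integralZl //.
      apply: ge0_le_integral => //=.
      + apply/measurable_EFinP; apply: measurableT_comp => //.
        exact: (measurableT_comp mK (pair1_measurable x)).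
      + apply/measurable_EFinP; apply: measurable_funM => //.
        exact: integrableR_measurable ib'.
      + move=> y _; rewrite lee_fin -normrM.
        exact: le_trans (bK x y) (ler_norm _).
  have := integrableRZ (\int[mu]_y `|b y|) ia'.
  move=> /integrableP[_]; congr (_ < _)%E; apply: eq_integral => x _ /=.
  by rewrite ger0_norm ?mulr_ge0 ?Rintegral_ge0 // mulrC.
have mx x : measurable_fun setT (K x).
  exact: (measurableT_comp mK (pair1_measurable x)).
have my y : measurable_fun setT (K ^~ y).
  exact: (measurableT_comp mK (pair2_measurable y)).
have ix x : integrableR (K x).
  apply: (integrableR_le (mx x) (bK x)); exact: integrableRZ.
have iy y : integrableR (K ^~ y).
  apply: (integrableR_le (my y) (fun x => bK x y)).
  have -> : (fun x => a x * b y) = (fun x => b y * a x) by apply/funext => x; rewrite mulrC.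
  exact: integrableRZ.
have := Fubini iK => /(congr1 fine) /= h.
transitivity (fine (\int[mu]_x \int[mu]_y (K x y)%:E)).
  rewrite /Rintegral; congr fine; apply: eq_integral => x _.
  by rewrite fineK //; exact: (integrable_fin_num measurableT (ix x)).
rewrite h /Rintegral; congr fine; apply: eq_integral => y _.
by rewrite fineK //; exact: (integrable_fin_num measurableT (iy y)).
Qed.

Variable k : R[i].
Hypothesis hk : 0 <= complex.Re k.
Implicit Types f g : R -> R[i].
Local Notation w := (dunkl_weight k).

Let product_measurable f g : measurablec f -> measurablec g ->
  measurable_fun setT (Rec (fun z : R * R => f z.1 * g z.2 * dunkl_wave k (- (z.2 * z.1)))) /\
  measurable_fun setT (Imc (fun z : R * R => f z.1 * g z.2 * dunkl_wave k (- (z.2 * z.1)))).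
Proof.
move=> [f1 f2] [g1 g2]; have [w1 w2] := dunkl_wave_continuous hk.
have mp : measurable_fun setT (fun z : R * R => - (z.2 * z.1)).
  apply: measurableT_comp => //.
  exact: (measurable_funM measurable_snd measurable_fst).
have c1 (h : R -> R) : measurable_fun setT h -> measurable_fun setT (fun z : R * R => h z.1).
  by move=> mh; exact: (measurableT_comp mh measurable_fst).
have c2 (h : R -> R) : measurable_fun setT h -> measurable_fun setT (fun z : R * R => h z.2).
  by move=> mh; exact: (measurableT_comp mh measurable_snd).
have c3 (h : R -> R) : continuous h -> measurable_fun setT (fun z : R * R => h (- (z.2 * z.1))).
  by move=> ch; exact: (measurableT_comp (continuous_measurable_fun ch) mp).
have := (c1 _ f1, c1 _ f2, c2 _ g1, c2 _ g2, c3 _ w1, c3 _ w2).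
rewrite /Rec /Imc => -[[[[[m1 m2] m3] m4] m5] m6].
split.
  rewrite (_ : (fun x : R * R => _) = (fun z : R * R =>
    (Rec f z.1 * Rec g z.2 - Imc f z.1 * Imc g z.2) * Rec (dunkl_wave k) (- (z.2 * z.1)) -
    (Rec f z.1 * Imc g z.2 + Imc f z.1 * Rec g z.2) * Imc (dunkl_wave k) (- (z.2 * z.1)))).
    by apply: measurable_funB; apply: measurable_funM => //;
       [apply: measurable_funB|apply: measurable_funD]; apply: measurable_funM.
  by apply/funext => z; rewrite !(cReM, cImM).
rewrite (_ : (fun x : R * R => _) = (fun z : R * R =>
    (Rec f z.1 * Rec g z.2 - Imc f z.1 * Imc g z.2) * Imc (dunkl_wave k) (- (z.2 * z.1)) +
    (Rec f z.1 * Imc g z.2 + Imc f z.1 * Rec g z.2) * Rec (dunkl_wave k) (- (z.2 * z.1)))).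
  by apply: measurable_funD; apply: measurable_funM => //;
     [apply: measurable_funB|apply: measurable_funD]; apply: measurable_funM.
by apply/funext => z; rewrite !(cReM, cImM).
Qed.

(** The kernel is bounded and symmetric in its two arguments, so the order of integration can be
    exchanged. *)
Lemma dunkl_integral_adjoint f g : measurablec f -> rapid f ->
  measurablec g -> rapid g ->
  integralc (fun y => dunkl_integral k f y * g y * w y) =
  integralc (fun x => f x * dunkl_integral k g x * w x).
Proof.
move=> mf rf mg rg.
have ifw := rapid_weight_integrable hk mf rf.
have igw := rapid_weight_integrable hk mg rg.
pose K (x y : R) := (f x * w x) * (g y * w y) * dunkl_wave k (- (y * x)).
have -> : (fun y => dunkl_integral k f y * g y * w y) =
    (fun y => integralc (fun x => K x y)).
  apply/funext => y; rewrite -mulrA mulrC dunkl_integralE -integralcZ; last exact: dunkl_integrand_integrable.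
  congr integralc; apply/funext => x; rewrite /K.
  by move: (dunkl_wave _ _) (w x) (w y) => *; ring.
have -> : (fun x => f x * dunkl_integral k g x * w x) =
    (fun x => integralc (fun y => K x y)).
  apply/funext => x; rewrite mulrAC dunkl_integralE -integralcZ; last exact: dunkl_integrand_integrable.
  congr integralc; apply/funext => y; rewrite /K (mulrC x y).
  by move: (dunkl_wave _ _) (w x) (w y) => *; ring.
have mfw := integrablec_measurable ifw; have mgw := integrablec_measurable igw.
have [mK1 mK2] := product_measurable mfw mgw.
have ia := integrablec_cmod ifw; have ib := integrableRZ 2 (integrablec_cmod igw).
have bK x y : cmod (K x y) <= cmod (f x * w x) * (2 * cmod (g y * w y)).
  rewrite /K (cmodM _ (dunkl_wave _ _)) (cmodM (f x * w x)) -mulrA ler_wpM2l ?cmod_ge0 //.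
  by rewrite mulrC ler_wpM2r ?cmod_ge0 // dunkl_wave_bound.
apply: eqcP => /=; symmetry.
  apply: (@Rintegral_Fubini (fun x y => complex.Re (K x y)) _ _ mK1 _ ia ib) => x y.
  exact: le_trans (normr_Re_le _) (bK x y).
apply: (@Rintegral_Fubini (fun x y => complex.Im (K x y)) _ _ mK2 _ ia ib) => x y.
exact: le_trans (normr_Im_le _) (bK x y).
Qed.

End Fubini.

(** * Inversion *)

Section Gaussian.
Context {R : realType}.
Local Notation mu := (@lebesgue_measure R).

Definition gaussian (t x : R) : R := expR (- (t * x ^+ 2 / 2)).
Local Notation gaussc t := (fun x : R => (gaussian t x)%:C).

Lemma gaussian_ge0 t x : 0 <= gaussian t x.
Proof. exact: expR_ge0. Qed.

Lemma gaussianN t x : gaussian t (- x) = gaussian t x.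
Proof. by rewrite /gaussian sqrrN. Qed.

Lemma gaussian_derive (t x : R) : is_derive x 1 (gaussian t) (- (t * x) * gaussian t x).
Proof.
have h : is_derive x 1 (fun y : R => - (t * y ^+ 2 / 2)) (- (t * x)).
  by apply: is_derive_eq; rewrite -![_ *: _]/(_ * _) ?expr1 ?mulr1 ?scaler0 ?addr0; field.
apply: (is_derive_eq (@is_derive1_comp R expR _ x _ _ (is_derive_expR _) h)).
by rewrite mulrC.
Qed.

Lemma gaussianc_derive (t x : R) :
  is_derivec x (gaussc t) ((- (t * x) * gaussian t x)%:C).
Proof. exact/is_derivec_real/gaussian_derive. Qed.

(** [expR s] is the power of exponent [n + 1] of [expR (s / (n + 1))], which is at least
    [1 + s / (n + 1)]. *)
Lemma expR_ge_pow (n : nat) (s : R) : 0 <= s -> (s / n.+1%:R) ^+ n.+1 <= expR s.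
Proof.
move=> s0; have -> : expR s = expR (s / n.+1%:R) ^+ n.+1.
  by rewrite -expRM_natl mulrC mulfVK // pnatr_eq0.
apply: lerXn2r; rewrite ?nnegrE ?divr_ge0 ?expR_ge0 //.
by apply: le_trans (expR_ge1Dx _); rewrite lerDr.
Qed.

Lemma gaussian_rapid t : 0 < t -> rapid (gaussc t).
Proof.
(* Chosen so that [expR_ge_pow] at [t x^2 / 2] reads [|x|^(2 (m + 1)) <= C * exp (t x^2 / 2)]. *)
move=> t0 m; pose C : R := (2 * m.+1%:R / t) ^+ m.+1.
have C0 : 0 <= C by rewrite exprn_ge0 // divr_ge0 ?mulr_ge0 // ltW.
exists (1 + C) => x; rewrite cmod_real (ger0_norm (gaussian_ge0 t x)).
have s0 : 0 <= t * x ^+ 2 / 2 by rewrite divr_ge0 // mulr_ge0 ?sqr_ge0 // ltW.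
have g1 : gaussian t x <= 1 by rewrite /gaussian -[leRHS]expR0 ler_expR oppr_le0.
have [x1|x1] := leP `|x| 1.
  rewrite (@le_trans _ _ 1) ?lerDl //.
  apply: le_trans g1; rewrite ler_piMl ?gaussian_ge0 //.
  exact: exprn_ile1.
rewrite (@le_trans _ _ C) ?lerDr //.
have := expR_ge_pow m s0.
have -> : t * x ^+ 2 / 2 / m.+1%:R = (2 * m.+1%:R / t)^-1 * `|x| ^+ 2.
  by rewrite real_normK ?num_real //; field; rewrite gt_eqF //= addrC natr1 pnatr_eq0.
rewrite exprMn exprVn -/C => h.
have Cp : 0 < C by rewrite exprn_gt0 // divr_gt0 // mulr_gt0.
rewrite /gaussian expRN -ler_pdivlMr ?invr_gt0 ?expR_gt0 // invrK.
apply: le_trans (ler_wpM2l C0 h); rewrite mulrA divff ?gt_eqF // mul1r -exprM.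
by apply: ler_weXn2l; [exact: ltW|rewrite (leq_trans (leqnSn m)) // leq_pmull].
Qed.

Lemma gaussian_measurable t : measurablec (gaussc t).
Proof.
exact/continuous_measurablec/(is_derivec_continuous (gaussianc_derive t)).
Qed.

Lemma gaussian_natX n x : gaussian 1 x ^+ n = gaussian n%:R x.
Proof. by rewrite /gaussian -expRM_natl; congr expR; ring. Qed.

End Gaussian.
Notation gaussc t := (fun x => (gaussian t x)%:C).

Section Completeness.
Context {R : realType}.
Local Notation mu := (@lebesgue_measure R).
Variable k : R[i].
Hypothesis hk : 0 <= complex.Re k.
Local Notation w := (dunkl_weight k).

Lemma rapid_affine_gaussian (h : R -> R[i]) M t : 0 < t ->
  (forall x, cmod (h x) <= M * (1 + `|x|)) -> rapid (fun x => h x * (gaussian t x)%:C).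
Proof.
move=> t0 hM.
have r1 := gaussian_rapid t0.
have := rapidD r1 (rapidX 1 r1) => r2.
have r3 : rapid (fun x : R => (1 + `|x|)%:C * (gaussian t x)%:C).
  move=> m; have [A hA] := r1 m; have [B hB] := rapidX 1 r1 m.
  exists (A + B) => x; apply: le_trans (lerD (hA x) (hB x)).
  rewrite -mulrDr ler_wpM2l ?exprn_ge0 // expr1 !cmodM !cmod_real.
  by rewrite (ger0_norm (_ : 0 <= 1 + `|x|)) ?addr_ge0 // mulrDl mul1r.
apply: (rapid_le (M := `|M|) r3) => x; rewrite !cmodM mulrA.
rewrite ler_wpM2r ?cmod_ge0 // cmod_real (ger0_norm (_ : 0 <= 1 + `|x|)) ?addr_ge0 //.
by rewrite (le_trans (hM x)) // ler_wpM2r ?addr_ge0 // ler_norm.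
Qed.

Definition peak (u u0 : R) : R := 1 - (u - u0) ^+ 2.

(* Linear combinations of Gaussians contain the functions
   [u^(j+1) (1 - (u - u0)^2)^n] with [u = exp (- x^2 / 2)]. *)
Lemma peak_integral (h : R -> R[i]) M : measurablec h ->
  (forall x, cmod (h x) <= M * (1 + `|x|)) ->
  (forall t, 0 < t -> integralc (fun x => h x * (gaussian t x)%:C * w x) = 0) ->
  forall u0 n j, 0 < u0 <= 1 ->
  let F x := h x * (gaussian 1 x ^+ j.+1 * peak (gaussian 1 x) u0 ^+ n)%:C * w x in
  integrablec F /\ integralc F = 0.
Proof.
move=> mh hM h0 u0 n j u01.
have mg : measurable_fun setT (gaussian (1 : R)).
  by have [] := gaussian_measurable (1 : R).
elim: n j => [|n IH] j F.
  have -> : F = fun x => h x * (gaussian j.+1%:R x)%:C * w x.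
    by apply/funext => x; rewrite /F expr0 mulr1 gaussian_natX.
  split; last by apply: h0; rewrite ltr0n.
  apply: rapid_weight_integrable => //; last by apply: (rapid_affine_gaussian _ hM); rewrite ltr0n.
  by apply: measurablecM => //; exact: gaussian_measurable.
have [i1 e1] := IH j; have [i2 e2] := IH j.+1; have [i3 e3] := IH j.+2.
(* One factor of [peak] is the quadratic [1 - u0^2 + 2 u0 u - u^2], which raises the power of [u] by
   0, 1 or 2. *)
have FE : F = fun x =>
   (1 - u0 ^+ 2)%:C * (h x * (gaussian 1 x ^+ j.+1 * peak (gaussian 1 x) u0 ^+ n)%:C * w x)
   + ((2 * u0)%:C * (h x * (gaussian 1 x ^+ j.+2 * peak (gaussian 1 x) u0 ^+ n)%:C * w x)
   + (-1) * (h x * (gaussian 1 x ^+ j.+3 * peak (gaussian 1 x) u0 ^+ n)%:C * w x)).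
  apply/funext => x; rewrite /F.
  have -> : gaussian 1 x ^+ j.+1 * peak (gaussian 1 x) u0 ^+ n.+1 =
    (1 - u0 ^+ 2) * (gaussian 1 x ^+ j.+1 * peak (gaussian 1 x) u0 ^+ n) +
    (2 * u0 * (gaussian 1 x ^+ j.+2 * peak (gaussian 1 x) u0 ^+ n) -
    (gaussian 1 x ^+ j.+3 * peak (gaussian 1 x) u0 ^+ n)).
    rewrite (exprS (peak _ _)); set P := peak _ _ ^+ n.
    rewrite -[peak _ _]/(1 - (gaussian 1 x - u0) ^+ 2) !(exprS (gaussian 1 x)).
    by move: (gaussian 1 x) P => *; ring.
  move: (1 - u0 ^+ 2) (2 * u0) (_ ^+ j.+1 * _) (_ ^+ j.+2 * _) (_ ^+ j.+3 * _).
  move=> p q a b c; rewrite !(real_complexD, real_complexN, real_complexM).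
  by move: (w x) (h x) p%:C q%:C a%:C b%:C c%:C => *; ring.
rewrite FE; split.
  by apply: integrablecD; [|apply: integrablecD]; apply: integrablecZ.
rewrite integralcD ?integralcD ?integralcZ ?e1 ?e2 ?e3 ?mulr0 ?addr0 //;
  by [exact: integrablecZ|apply: integrablecD; exact: integrablecZ].
Qed.

End Completeness.

Section Completeness.
Context {R : realType}.
Local Notation mu := (@lebesgue_measure R).
Variable k : R[i].
Hypothesis hk : 0 <= complex.Re k.
Local Notation w := (dunkl_weight k).

Lemma gaussian_decreasing (x y : R) : 0 <= x -> x < y ->
  gaussian 1 y < gaussian 1 x.
Proof.
move=> x0 xy; rewrite ltr_expR ltrN2 !mul1r ltr_pM2r ?invr_gt0 //.
by apply: ltrXn2r => //; rewrite ?nnegrE // (le_trans x0) // ltW.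
Qed.

(* A peak argument (Laplace's method): [peak (u x) (u x0)] is close to [1]
   near [x0] and bounded away from [1] elsewhere. *)
Lemma peak_separation (p : R -> R) (x0 c : R) : 0 < x0 -> 0 < c ->
  (forall x, p (- x) = p x) ->
  {for x0, continuous p} -> c < p x0 ->
  integrableR (fun x => p x * gaussian 1 x) ->
  (forall n, integrableR (fun x => p x * (gaussian 1 x *
     peak (gaussian 1 x) (gaussian 1 x0) ^+ n))) ->
  ~ (forall n, \int[mu]_x (p x * (gaussian 1 x *
     peak (gaussian 1 x) (gaussian 1 x0) ^+ n)) = 0).
Proof.
move=> x0p c0 pN cp cpx0 ip ipn H.
pose u : R -> R := gaussian 1; pose u0 := u x0.
have u01 x : 0 < u x <= 1.
  rewrite expR_gt0 /= /u /gaussian -[leRHS]expR0 ler_expR oppr_le0.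
  by rewrite divr_ge0 // mulr_ge0 ?sqr_ge0.
have [d /andP[d0 dx0] hd] : exists2 d, 0 < d < x0 & forall x, `|x0 - x| < d -> c < p x.
  have /cvgrPdist_lt := cp => /(_ (p x0 - c)); rewrite subr_gt0 => /(_ cpx0).
  move=> [e /= e0 he]; exists (Num.min e (x0 / 2)).
    by rewrite lt_min e0 divr_gt0 //= gt_min; apply/orP; right; lra.
  move=> x; rewrite lt_min => /andP[xe _].
  have := he x xe => /=; rewrite ltr_distlC.
  by move=> /andP[+ _]; lra.
(* [u] decreases on the half line, so [u x] differs from [u0] by at least [eta] when [|x|] is at
   distance at least [d] from [x0]. *)
pose eta := Num.min (u (x0 - d) - u0) (u0 - u (x0 + d)).
have eta0 : 0 < eta.
  by rewrite lt_min !subr_gt0; apply/andP; split; apply: gaussian_decreasing; lra.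
have eta1 : eta < 1.
  rewrite gt_min; apply/orP; left.
  by have /andP[h1 h2] := u01 (x0 - d); have /andP[h3 h4] := u01 x0; rewrite /u0; lra.
have [d2 d20 hd2] : exists2 d2, 0 < d2 & forall x, `|x0 - x| < d2 -> `|u0 - u x| <= eta / 2.
  have cu : {for x0, continuous u}.
    apply: differentiable_continuous; apply/derivable1_diffP.
    by case: (gaussian_derive 1 x0).
  have /cvgrPdist_le := cu => /(_ (eta / 2)); rewrite divr_gt0 // => /(_ isT).
  by move=> [e /= e0 he]; exists e.
pose r := Num.min d d2.
have r0 : 0 < r by rewrite lt_min d0.
pose I : set R := `]x0 - r, x0 + r[%classic.
pose m := u (x0 + d).
have m0 : 0 < m by exact: expR_gt0.
(* [peak] is at most [A] away from [x0] and [- x0], and at least [B] on [I]. *)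
pose A := 1 - eta ^+ 2; pose B := 1 - (eta / 2) ^+ 2.
have A0 : 0 <= A by rewrite /A; nra.
have AB : A < B by rewrite /A /B; nra.
have B0 : 0 < B by exact: le_lt_trans AB.
have peak01 x : 0 <= peak (u x) u0.
  by rewrite /peak; have /andP[h1 h2] := u01 x; have /andP[h3 h4] := u01 x0; rewrite /u0; nra.
have low n x : c * m * B ^+ n * \1_I x - A ^+ n * (`|p x| * u x) <=
    p x * (u x * peak (u x) u0 ^+ n).
  have ux0 : 0 <= u x by exact: ltW (expR_gt0 _).
  have P0 : 0 <= peak (u x) u0 ^+ n by rewrite exprn_ge0.
  have N0 : 0 <= A ^+ n * (`|p x| * u x) by rewrite !mulr_ge0 // exprn_ge0.
  rewrite indicE; have [xI|xI] := boolP (x \in I).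
    rewrite mulr1.
    have xr : `|x0 - x| < r.
      by move: xI; rewrite inE /I /= in_itv /= distrC ltr_distl.
    move: xr; rewrite lt_min => /andP[xd xd2].
    have hp := hd _ xd; have hu := hd2 _ xd2.
    have um : m <= u x.
      apply: ltW; apply: gaussian_decreasing; move: xd; rewrite ltr_distlC; lra.
    have BP : B ^+ n <= peak (u x) u0 ^+ n.
      apply: lerXn2r; rewrite ?nnegrE ?(ltW B0) ?peak01 // /B /peak lerD2l lerN2.
      by rewrite -(real_normK (num_real (u x - u0))) distrC; apply: lerXn2r; rewrite ?nnegrE ?divr_ge0 // ltW.
    apply: (@le_trans _ _ (c * m * B ^+ n)); first by rewrite gerBl.
    rewrite -mulrA; apply: ler_pM; rewrite ?(ltW c0) ?mulr_ge0 ?exprn_ge0 ?(ltW m0) ?(ltW B0) ?(ltW hp) //.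
    by apply: ler_pM; rewrite ?exprn_ge0 ?(ltW m0) ?(ltW B0).
  rewrite mulr0 sub0r.
  (* As [p] is even, it is positive near [- x0] as well as near [x0]; there the integrand is
     nonnegative. *)
  have near_case y : `|x0 - y| < d -> p y = p x -> - (A ^+ n * (`|p x| * u x)) <=
     p x * (u x * peak (u x) u0 ^+ n).
    move=> yd <-; rewrite (@le_trans _ _ 0) ?oppr_le0 //; first by rewrite !mulr_ge0 // exprn_ge0.
    by rewrite !mulr_ge0 // ltW // (lt_trans c0) // hd.
  have far_case : eta <= `|u x - u0| -> - (A ^+ n * (`|p x| * u x)) <=
     p x * (u x * peak (u x) u0 ^+ n).
    move=> far; have PA : peak (u x) u0 ^+ n <= A ^+ n.
      apply: lerXn2r; rewrite ?nnegrE ?peak01 // /A /peak lerD2l lerN2.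
      by rewrite -(real_normK (num_real (u x - u0))); apply: lerXn2r; rewrite ?nnegrE // ltW.
    have h1 : - `|p x| <= p x by rewrite lerNl -normrN ler_norm.
    apply: (@le_trans _ _ (- `|p x| * (u x * peak (u x) u0 ^+ n))); last first.
      by apply: ler_wpM2r => //; rewrite mulr_ge0.
    rewrite mulNr lerN2 mulrA mulrC ler_wpM2r ?mulr_ge0 //.
  have uN : u (- x) = u x by exact: gaussianN.
  have far_pos y : 0 <= y -> d <= `|x0 - y| -> eta <= `|u y - u0|.
    move=> y0; rewrite ler_normr => /orP[h|h].
      have : u (x0 - d) <= u y.
        have [->|ne] := eqVneq y (x0 - d); first by [].
        by apply/ltW/gaussian_decreasing => //; rewrite lt_neqAle ne; lra.
      have e1 : eta <= u (x0 - d) - u0 by rewrite ge_min lexx.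
      by move=> h2; rewrite (le_trans _ (ler_norm _)) //; lra.
    have : u y <= u (x0 + d).
      have [->|ne] := eqVneq y (x0 + d); first by [].
      by apply/ltW/gaussian_decreasing; [lra|rewrite lt_neqAle eq_sym ne; lra].
    have e1 : eta <= u0 - u (x0 + d) by rewrite ge_min lexx orbT.
    by move=> h2; rewrite distrC (le_trans _ (ler_norm _)) //; lra.
  have [xp|xn] := leP 0 x.
    have [xd|xd] := ltP `|x0 - x| d; first exact: (near_case x).
    exact/far_case/far_pos.
  have [xd|xd] := ltP `|x0 - - x| d; first exact: (near_case (- x)).
  by apply: far_case; rewrite -uN; apply: far_pos => //; rewrite oppr_ge0 ltW.
pose K := \int[mu]_x (`|p x| * u x).
have iK : integrableR (fun x => `|p x| * u x).
  have := integrable_norm ip; congr integrableR; apply/funext => x /=.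
  by rewrite normrM (ger0_norm (gaussian_ge0 _ _)).
have iI : integrableR (\1_I : R -> R) by exact: integrable_indic_itv.
have intI : \int[mu]_x (\1_I x : R) = r + r.
  rewrite /Rintegral integral_indic; [|exact: measurableT|exact: measurable_itv].
  rewrite setIT; have := @lebesgue_measure_itv R `]x0 - r, x0 + r[.
  rewrite -/I /= lte_fin => ->.
  by rewrite ltrD2l gtrN // -EFinB /=; ring.
(* The right side of [low] has integral 0, so integration bounds [B^n] by a constant times [A^n] for
   every [n], which fails for large [n] as [A < B]. *)
have main n : c * m * B ^+ n * (r + r) <= A ^+ n * K.
  have i1 := integrableRZ (c * m * B ^+ n) iI; have i2 := integrableRZ (A ^+ n) iK.
  have e1 : \int[mu]_x (c * m * B ^+ n * \1_I x) = c * m * B ^+ n * (r + r).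
    by rewrite RintegralZl // intI.
  have e2 : \int[mu]_x (A ^+ n * (`|p x| * u x)) = A ^+ n * K.
    by rewrite RintegralZl.
  rewrite -subr_le0 -e1 -e2 -RintegralB //.
  rewrite -[leRHS](H n).
  exact: (@le_Rintegral _ _ _ mu setT _ _ measurableT (integrableRB i1 i2) (ipn n) (fun x _ => low n x)).
have K0 : 0 <= K by apply: Rintegral_ge0 => x _; rewrite mulr_ge0 // expR_ge0.
pose q := A / B.
have q0 : 0 <= q by rewrite divr_ge0 // ltW.
have q1 : `|q| < 1 by rewrite ger0_norm // ltr_pdivrMr // mul1r.
have L n : c * m * (r + r) <= q ^+ n * K.
  have Bn : 0 < B ^+ n by rewrite exprn_gt0.
  by rewrite /q expr_div_n [leRHS]mulrAC ler_pdivlMr // [leLHS]mulrAC.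
have cq : q ^+ n * K @[n --> \oo] --> (0 : R).
  by rewrite -(mul0r K); apply: cvgM; [exact: cvg_expr|exact: cvg_cst].
have : c * m * (r + r) <= 0.
  by rewrite -(cvg_lim _ cq) //; apply: limr_ge; [apply/cvg_ex; exists 0|exact: nearW].
by rewrite leNgt mulr_gt0 // ?mulr_gt0 // addr_gt0.
Qed.

End Completeness.

HB.lock Definition gaussian_mass {R : realType} (k : R[i]) (t : R) : R[i] :=
  integralc (fun x => (gaussian t x)%:C * dunkl_weight k x).

Section Inversion.
Context {R : realType}.
Local Notation mu := (@lebesgue_measure R).
Variable k : R[i].
Hypothesis hk : 0 <= complex.Re k.
Local Notation w := (dunkl_weight k).
Local Notation ii := (0 +i* 1 : R[i]).
Local Notation D := (dunkl_integral k).

(** The weight is complex, so the phase is rotated: for [q] the conjugate of [h x * w x], the real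
    part of [q * (h * w)] is positive at [x], and the peaks apply to it. Linear growth is allowed
    because the odd part of a bounded function will enter multiplied by [x]. *)
Lemma gaussian_complete_even (h : R -> R[i]) M : continuousc h ->
  (forall x, h (- x) = h x) -> (forall x, cmod (h x) <= M * (1 + `|x|)) ->
  (forall t, 0 < t -> integralc (fun x => h x * (gaussian t x)%:C * w x) = 0) ->
  forall x, x != 0 -> h x = 0.
Proof.
move=> ch hN hM h0.
have mh := continuous_measurablec ch.
suff pos x : 0 < x -> h x = 0.
  by move=> x; case: ltgtP => // [x0 _|/pos //]; rewrite -hN pos // oppr_gt0.
move=> x0; apply/eqP/negPn/negP => hx.
have wx : w x != 0 by rewrite weight_neq0 // gt_eqF.
pose q : R[i] := (h x * w x)^*.
pose p y := complex.Re (q * (h y * w y)).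
have qq : p x = cmod (h x * w x) ^+ 2.
  by rewrite /p /q cmod_sqr; case: (h x * w x) => a b; rewrite cReM /=; ring.
have px : 0 < p x.
  by rewrite qq exprn_gt0 // lt_def cmod_ge0 cmod_eq0 mulf_neq0.
have pE y (r : R) : p y * r = complex.Re (q * (h y * r%:C * w y)).
  rewrite /p (_ : q * (h y * r%:C * w y) = q * (h y * w y) * r%:C); last first.
    by move: (w y) => *; ring.
  by rewrite [RHS]cReM /= mulr0 subr0.
have u01 : 0 < gaussian 1 x <= 1.
  rewrite expR_gt0 /= /gaussian -[leRHS]expR0 ler_expR oppr_le0.
  by rewrite divr_ge0 // mulr_ge0 ?sqr_ge0.
have key n j := peak_integral hk mh hM h0 n j u01.
apply: (@peak_separation R p x (p x / 2)) => //.
- by rewrite divr_gt0.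
- by move=> y; rewrite /p hN weightN.
- have cw := is_derivec_continuous_at (weight_derive k x0).
  have cx : continuousc_at x h by split; [exact: ch.1|exact: ch.2].
  have cq : continuousc_at x (fun=> q) by split; exact: cvg_cst.
  exact: (continuousc_atM cq (continuousc_atM cx cw)).1.
- by lra.
- have [i1 _] := key 0%N 0%N; have := (integrablecZ q i1).1.
  congr integrableR; apply/funext => y; rewrite /Rec /= pE expr1 expr0 mulr1 //.
- move=> n; have [i1 _] := key n 0%N; have := (integrablecZ q i1).1.
  by congr integrableR; apply/funext => y; rewrite /Rec /= pE expr1.
- move=> n; have [i1 e1] := key n 0%N; have := integralcZ q i1.
  rewrite e1 mulr0 => /(congr1 (@complex.Re R)) /= e2; rewrite -[RHS]e2.
  by apply: eq_Rintegral => y _; rewrite pE expr1.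
Qed.

(** Both [h x + h (- x)] and [x * (h x - h (- x))] are even; Gaussians test the first, Gaussians
    times [x] the second. *)
Lemma gaussian_complete (h : R -> R[i]) M : continuousc h ->
  (forall x, cmod (h x) <= M) ->
  (forall t, 0 < t -> integralc (fun x => h x * (gaussian t x)%:C * w x) = 0) ->
  (forall t, 0 < t -> integralc (fun x => h x * (x%:C * (gaussian t x)%:C) * w x) = 0) ->
  forall x, x != 0 -> h x = 0.
Proof.
move=> ch hM h0 h1 x xn0.
have mh := continuous_measurablec ch.
have cN : continuousc (fun x => h (- x)).
  by apply: continuousc_comp => // y; exact: opp_continuous.
have mN := continuous_measurablec cN.
have iH (f : R -> R[i]) t : 0 < t -> measurablec f -> (forall x, cmod (f x) <= M) ->
    integrablec (fun x => f x * (gaussian t x)%:C * w x).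
  move=> t0 mf fM; apply: rapid_weight_integrable => //.
    by apply: measurablecM => //; exact: gaussian_measurable.
  under eq_fun do rewrite mulrC; exact: rapidMl (gaussian_rapid t0) fM.
have mX : measurablec (fun x : R => x%:C) by exact: measurablec_real.
have iX (f : R -> R[i]) t : 0 < t -> measurablec f -> (forall x, cmod (f x) <= M) ->
    integrablec (fun x => f x * (x%:C * (gaussian t x)%:C) * w x).
  move=> t0 mf fM; apply: rapid_weight_integrable => //.
    by apply: measurablecM => //; apply: measurablecM => //; exact: gaussian_measurable.
  under eq_fun do rewrite mulrC -[X in X * _ * _]expr1.
  exact: rapidMl (rapidX 1 (gaussian_rapid t0)) fM.
have M0 : 0 <= M by exact: le_trans (cmod_ge0 _) (hM 0).
have e0 : h x + h (- x) = 0.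
  apply: (@gaussian_complete_even (fun x => h x + h (- x)) (2 * M)) => //.
  - exact: continuouscD.
  - by move=> y; rewrite opprK addrC.
  - move=> y; apply: le_trans (ler_cmodD _ _) _.
    apply: (@le_trans _ _ (2 * M)); first by have := hM y; have := hM (- y); lra.
    by rewrite ler_peMr ?mulr_ge0 // lerDl.
  - move=> t t0.
    have -> : (fun x => (h x + h (- x)) * (gaussian t x)%:C * w x) =
       fun x => h x * (gaussian t x)%:C * w x + h (- x) * (gaussian t x)%:C * w x.
      by apply/funext => y; rewrite !mulrDl.
    rewrite integralcD ?h0 ?add0r //; try by apply: iH.
    rewrite integralc_opp; last by apply: iH.
    rewrite -[RHS](h0 t t0); congr integralc; apply/funext => y.
    by rewrite opprK gaussianN weightN.
have e1 : x%:C * (h x - h (- x)) = 0.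
  apply: (@gaussian_complete_even (fun x => x%:C * (h x - h (- x))) (2 * M)) => //.
  - apply: continuouscM; first by apply: continuousc_real => y; exact: cvg_id.
    rewrite (_ : (fun x => h x - h (- x)) = fun x => h x + (-1) * h (- x)).
      by apply: continuouscD => //; apply: continuouscM => //; exact: continuousc_cst.
    by apply/funext => y; rewrite mulN1r.
  - by move=> y; rewrite opprK real_complexN; ring.
  - move=> y; rewrite cmodM cmod_real.
    apply: (@le_trans _ _ (`|y| * (2 * M))); last first.
      by rewrite mulrC ler_wpM2l ?mulr_ge0 // lerDr.
    rewrite ler_wpM2l //; apply: le_trans (ler_cmodB _ _) _.
    by have := hM y; have := hM (- y); lra.
  - move=> t t0.
    have -> : (fun x => x%:C * (h x - h (- x)) * (gaussian t x)%:C * w x) =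
       fun x => h x * (x%:C * (gaussian t x)%:C) * w x -
                h (- x) * (x%:C * (gaussian t x)%:C) * w x.
      by apply/funext => y; move: (w y) => *; ring.
    rewrite integralcB ?h1 ?sub0r //; try by apply: iX.
    rewrite integralc_opp; last by apply: iX.
    apply/eqP; rewrite oppr_eq0; apply/eqP.
    rewrite -[RHS]oppr0 -[in RHS](h1 t t0) -integralcN; last exact: iX.
    congr integralc; apply/funext => y.
    by rewrite opprK gaussianN weightN real_complexN; move: (w y) => *; ring.
move/eqP: e1; rewrite mulf_eq0 real_complex_eq0 (negbTE xn0) /= subr_eq0 => /eqP e1.
move: e0; rewrite -e1 => /eqP; rewrite -mulr2n mulrn_eq0 /= => /eqP //.
Qed.

Local Notation gaussian_mass := (gaussian_mass k).

Lemma gaussian_massE : dunkl_const k = gaussian_mass 1.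
Proof.
by rewrite gaussian_mass.unlock; congr integralc; apply/funext => x; rewrite /gaussian mul1r.
Qed.

(** Identities such as [weightM] hold off the origin, which is a null set. *)
Lemma eq_integralc_ae (f g : R -> R[i]) : integrablec f -> integrablec g ->
  (forall x, x != 0 -> f x = g x) -> integralc f = integralc g.
Proof.
move=> hf hg fg; apply/eqP; rewrite -subr_eq0 -integralcB //; apply/eqP.
have z (P : R[i] -> R) : P 0 = 0 -> \int[mu]_x P (f x - g x) = 0.
  move=> P0; have := @Rintegral_set1 R (fun x => P (f x - g x)) 0.
  rewrite Rintegral_mkcond => e; rewrite -[RHS]e.
  apply: eq_Rintegral => x _; rewrite patchE.
  have [/set_mem -> //|] := boolP (x \in [set 0]).
  move=> /negP h; rewrite fg ?subrr //; apply/eqP => x0; apply: h; exact/mem_set.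
by apply: eqcP => /=; exact: z.
Qed.

(** By homogeneity of the weight, [gaussian_mass t] is [t^(- k - 1/2)] times [gaussian_mass 1];
    writing [t = s^2] avoids complex powers. *)
Lemma gaussian_mass_scale (s : R) : 0 < s ->
  gaussian_mass 1 = s%:C * w s * gaussian_mass (s ^+ 2).
Proof.
move=> s0; have s20 : 0 < s ^+ 2 by rewrite exprn_gt0.
have i1 := rapid_weight_integrable hk (gaussian_measurable 1) (@gaussian_rapid R 1 ltr01).
have i2 := rapid_weight_integrable hk (gaussian_measurable (s ^+ 2)) (gaussian_rapid s20).
rewrite gaussian_mass.unlock (integralc_scale s0 i1) -mulrA; congr (_ * _); rewrite -integralcZ //.
apply: eq_integralc_ae.
- exact: integrablec_scale s0 i1.
- exact: integrablecZ.
- move=> x x0; rewrite weightM // mulrCA (_ : gaussian 1 (s * x) = gaussian (s ^+ 2) x) //.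
  by rewrite /gaussian; congr expR; ring.
Qed.

Lemma weight1 : w 1 = 1.
Proof.
by rewrite /dunkl_weight normr1 powR1 ln1 mulr0 cos0 sin0 mulr0 mulr1.
Qed.

Lemma gaussian_mass_sqrt t : 0 < t -> gaussian_mass 1 =
  (Num.sqrt t)%:C * w (Num.sqrt t) * gaussian_mass t.
Proof.
move=> t0; have s0 : 0 < Num.sqrt t by rewrite sqrtr_gt0.
have e : Num.sqrt t ^+ 2 = t by rewrite sqr_sqrtr // ltW.
by rewrite (gaussian_mass_scale s0) e.
Qed.

(** The powers of [t] and of its inverse cancel; this product is the origin of the constant in the
    inversion formula. *)
Lemma gaussian_mass_mul t : 0 < t ->
  gaussian_mass t * gaussian_mass t^-1 = dunkl_const k ^+ 2.
Proof.
move=> t0; have ti0 : 0 < t^-1 by rewrite invr_gt0.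
have s0 : 0 < Num.sqrt t by rewrite sqrtr_gt0.
have sn0 : Num.sqrt t != 0 by rewrite gt_eqF.
have e1 := gaussian_mass_sqrt t0; have e2 := gaussian_mass_sqrt ti0.
have ei : Num.sqrt t^-1 = (Num.sqrt t)^-1 by rewrite sqrtrV // ltW.
have ws : w (Num.sqrt t) * w (Num.sqrt t^-1) = 1.
  by rewrite ei -weightM ?invr_eq0 // mulfV // weight1.
have ss : (Num.sqrt t)%:C * (Num.sqrt t^-1)%:C = 1 :> R[i].
  by rewrite ei -real_complexM mulfV.
have aux (C : comNzRingType) (m s u v p q : C) : s * p = 1 -> u * q = 1 ->
    s * u * m * (p * q * v) = m * v.
  move=> h1 h2; have -> : s * u * m * (p * q * v) = (s * p) * (u * q) * (m * v) by ring.
  by rewrite h1 h2 !mul1r.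
by rewrite gaussian_massE expr2 {1}e1 e2 (aux _ _ _ _ _ _ _ ss ws).
Qed.

(** If the constant vanished, so would every [gaussian_mass] by scaling, and the function 1 would be
    orthogonal to all Gaussians, against completeness. *)
Lemma dunkl_const_neq0 : dunkl_const k != 0.
Proof.
apply/negP => /eqP c0.
have m0 t : 0 < t -> gaussian_mass t = 0.
  move=> t0; have s0 : 0 < Num.sqrt t by rewrite sqrtr_gt0.
  have := gaussian_mass_sqrt t0; rewrite -gaussian_massE c0.
  move=> /esym/eqP; rewrite !mulf_eq0 real_complex_eq0 (gt_eqF s0) /=.
  have ws : w (Num.sqrt t) != 0 by apply: weight_neq0; rewrite gt_eqF.
  by rewrite (negbTE ws) => /eqP.
have := @gaussian_complete_even (fun=> 1) 1 (continuousc_cst 1) (fun=> erefl) _ _ 1 (oner_neq0 _).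
move=> H; suff : (1 : R[i]) = 0 by apply/eqP; rewrite oner_eq0.
apply: H => [x|t t0].
  by rewrite (cmod_nat 1) mul1r lerDl.
by rewrite -[RHS](m0 t t0) gaussian_mass.unlock; congr integralc; apply/funext => x; rewrite mul1r.
Qed.

Lemma one_2k_neq0 : 1 + 2 * k != 0.
Proof.
by have := dunkl_fact_neq0 hk 1; rewrite dunkl_factS dunkl_fact0 /= mulr1 mul1r.
Qed.

Lemma dunkl_gaussian t x :
  dunkl k (gaussc t) x = (- t)%:C * (x%:C * (gaussian t x)%:C).
Proof.
rewrite (dunklE _ _ (gaussianc_derive t)) gaussianN subrr mul0r add0r.
rewrite mulr0 oppr0 mul0r mulr0 mulr0 mulr0 addr0 -!real_complexM; congr (_%:C); ring.
Qed.

Lemma gaussianX_measurable t : measurablec (fun x : R => x%:C * (gaussian t x)%:C).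
Proof. by apply: measurablecM; [exact: measurablec_real|exact: gaussian_measurable]. Qed.

Lemma gaussianX_rapid t : 0 < t -> rapid (fun x : R => x%:C * (gaussian t x)%:C).
Proof.
move=> t0; have := rapidX 1 (gaussian_rapid t0).
by congr rapid; apply/funext => x; rewrite expr1.
Qed.

Lemma dunkl_integral_gaussianX t l : 0 < t ->
  D (fun x : R => x%:C * (gaussian t x)%:C) l = - ii * (t^-1)%:C * l%:C * D (gaussc t) l.
Proof.
move=> t0.
have cg' : continuousc (fun x => (- (t * x) * gaussian t x)%:C).
  apply: continuousc_real => x; apply: cvgM.
    by apply: cvgN; apply: cvgM; [exact: cvg_cst|exact: cvg_id].
  apply: differentiable_continuous; apply/derivable1_diffP.
  by case: (gaussian_derive t x).
have rg' : rapid (fun x => (- (t * x) * gaussian t x)%:C).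
  have := rapidZ (- t)%:C (gaussianX_rapid t0); congr rapid; apply/funext => x.
  by rewrite -!real_complexM; congr (_%:C); ring.
have := dunkl_integral_dunkl hk l (gaussianc_derive t) cg' (gaussian_rapid t0) rg'.
rewrite (_ : dunkl k (gaussc t) = fun x : R => (- t)%:C * (x%:C * (gaussian t x)%:C)); last first.
  by apply/funext => x; exact: dunkl_gaussian.
rewrite dunkl_integralZ //; [|exact: gaussianX_measurable|exact: gaussianX_rapid].
have tn0 : t%:C != 0 :> R[i] by rewrite real_complex_eq0 gt_eqF.
rewrite real_complexN real_complexV.
move: (D _ l) (D _ l) l%:C t%:C tn0 (ii) => q p r s s0 i h.
have -> : - i * s^-1 * r * q = - s^-1 * (i * r * q) by ring.
by rewrite -h; field.
Qed.

(** Combining [T g = - t x g] with the intertwining relations gives [T (D g) = - (l / t) D g]. Since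
    [D g] is even, the reflection part drops out and a first-order differential equation remains,
    solved by the Gaussian of parameter [1 / t]. *)
Lemma dunkl_integral_gaussian t l : 0 < t ->
  D (gaussc t) l = gaussian_mass t * (gaussian t^-1 l)%:C.
Proof.
move=> t0; have mg := gaussian_measurable t; have rg := gaussian_rapid t0.
have tn0 : t%:C != 0 :> R[i] by rewrite real_complex_eq0 gt_eqF.
pose D' l := integralc (fun x => (gaussian t x)%:C *
   (- x%:C * dunkl_wave' k (- (l * x))) * w x).
have dD y : is_derivec y (D (gaussc t)) (D' y) by exact: dunkl_integral_derive.
have DN y : D (gaussc t) (- y) = D (gaussc t) y.
  rewrite dunkl_integralN //; congr (dunkl_integral k _ y).
  by apply/funext => x; rewrite gaussianN.
have ode y : dunkl k (D (gaussc t)) y = - (t^-1)%:C * y%:C * D (gaussc t) y.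
  transitivity (D (fun x : R => - ii * (x%:C * (gaussian t x)%:C)) y).
    exact: dunkl_dunkl_integral.
  rewrite (dunkl_integralZ hk (- ii) y (gaussianX_measurable t) (gaussianX_rapid t0)).
  rewrite dunkl_integral_gaussianX //.
  have i2 : ii * ii = -1 by apply: eqcP; rewrite !(cReM, cImM) /=; ring.
  transitivity ((ii * ii) * ((t^-1)%:C * y%:C * D (gaussc t) y)).
    by move: (D _ _) (_%:C) (_%:C) (ii) => *; ring.
  by rewrite i2; move: (D _ _) (_%:C) (_%:C) => *; ring.
have D'E y : D' y = - (t^-1)%:C * y%:C * D (gaussc t) y.
  have := ode y; rewrite (dunklE _ _ dD) DN subrr mul0r add0r.
  (* At 0 the equation reads [(1 + 2 k) * D' 0 = 0]. *)
  have [->|_] := eqVneq y 0; last by rewrite mul0r mulr0 addr0.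
  rewrite mul1r mulr0 mul0r => h.
  apply: (mulfI one_2k_neq0); rewrite mulr0 -[RHS]h; move: (D' 0) => *; ring.
pose E y := D (gaussc t) y * (expR (t^-1 * y ^+ 2 / 2))%:C.
have dE y : is_derivec y E 0.
  have he : is_derive y 1 (fun y : R => expR (t^-1 * y ^+ 2 / 2))
      (t^-1 * y * expR (t^-1 * y ^+ 2 / 2)).
    have h : is_derive y 1 (fun y : R => t^-1 * y ^+ 2 / 2) (t^-1 * y).
      by apply: is_derive_eq; rewrite -![_ *: _]/(_ * _) ?expr1 ?mulr1 ?scaler0 ?addr0;
        field; rewrite gt_eqF.
    apply: (is_derive_eq (@is_derive1_comp R expR _ y _ _ (is_derive_expR _) h)).
    by rewrite mulrC.
  apply: (is_derivec_eq (is_derivecM (dD y) (is_derivec_real he))).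
  rewrite D'E !real_complexM; move: (D _ _) (_%:C) (_%:C) (_%:C) => *; ring.
have Ec : E l = E 0.
  apply/eqP; rewrite -subr_eq0 -cmod_eq0 eq_le cmod_ge0 andbT.
  have := @difference_le _ E (fun=> 0) 0 dE _ 0 l.
  by rewrite cmod0 mulr0 mul0r; apply.
have E0 : E 0 = gaussian_mass t.
  rewrite /E expr0n /= mulr0 mul0r expR0 mulr1.
  by rewrite gaussian_mass.unlock dunkl_integralE; congr integralc; apply/funext => x; rewrite mul0r oppr0 dunkl_wave0 // mulr1.
rewrite -E0 -Ec /E -mulrA -real_complexM /gaussian -expRD addrN expR0 mulr1 //.
Qed.

Let Dgg t x : 0 < t -> D (D (gaussc t)) x = dunkl_const k ^+ 2 * (gaussian t x)%:C.
Proof.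
move=> t0; have ti0 : 0 < t^-1 by rewrite invr_gt0.
rewrite (_ : D (gaussc t) = fun l => gaussian_mass t * (gaussian t^-1 l)%:C); last first.
  by apply/funext => l; exact: dunkl_integral_gaussian.
rewrite dunkl_integralZ //; [|exact: gaussian_measurable|exact: gaussian_rapid].
by rewrite dunkl_integral_gaussian // invrK mulrA gaussian_mass_mul.
Qed.

Let DgX t : 0 < t -> D (fun y : R => y%:C * (gaussian t y)%:C) =
    fun l : R => (- ii * (t^-1)%:C * gaussian_mass t) * (l%:C * (gaussian t^-1 l)%:C).
Proof.
move=> t0; apply/funext => l; rewrite dunkl_integral_gaussianX // dunkl_integral_gaussian //.
by move: (gaussian_mass t) (_%:C) (_%:C) (_%:C) (ii) => *; ring.
Qed.

Let DggX t x : 0 < t -> D (D (fun y : R => y%:C * (gaussian t y)%:C)) x =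
  - dunkl_const k ^+ 2 * (x%:C * (gaussian t x)%:C).
Proof.
move=> t0; have ti0 : 0 < t^-1 by rewrite invr_gt0.
rewrite DgX // dunkl_integralZ //; [|exact: gaussianX_measurable|exact: gaussianX_rapid].
rewrite dunkl_integral_gaussianX // dunkl_integral_gaussian // invrK.
rewrite -(gaussian_mass_mul t0).
have i2 : ii * ii = -1 by apply: eqcP; rewrite !(cReM, cImM) /=; ring.
have tt : (t^-1)%:C * t%:C = 1 :> R[i] by rewrite -real_complexM mulVf ?gt_eqF.
transitivity ((ii * ii) * ((t^-1)%:C * t%:C) * (gaussian_mass t * gaussian_mass t^-1 *
    (x%:C * (gaussian t x)%:C))).
  by move: (gaussian_mass t) (gaussian_mass t^-1) (gaussian t x)%:C x%:C t%:C (t^-1)%:C (ii) => *; ring.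
by rewrite i2 tt; move: (gaussian_mass t) (gaussian_mass t^-1) (_%:C) (_%:C) => *; ring.
Qed.

(** Adjointness moves both transforms onto a test function, a Gaussian or [x] times a Gaussian, for
    which the formula is explicit; completeness is then applied to the difference of the two sides.
    The point 0 is excluded as in [gaussian_complete]. *)
Theorem dunkl_inversion (f : R -> R[i]) : continuousc f -> rapid f -> rapid (D f) ->
  forall x, x != 0 -> D (D f) x = dunkl_const k ^+ 2 * f (- x).
Proof.
move=> cf rf rD x x0.
have mf := continuous_measurablec cf.
have cD := dunkl_integral_continuous hk mf rf.
have mD := continuous_measurablec cD.
have cDD := dunkl_integral_continuous hk mD rD.
have mDD := continuous_measurablec cDD.
have [A A0 hA] := rapid_bounded rf; have [B B0 hB] := dunkl_integral_bound hk mD rD.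
set C := dunkl_const k ^+ 2.
have mfN : measurablec (fun x => f (- x)).
  apply: continuous_measurablec; apply: continuousc_comp => // y; exact: opp_continuous.
have key (g : R -> R[i]) : measurablec g -> rapid g -> measurablec (D g) ->
    rapid (D g) -> (forall x, D (D g) x = C * g (- x)) ->
    integralc (fun x => (D (D f) x - C * f (- x)) * g x * w x) = 0.
  move=> mg rg mDg rDg gE.
  have i1 : integrablec (fun x => D (D f) x * g x * w x).
    apply: rapid_weight_integrable => //; first exact: measurablecM.
    under eq_fun do rewrite mulrC; exact: rapidMl rg hB.
  have i2 : integrablec (fun x => f (- x) * g x * w x).
    apply: rapid_weight_integrable => //; first exact: measurablecM.
    by under eq_fun do rewrite mulrC; apply: rapidMl rg _ => y; exact: hA.
  have -> : (fun x => (D (D f) x - C * f (- x)) * g x * w x) =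
     fun x => D (D f) x * g x * w x - C * (f (- x) * g x * w x).
    by apply/funext => y; move: (w y) (D _ _) => *; ring.
  rewrite integralcB ?integralcZ //; last exact: integrablecZ.
  rewrite (dunkl_integral_adjoint hk mD rD mg rg).
  rewrite (dunkl_integral_adjoint hk mf rf mDg rDg).
  apply/eqP; rewrite subr_eq0; apply/eqP.
  rewrite -integralcZ // integralc_opp; last first.
    under eq_fun do rewrite gE -mulrA.
    have := integrablecZ C (integrablec_opp i2); congr integrablec; apply/funext => y.
    by rewrite opprK weightN; move: (w y) => *; ring.
  by congr integralc; apply/funext => y; rewrite gE opprK weightN; move: (w y) => *; ring.
have Dg t : 0 < t -> D (gaussc t) = fun l => gaussian_mass t * (gaussian t^-1 l)%:C.
  by move=> t0; apply/funext => l; exact: dunkl_integral_gaussian.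
apply/eqP; rewrite -subr_eq0; apply/eqP.
apply: (@gaussian_complete (fun x => D (D f) x - C * f (- x)) (B + cmod C * A)) => //.
- rewrite (_ : (fun x => _) = fun x => D (D f) x + (- C) * f (- x)).
    apply: continuouscD => //; apply: continuouscM; first exact: continuousc_cst.
    by apply: continuousc_comp => // y; exact: opp_continuous.
  by apply/funext => y; rewrite mulNr.
- move=> y; apply: le_trans (ler_cmodB _ _) _; rewrite cmodM; apply: lerD => //.
  by rewrite ler_wpM2l ?cmod_ge0.
- move=> t t0; have ti0 : 0 < t^-1 by rewrite invr_gt0.
  apply: key.
  + exact: gaussian_measurable.
  + exact: gaussian_rapid.
  + by rewrite Dg //; apply: measurablecZ; exact: gaussian_measurable.
  + by rewrite Dg //; apply: rapidZ; exact: gaussian_rapid.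
  + by move=> y; rewrite Dgg // gaussianN.
- move=> t t0; have ti0 : 0 < t^-1 by rewrite invr_gt0.
  apply: key.
  + exact: gaussianX_measurable.
  + exact: gaussianX_rapid.
  + by rewrite DgX //; apply: measurablecZ; exact: gaussianX_measurable.
  + by rewrite DgX //; apply: rapidZ; exact: gaussianX_rapid.
  + by move=> y; rewrite DggX // gaussianN real_complexN mulNr mulNr mulrN.
Qed.

End Inversion.

(** * Schwartz functions *)

Section Schwartz.
Context {R : realType}.
Local Notation mu := (@lebesgue_measure R).
Implicit Types (f g : R -> R[i]) (F G : nat -> R -> R[i]).

(** All derivatives are given as an explicit sequence, so that stability under an operation is shown
    by writing down the sequence of the result. *)
Definition derivative_tower F :=
  (forall n x, is_derivec x (F n) (F n.+1 x)) /\ (forall n, rapid (F n)).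

Definition tower_schwartz f := exists2 F, derivative_tower F & F 0%N = f.

Lemma schwartz_tower f : schwartz f -> tower_schwartz f.
Proof.
move=> [sf rf]; exists (fun n => iter n (@derive1c R) f) => //; split.
  by move=> n x; have [h1 h2] := sf n x; exact: is_derivecP h1 h2.
by move=> n m; exact: rf.
Qed.

Lemma is_derivec_id (x : R) : is_derivec x (fun y : R => y%:C) 1.
Proof. exact: (@is_derivec_real _ x id 1 (is_derive_id x 1)). Qed.

Lemma tower_schwartzX f : tower_schwartz f -> tower_schwartz (fun x => x%:C * f x).
Proof.
move=> [F [dF rF] <-].
(* Leibniz rule; for [n = 0] the junk index [n.-1] is multiplied by 0. *)
exists (fun n x => x%:C * F n x + n%:R * F n.-1 x); last first.
  by apply/funext => x; rewrite mul0r addr0.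
split=> [n x|n]; last first.
  apply: rapidD; last by apply: rapidZ; exact: rF.
  by have := rapidX 1 (rF n); congr rapid; apply/funext => x; rewrite expr1.
have h1 := is_derivecM (is_derivec_id x) (dF n x).
case: n h1 => [|n] h1.
  apply: (is_derivec_eq (is_derivecD h1 (is_derivecZ (0%:R) (dF 0%N x)))).
  by rewrite /=; ring.
apply: (is_derivec_eq (is_derivecD h1 (is_derivecZ n.+1%:R (dF n x)))).
by rewrite /= -!natr1; ring.
Qed.

Let I : set R := `[-1, 1]%classic.

(* The [n]-th derivative of [(F 0 x - F 0 (- x)) / x]. *)
Definition mean_moment F (n : nat) (x : R) : R[i] :=
  integralc (fun t => (\1_I t * t ^+ n)%:C * F n.+1 (x * t)).

Let N11 : (-1 : R) < 1.
Proof. by rewrite (lt_trans (ltrN10 R)). Qed.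

Let iI : integrableR (\1_I : R -> R).
Proof. exact: integrable_indic_itv. Qed.

Let weight_le1 n t : `|\1_I t * t ^+ n : R| <= \1_I t.
Proof.
rewrite indicE; have [tI|_] := boolP (t \in I); last by rewrite mul0r normr0.
rewrite mul1r normrX exprn_ile1 //.
by move: tI; rewrite inE /I /= in_itv /= ler_norml.
Qed.

Let moment_measurable F n x : derivative_tower F ->
  measurablec (fun t => (\1_I t * t ^+ n)%:C * F n.+1 (x * t)).
Proof.
move=> [dF rF]; apply: measurablecM.
  apply: measurablec_real; apply: measurable_funM.
    exact: (integrableR_measurable iI).
  exact: exprn_measurable.
apply: continuous_measurablec; apply: continuousc_comp.
  exact: (is_derivec_continuous (dF n.+1)).
by move=> t; apply: cvgM; [exact: cvg_cst|exact: cvg_id].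
Qed.

Let moment_integrable F n x : derivative_tower F ->
  integrablec (fun t => (\1_I t * t ^+ n)%:C * F n.+1 (x * t)).
Proof.
move=> tF; have [M M0 hM] := rapid_bounded (tF.2 n.+1).
apply: (@integrablec_le _ _ (fun t => M * \1_I t)); last exact: integrableRZ.
  exact: moment_measurable.
move=> t; rewrite cmodM cmod_real mulrC; apply: ler_pM; rewrite ?cmod_ge0 ?weight_le1 //.
Qed.

Lemma mean_moment_derive F n x : derivative_tower F ->
  is_derivec x (mean_moment F n) (mean_moment F n.+1 x).
Proof.
move=> tF; have [dF rF] := tF; have [M M0 hM] := rapid_bounded (rF n.+2).
apply: (@integralc_derive _ (fun l t => (\1_I t * t ^+ n)%:C * F n.+1 (l * t))
  (fun l t => (\1_I t * t ^+ n.+1)%:C * F n.+2 (l * t)) (fun t => M * \1_I t)).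
- by move=> l; exact: moment_integrable.
- move=> l t; have := dF n.+1 (t * l) => /is_derivec_scale.
  move=> /(is_derivecZ (\1_I t * t ^+ n)%:C) h.
  apply: (@eq_is_derivec _ _ (fun y => (\1_I t * t ^+ n)%:C * F n.+1 (t * y))).
    apply: (is_derivec_eq h); rewrite mulrA -real_complexM mulrC (mulrC t l).
    by rewrite mulrC; congr (_%:C * _); rewrite exprSr mulrA.
  by move=> y; rewrite mulrC (mulrC t y) mulrC.
- move=> l t; rewrite cmodM cmod_real mulrC; apply: ler_pM; rewrite ?cmod_ge0 ?weight_le1 //.
- exact: integrableRZ.
Qed.

Lemma mean_moment_bounded F n : derivative_tower F ->
  exists M, forall x, cmod (mean_moment F n x) <= M.
Proof.
move=> tF; have [M M0 hM] := rapid_bounded (tF.2 n.+1).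
exists (2 * \int[mu]_t (M * \1_I t)) => x.
apply: cmod_integralc_le; first exact: moment_integrable.
  move=> t; rewrite cmodM cmod_real mulrC; apply: ler_pM; rewrite ?cmod_ge0 ?weight_le1 //.
exact: integrableRZ.
Qed.

(** The fundamental theorem of calculus for [t -> F 0 (x t)] on [[-1, 1]]. *)
Lemma mean_moment0 F x : derivative_tower F ->
  x%:C * mean_moment F 0 x = F 0%N x - F 0%N (- x).
Proof.
move=> tF; have [dF rF] := tF.
rewrite /mean_moment -integralcZ; last exact: moment_integrable.
have dG t : is_derivec t (fun t => F 0%N (x * t)) (x%:C * F 1%N (x * t)).
  exact: is_derivec_scale.
have cG' : continuousc (fun t => x%:C * F 1%N (x * t)).
  apply: continuouscM; first exact: continuousc_cst.
  apply: continuousc_comp; first exact: (is_derivec_continuous (dF 1%N)).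
  by move=> t; apply: cvgM; [exact: cvg_cst|exact: cvg_id].
have FTC (h h' : R -> R) : (forall t : R, is_derive t 1 h (h' t)) -> continuous h' ->
    \int[mu]_t (h' t * \1_I t) = h 1 - h (-1).
  move=> dh ch'; have ch t : {for t, continuous h}.
    apply: differentiable_continuous; apply/derivable1_diffP.
    by case: (dh t).
  transitivity (\int[mu]_(t in I) h' t).
    rewrite [RHS]Rintegral_mkcond; apply: eq_Rintegral => t _.
    by rewrite patchE indicE; case: ifP; rewrite ?mulr1 ?mulr0.
  rewrite /Rintegral /I (@continuous_FTC2 _ h' h) //.
  - exact: continuous_subspaceT.
  - split; first by move=> t _; case: (dh t).
      by apply: cvg_at_right_filter; exact: ch.
    by apply: cvg_at_left_filter; exact: ch.
  - by move=> t _; rewrite derive1E (@derive_val _ _ _ _ _ _ _ (dh t)).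
have e : (fun t => x%:C * ((\1_I t * t ^+ 0)%:C * F 1%N (x * t))) =
    (fun t => (x%:C * F 1%N (x * t)) * (\1_I t)%:C).
  by apply/funext => t; rewrite expr0 mulr1; ring.
rewrite e; apply: eqcP => /=.
  have := FTC _ _ (fun t => (dG t).1) cG'.1; rewrite /Rec mulr1 mulrN1 cReD cReN => <-.
  by apply: eq_Rintegral => t _; rewrite [LHS]cReM /= mulr0 subr0.
have := FTC _ _ (fun t => (dG t).2) cG'.2; rewrite /Imc mulr1 mulrN1 cImD cImN => <-.
by apply: eq_Rintegral => t _; rewrite [LHS]cImM /= mulr0 add0r.
Qed.

Lemma mean_moment_at0 F : derivative_tower F -> mean_moment F 0 0 = 2 * F 1%N 0.
Proof.
move=> tF; rewrite /mean_moment.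
have e : (fun t => (\1_I t * t ^+ 0)%:C * F 1%N (0 * t)) = (fun t => F 1%N 0 * (\1_I t)%:C).
  by apply/funext => t; rewrite expr0 mulr1 mul0r mulrC.
have iIc : integrablec (fun t => (\1_I t : R)%:C).
  split; first exact: iI.
  exact: (@integrable0 _ _ _ mu setT).
rewrite e integralcZ // mulrC; congr (_ * _); apply: eqcP => /=.
  rewrite /Rec /= /Rintegral integral_indic; [|exact: measurableT|exact: measurable_itv].
  rewrite setIT; have := @lebesgue_measure_itv R `[-1, 1].
  by rewrite -/I /= lte_fin N11 => -> /=; rewrite opprK.
by rewrite Rintegral_cst // mul0r addr0.
Qed.

(** Leibniz rule for the [n]-th derivative of the identity [mean_moment0]. Solved for
    [x * mean_moment F n x], it trades a factor [x] for terms already known to decay. *)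
Lemma mean_moment_rec F n x : derivative_tower F ->
  x%:C * mean_moment F n x + n%:R * mean_moment F n.-1 x =
  F n x - (-1) ^+ n * F n (- x).
Proof.
move=> tF; have [dF rF] := tF; elim: n x => [|n IH] x.
  by rewrite mul0r addr0 expr0 mul1r mean_moment0.
have d1 : is_derivec x (fun y => y%:C * mean_moment F n y + n%:R * mean_moment F n.-1 y)
    (x%:C * mean_moment F n.+1 x + n.+1%:R * mean_moment F n x).
  have h1 := is_derivecM (is_derivec_id x) (mean_moment_derive n x tF).
  case: n h1 {IH} => [|n] h1.
    apply: (is_derivec_eq (is_derivecD h1 (is_derivecZ 0%:R (mean_moment_derive 0 x tF)))).
    by rewrite /=; move: (mean_moment _ _) => m; ring.
  apply: (is_derivec_eq (is_derivecD h1 (is_derivecZ n.+1%:R (mean_moment_derive n x tF)))).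
  by rewrite /= -!natr1; move: (mean_moment _ _) => m; ring.
have d2 : is_derivec x (fun y => F n y - (-1) ^+ n * F n (- y))
    (F n.+1 x - (-1) ^+ n.+1 * F n.+1 (- x)).
  apply: (is_derivec_eq (is_derivecB (dF n x) (is_derivecZ ((-1) ^+ n)
    (is_derivec_opp (dF n (- x)))))).
  by rewrite exprS; ring.
have e : (fun y => y%:C * mean_moment F n y + n%:R * mean_moment F n.-1 y) =
    (fun y => F n y - (-1) ^+ n * F n (- y)) by apply/funext => y; exact: IH.
by rewrite /= -(is_derivec_val d1) -(is_derivec_val d2) e.
Qed.

(** Strong induction on [n]: one factor [x] is removed by [mean_moment_rec], and the remaining [m]
    fall on [F n] and on the moment of order [n - 1]. *)
Lemma mean_moment_rapid F n : derivative_tower F -> rapid (mean_moment F n).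
Proof.
move=> tF; elim/ltn_ind: n => n IH [|m].
  have [M hM] := mean_moment_bounded n tF; exists M => x.
  by rewrite expr0 mul1r.
have [A hA] := tF.2 n m.
have [B hB] : exists B, forall x, n%:R * (`|x| ^+ m * cmod (mean_moment F n.-1 x)) <= B.
  case: n IH {A hA} => [|n] IH; first by exists 0 => x; rewrite mul0r.
  by have [B hB] := IH n (ltnSn n) m; exists (n.+1%:R * B) => x; rewrite ler_wpM2l.
exists (2 * A + B) => x.
have -> : `|x| ^+ m.+1 * cmod (mean_moment F n x) =
    `|x| ^+ m * cmod (x%:C * mean_moment F n x).
  by rewrite exprSr -mulrA cmodM cmod_real.
have -> : x%:C * mean_moment F n x =
    F n x - (-1) ^+ n * F n (- x) - n%:R * mean_moment F n.-1 x.
  by rewrite -mean_moment_rec // addrK.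
apply: (@le_trans _ _ (`|x| ^+ m * (cmod (F n x) + cmod (F n (- x)) +
   n%:R * cmod (mean_moment F n.-1 x)))).
  rewrite ler_wpM2l ?exprn_ge0 // (le_trans (ler_cmodB _ _)) // cmodM cmod_nat lerD2r.
  rewrite (le_trans (ler_cmodB _ _)) // cmodM cmodX cmodN (cmod_nat 1) expr1n mul1r //.
have h1 := hA x; have := hA (- x); rewrite normrN => h2; have h3 := hB x.
rewrite !mulrDr mulrCA; lra.
Qed.

Variable k : R[i].

Lemma dunkl_towerE F x : derivative_tower F ->
  dunkl k (F 0%N) x = F 1%N x + k * mean_moment F 0 x.
Proof.
move=> tF; rewrite (dunklE _ _ (tF.1 0%N)); congr (_ + k * _).
have [->|x0] := eqVneq x 0.
  by rewrite oppr0 subrr mul0r add0r mul1r mean_moment_at0.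
rewrite mul0r addr0 -mean_moment0 // real_complexV.
by field; rewrite real_complex_eq0.
Qed.

Lemma tower_schwartz_dunkl f : tower_schwartz f -> tower_schwartz (dunkl k f).
Proof.
move=> [F tF <-]; exists (fun n x => F n.+1 x + k * mean_moment F n x).
  split=> [n x|n].
    apply: is_derivecD; first exact: tF.1.
    by apply: is_derivecZ; exact: mean_moment_derive.
  apply: rapidD; first exact: tF.2.
  by apply: rapidZ; exact: mean_moment_rapid.
by apply/funext => x; rewrite dunkl_towerE.
Qed.

Lemma tower_schwartz_iter f n : tower_schwartz f -> tower_schwartz (iter n (dunkl k) f).
Proof. by move=> hf; elim: n => //= n IH; exact: tower_schwartz_dunkl. Qed.

Lemma tower_schwartz_C1 f : tower_schwartz f -> exists f',
  [/\ forall x, is_derivec x f (f' x), continuousc f', rapid f & rapid f'].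
Proof.
move=> [F [dF rF] <-]; exists (F 1%N); split => //.
exact: (is_derivec_continuous (dF 1%N)).
Qed.

Lemma tower_schwartz_rapid f : tower_schwartz f -> rapid f.
Proof. by move=> /tower_schwartz_C1[f' []]. Qed.

Lemma tower_schwartz_continuous f : tower_schwartz f -> continuousc f.
Proof. by move=> /tower_schwartz_C1[f' [df _ _ _]]; exact: is_derivec_continuous df. Qed.

Lemma tower_schwartz_measurable f : tower_schwartz f -> measurablec f.
Proof. by move=> /tower_schwartz_continuous; exact: continuous_measurablec. Qed.

End Schwartz.

(** * Upper bound *)

Section UpperBound.
Context {R : realType}.
Variable k : R[i].
Hypothesis hk : 0 <= complex.Re k.
Implicit Types f g : R -> R[i].
Local Notation mu := (@lebesgue_measure R).
Local Notation w := (dunkl_weight k).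
Local Notation ii := (0 +i* 1 : R[i]).
Local Notation D := (dunkl_integral k).
Local Notation T := (dunkl k).

Lemma dunkl_integral_iter f n l : tower_schwartz f ->
  D (iter n T f) l = (ii * l%:C) ^+ n * D f l.
Proof.
move=> hf; elim: n => [|n IH]; first by rewrite expr0 mul1r.
have [f' [d1 c1 r1 r2]] := tower_schwartz_C1 (tower_schwartz_iter k n hf).
by rewrite iterS (dunkl_integral_dunkl hk l d1 c1 r1 r2) IH exprS mulrA.
Qed.

Lemma cmod_dunkl_integral_iter f n l : tower_schwartz f ->
  cmod (D (iter n T f) l) = `|l| ^+ n * cmod (D f l).
Proof.
by move=> hf; rewrite dunkl_integral_iter // cmodM cmodX cmodM cmodi mul1r cmod_real.
Qed.

(** [D (T^m f)] is bounded and equals [(ii * l)^m * D f l]. *)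
Lemma dunkl_integral_rapid f : tower_schwartz f -> rapid (D f).
Proof.
move=> hf m; have hm := tower_schwartz_iter k m hf.
have [M M0 hM] := dunkl_integral_bound hk (tower_schwartz_measurable hm)
  (tower_schwartz_rapid hm).
by exists M => l; rewrite -cmod_dunkl_integral_iter.
Qed.

(** Inversion is available off 0; continuity extends the resulting bound to 0. *)
Lemma continuousc_cmod_le f C : continuousc f ->
  (forall x, x != 0 -> cmod (f x) <= C) -> forall x, cmod (f x) <= C.
Proof.
move=> cf fC x; have [->|/fC //] := eqVneq x 0.
have c0 : cmod (f (n.+1%:R^-1)) @[n --> \oo] --> cmod (f 0).
  apply: (@cvg_comp _ _ _ (fun n : nat => (n.+1%:R^-1 : R)) (fun x => cmod (f x)) _ (nbhs (0 : R))).
    exact: (@cvg_harmonic R).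
  exact: continuousc_cmod.
rewrite -(cvg_lim _ c0) //; apply: limr_le; first by apply/cvg_ex; exists (cmod (f 0)).
by apply: nearW => n; apply: fC; rewrite invr_eq0 pnatr_eq0.
Qed.

Lemma band_limited_bound f s : tower_schwartz f -> 0 <= s ->
  (forall l, s < `|l| -> D f l = 0) ->
  exists2 C, 0 <= C & forall n x, cmod (iter n T f x) <= C * s ^+ n.
Proof.
move=> hf s0 hs.
have mf := tower_schwartz_measurable hf; have rf := tower_schwartz_rapid hf.
have rD := dunkl_integral_rapid hf.
have cD := dunkl_integral_continuous hk mf rf.
have iDw := rapid_weight_integrable hk (continuous_measurablec cD) rD.
pose h x : R := 2 * cmod (D f x * w x).
have ih : integrableR h by apply: integrableRZ; exact: integrablec_cmod.
pose K := 2 * \int[mu]_x h x; pose c2 := cmod (dunkl_const k ^+ 2)^-1.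
have K0 : 0 <= K.
  by rewrite mulr_ge0 // Rintegral_ge0 // => x _; rewrite mulr_ge0 ?cmod_ge0.
exists (c2 * K); first by rewrite mulr_ge0 ?cmod_ge0.
move=> n; set g := iter n T f.
have hg : tower_schwartz g by exact: tower_schwartz_iter.
have mg := tower_schwartz_measurable hg; have rg := tower_schwartz_rapid hg.
have cg := tower_schwartz_continuous hg.
have rDg := dunkl_integral_rapid hg.
have mDg := continuous_measurablec (dunkl_integral_continuous hk mg rg).
apply: continuousc_cmod_le => // x x0.
have Nx0 : - x != 0 by rewrite oppr_eq0.
have c0 : dunkl_const k ^+ 2 != 0 by rewrite expf_neq0 // dunkl_const_neq0.
have -> : g x = (dunkl_const k ^+ 2)^-1 * D (D g) (- x).
  by rewrite (dunkl_inversion hk cg rg rDg Nx0) opprK mulKf.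
rewrite cmodM -mulrA ler_wpM2l ?cmod_ge0 //.
have -> : K * s ^+ n = 2 * \int[mu]_x (s ^+ n * h x).
  by rewrite RintegralZl // /K; ring.
rewrite dunkl_integralE; apply: cmod_integralc_le.
- exact: dunkl_integrand_integrable.
- move=> l; rewrite mulrAC cmodM cmodM cmod_dunkl_integral_iter // /h !cmodM.
  have b := dunkl_wave_bound hk (- (- x * l)).
  have [sl|sl] := ltP s `|l|.
    by rewrite hs // cmod0 !(mulr0, mul0r).
  have e1 : `|l| ^+ n <= s ^+ n by apply: lerXn2r; rewrite ?nnegrE.
  rewrite -(mulrA (`|l| ^+ n)) -mulrA.
  apply: ler_pM => //; rewrite ?exprn_ge0 ?mulr_ge0 ?cmod_ge0 //.
  by rewrite mulrC ler_wpM2r ?mulr_ge0 ?cmod_ge0.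
- exact: integrableRZ.
Qed.

Lemma dunklD f f' g g' x : (forall x, is_derivec x f (f' x)) ->
  (forall x, is_derivec x g (g' x)) ->
  T (fun y => f y + g y) x = T f x + T g x.
Proof.
move=> df dg; have d y := is_derivecD (df y) (dg y).
rewrite (dunklE _ _ d) (dunklE _ _ df) (dunklE _ _ dg).
by move: (x^-1)%:C ((x == 0)%:R : R[i]) => p q; ring.
Qed.

Lemma dunklX f f' x : (forall x, is_derivec x f (f' x)) ->
  T (fun y => y%:C * f y) x = x%:C * T f x + f x + 2 * k * f (- x).
Proof.
move=> df; have d y := is_derivecM (is_derivec_id y) (df y).
rewrite (dunklE _ _ d) (dunklE _ _ df) real_complexN.
have [->|x0] := eqVneq x 0.
  have z : (0 : R)%:C = 0 :> R[i] by [].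
  rewrite !z !oppr0 ?eqxx !mul0r [true%:R]mulr1n; move: (f 0) (f' 0) (0^-1)%:C => p q r; ring.
rewrite real_complexV [false%:R]mulr0n mul0r addr0; field; by rewrite real_complex_eq0.
Qed.

Lemma dunkl_opp f f' x : (forall x, is_derivec x f (f' x)) ->
  T (fun y => f (- y)) x = - T f (- x).
Proof.
move=> df; have d y := is_derivec_opp (df (- y)).
rewrite (dunklE _ _ d) (dunklE _ _ df) !opprK oppr0 invrN real_complexN oppr_eq0.
by move: (x^-1)%:C ((x == 0)%:R : R[i]) => p q; ring.
Qed.

(** The commutator of [T] and [x] is [1 + 2 k S] with [S] the reflection. As [T S = - S T], the
    contributions of [S] cancel in pairs and one is left for odd [n]. For [n = 0] the junk index
    [n.-1] is multiplied by 0. *)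
Lemma dunkl_iter_mulX f n x : tower_schwartz f ->
  iter n T (fun y => y%:C * f y) x =
  x%:C * iter n T f x + n%:R * iter n.-1 T f x +
  (odd n)%:R * (2 * k) * iter n.-1 T f (- x).
Proof.
move=> hf; elim: n x => [|n IH] x; first by rewrite /= !mul0r !addr0.
have [f1 [d1 _ _ _]] := tower_schwartz_C1 (tower_schwartz_iter k n hf).
have [f2 [d2 _ _ _]] := tower_schwartz_C1 (tower_schwartz_iter k n.-1 hf).
rewrite iterS (_ : iter n T _ = fun x => x%:C * iter n T f x + n%:R * iter n.-1 T f x +
  (odd n)%:R * (2 * k) * iter n.-1 T f (- x)); last exact/funext.
have dX y := is_derivecM (is_derivec_id y) (d1 y).
have dN y := is_derivec_opp (d2 (- y)).
rewrite (dunklD _ (fun y => is_derivecD (dX y) (is_derivecZ n%:R (d2 y)))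
  (fun y => is_derivecZ ((odd n)%:R * (2 * k)) (dN y))).
rewrite (dunklD _ dX (fun y => is_derivecZ n%:R (d2 y))).
rewrite (dunklX _ d1) (dunklZ _ _ _ d2) (dunklZ _ _ _ dN) (dunkl_opp _ d2).
case: n {IH d1 d2 dX dN} => [|n].
  by rewrite /= !mul0r mul1r; move: (T f x) => p; ring.
rewrite -!iterS /= -!natr1; case: (odd n) => /=;
  by move: (T _ _) (T _ _) (iter n T f x) => *; ring.
Qed.

(** Apart from the reflection, [T] is local, and the set [s < |l|] is open and symmetric: [T (D f)]
    vanishes there with [D f]. *)
Lemma band_limited_mulX f s : tower_schwartz f -> 0 <= s ->
  (forall l, s < `|l| -> D f l = 0) ->
  forall l, s < `|l| -> D (fun x => x%:C * f x) l = 0.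
Proof.
move=> hf s0 hs l sl.
have hX := tower_schwartzX hf.
have mX := tower_schwartz_measurable hX; have rX := tower_schwartz_rapid hX.
have mf := tower_schwartz_measurable hf; have rf := tower_schwartz_rapid hf.
have h := dunkl_dunkl_integral hk l mf rf.
rewrite (dunkl_integralZ hk (- ii) l mX rX) in h.
have i0 : - ii != 0 by rewrite oppr_eq0 eq_complex /= oner_eq0 andbF.
apply: (mulfI i0); rewrite mulr0 -h.
have l0 : l != 0 by rewrite -normr_gt0 (le_lt_trans s0).
have nz (P : R[i] -> R) : P 0 = 0 -> is_derive l 1 (fun y => P (D f y)) 0.
  move=> P0; have hc : is_derive l 1 (fun _ : R => (0 : R)) (0 : R) by exact: is_derive_cst.
  apply: near_eq_is_derive hc.
  exists (`|l| - s); first by rewrite /= subr_gt0.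
  move=> y /= ly; rewrite hs ?P0 //.
  have := ler_normD (l - y) y; rewrite subrK; move: ly; lra.
have dD : is_derivec l (D f) 0 by split; exact: nz.
rewrite /dunkl (is_derivec_val dD) (negbTE l0) !hs ?normrN //.
by rewrite subrr mul0r mulr0 addr0.
Qed.

Lemma band_limited_decay f s m : tower_schwartz f -> 0 < s ->
  (forall l, s < `|l| -> D f l = 0) ->
  exists2 C, 0 <= C & forall n x,
    `|x| ^+ m * cmod (iter n T f x) <= C * n.+1%:R ^+ m * s ^+ n.
Proof.
move=> hf s0; elim: m f hf => [|m IH] f hf hs.
  have [C C0 hC] := band_limited_bound hf (ltW s0) hs; exists C => // n x.
  by rewrite !expr0 mul1r mulr1.
have [C1 C10 h1] := IH _ (tower_schwartzX hf) (band_limited_mulX hf (ltW s0) hs).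
have [C2 C20 h2] := IH _ hf hs.
have k0 := cmod_ge0 k.
(* The commutator contains [T^(n-1) f], of size [s^(n-1)], which is rewritten as [s^n / s]; this is
   where [0 < s] enters. *)
pose C3 := (1 + 2 * cmod k) * C2 / s.
have C30 : 0 <= C3 by rewrite divr_ge0 ?(ltW s0) // mulr_ge0 // addr_ge0 // mulr_ge0.
exists (C1 + C3); first by rewrite addr_ge0.
move=> n x.
have -> : `|x| ^+ m.+1 * cmod (iter n T f x) = `|x| ^+ m * cmod (x%:C * iter n T f x).
  by rewrite exprSr -mulrA cmodM cmod_real.
have -> : x%:C * iter n T f x = iter n T (fun y => y%:C * f y) x -
    (n%:R * iter n.-1 T f x + (odd n)%:R * (2 * k) * iter n.-1 T f (- x)).
  by rewrite dunkl_iter_mulX //; move: (iter n T f x) (iter _ T f _) (iter _ T f _) => *; ring.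
have xm0 : 0 <= `|x| ^+ m by rewrite exprn_ge0.
apply: le_trans (ler_wpM2l xm0 (ler_cmodB _ _)) _; rewrite mulrDr.
have n1 : (1 : R) <= n.+1%:R by rewrite ler1n.
have N0 : 0 <= n.+1%:R ^+ m :> R by rewrite exprn_ge0.
have sn0 : 0 <= s ^+ n by rewrite exprn_ge0 // ltW.
have -> : (C1 + C3) * n.+1%:R ^+ m.+1 * s ^+ n =
   C1 * n.+1%:R ^+ m.+1 * s ^+ n + C3 * n.+1%:R ^+ m.+1 * s ^+ n by ring.
apply: lerD.
  apply: le_trans (h1 n x) _; rewrite ler_wpM2r // ler_wpM2l //.
  by rewrite exprS ler_peMl.
case: n n1 N0 sn0 => [|n] n1 N0 sn0.
  rewrite /= !mul0r addr0 cmod0 mulr0 mulr_ge0 // mulr_ge0 // exprn_ge0 //.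
rewrite succnK; set b := C2 * n.+1%:R ^+ m * s ^+ n.
have b1 := h2 n x; have b2 := h2 n (- x); rewrite normrN in b2.
have b0 : 0 <= b by rewrite !mulr_ge0 ?exprn_ge0 // ltW.
apply: (@le_trans _ _ ((n.+1%:R + 2 * cmod k) * b)).
  apply: (@le_trans _ _ (`|x| ^+ m * (n.+1%:R * cmod (iter n T f x) +
     2 * cmod k * cmod (iter n T f (- x))))).
    rewrite ler_wpM2l // (le_trans (ler_cmodD _ _)) // cmodM cmod_nat lerD2l.
    rewrite !cmodM !cmod_nat ler_wpM2r ?cmod_ge0 // ler_piMl ?mulr_ge0 //.
    by case: (odd _).
  rewrite [leLHS]mulrDr [leRHS]mulrDl.
  by apply: lerD; rewrite [leLHS]mulrCA ler_wpM2l ?mulr_ge0.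
have -> : C3 * n.+2%:R ^+ m.+1 * s ^+ n.+1 =
    (1 + 2 * cmod k) * C2 * n.+2%:R ^+ m.+1 * s ^+ n.
  by rewrite /C3 !exprS; field; rewrite gt_eqF.
have key : (n.+1%:R + 2 * cmod k) * n.+1%:R ^+ m <=
    (1 + 2 * cmod k) * n.+2%:R ^+ m.+1 :> R.
  rewrite exprS mulrA; apply: ler_pM; rewrite ?exprn_ge0 ?addr_ge0 ?mulr_ge0 //.
    have : (n.+1%:R : R) <= n.+2%:R by rewrite ler_nat.
    have : (1 : R) <= n.+2%:R by rewrite ler1n.
    by move: (n.+1%:R : R) (n.+2%:R : R) => p q; nra.
  by apply: lerXn2r; rewrite ?nnegrE // ler_nat.
have -> : (n.+1%:R + 2 * cmod k) * b =
    C2 * s ^+ n * ((n.+1%:R + 2 * cmod k) * n.+1%:R ^+ m) by rewrite /b; ring.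
have -> : (1 + 2 * cmod k) * C2 * n.+2%:R ^+ m.+1 * s ^+ n =
    C2 * s ^+ n * ((1 + 2 * cmod k) * n.+2%:R ^+ m.+1) by ring.
by rewrite ler_wpM2l // mulr_ge0 // exprn_ge0 // ltW.
Qed.

End UpperBound.

(** * Lower bound *)

Section Bump.
Context {R : realType}.
Variables a b : R.
Hypotheses (a0 : 0 < a) (ab : a < b).

Lemma pow_derive n (t : R) : is_derive t 1 (fun y : R => y ^+ n) (n%:R * t ^+ n.-1).
Proof.
have -> : (fun y : R => y ^+ n) = (id : R -> R) ^+ n by rewrite exprfctE.
have h := @is_deriveX R R id n t 1 1 (is_derive_id t 1).
by rewrite -[X in is_derive _ _ _ X]mulr1; exact: h.
Qed.

(** The exponent is at least 2, which makes the truncated power differentiable at 0 too. *)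
Lemma max_pow_derive m (t : R) :
  is_derive t 1 (fun t : R => Num.max 0 t ^+ m.+2) (m.+2%:R * Num.max 0 t ^+ m.+1).
Proof.
have [t0|t0|t0] := ltgtP t 0.
- rewrite expr0n /= mulr0.
  have hc : is_derive t 1 (fun _ : R => (0 : R)) (0 : R) by exact: is_derive_cst.
  apply: near_eq_is_derive hc; near=> y.
  have y0 : y < 0 by near: y; exact: lt_nbhsl.
  by rewrite max_l ?ltW // expr0n.
- have hc : is_derive t 1 (fun y : R => y ^+ m.+2) (m.+2%:R * t ^+ m.+1).
    exact: pow_derive.
  apply: near_eq_is_derive hc; near=> y.
  have y0 : 0 < y by near: y; exact: lt_nbhsr.
  by rewrite max_r ?ltW.
- rewrite t0 expr0n /= mulr0.
  suff H : (fun h : R => h^-1 *: (((fun t : R => Num.max 0 t ^+ m.+2) \o shift 0) (h *: 1)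
     - Num.max 0 0 ^+ m.+2)) @ 0^' --> (0 : R).
    by apply: DeriveDef; [apply/cvg_ex; exists 0|exact/cvg_lim].
  apply/cvgrPdist_le => e e0; exists (Num.min 1 e); first by rewrite /= lt_min ltr01.
  move=> h /=; rewrite sub0r normrN lt_min => /andP[h1 he] h0.
  rewrite sub0r normrN maxxx expr0n /= subr0 -![_ *: _]/(_ * _) mulr1 addr0.
  have nh : 0 < `|h| by rewrite normr_gt0.
  rewrite normrM normfV mulrC ler_pdivrMr // normrX.
  have m1 : `|Num.max 0 h| <= `|h| by rewrite /Num.max; case: ifP; rewrite ?normr0.
  apply: (@le_trans _ _ (`|h| ^+ m.+2)); first by apply: lerXn2r; rewrite ?nnegrE.
  rewrite exprSr ler_wpM2r // exprSr (le_trans _ (ltW he)) // ler_piMl //.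
  by rewrite exprn_ile1 // ltW.
Unshelve. all: by end_near. Qed.

(* [shell_bump m i j x] is [x ^ (i - j)] times a function supported in
   [a <= |x| <= b]; the junk value of [x^-1] at [0] is harmless for [m > 0]. *)
Definition bump_base (x : R) : R := Num.max 0 ((x ^+ 2 - a ^+ 2) * (b ^+ 2 - x ^+ 2)).

Definition shell_bump m i j (x : R) : R := bump_base x ^+ m * x ^+ i * x^-1 ^+ j.

Lemma bump_base_ge0 x : 0 <= bump_base x.
Proof. by rewrite le_max lexx. Qed.

Lemma bump_baseN x : bump_base (- x) = bump_base x.
Proof. by rewrite /bump_base sqrrN. Qed.

Lemma bumpN m i j x : shell_bump m i j (- x) = (-1) ^+ (i + j) * shell_bump m i j x.
Proof.
rewrite /shell_bump bump_baseN invrN (exprNn x) (exprNn x^-1) exprD.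
by move: (bump_base x ^+ m) (x ^+ i) (x^-1 ^+ j) ((-1) ^+ i) ((-1) ^+ j) => *; ring.
Qed.

Lemma bump_base_gt0 x : 0 < bump_base x -> a < `|x| < b.
Proof.
rewrite lt_max ltxx /= => h; have b0 : 0 < b by exact: lt_trans ab.
have e : x ^+ 2 = `|x| ^+ 2 by rewrite real_normK ?num_real.
rewrite e in h; have := normr_ge0 x; move: (`|x|) h => y h y0.
have sq (u v : R) : 0 <= u -> u <= v -> u ^+ 2 <= v ^+ 2.
  by move=> u0 uv; apply: lerXn2r; rewrite ?nnegrE // (le_trans u0).
have abq := sq _ _ (ltW a0) (ltW ab).
apply/andP; split; rewrite ltNge; apply/negP => hy; move: h; apply/negP; rewrite -leNgt.
  have h1 := sq _ _ y0 hy; rewrite mulr_le0_ge0 ?subr_le0 ?subr_ge0 //.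
  exact: le_trans abq.
have h1 := sq _ _ (ltW b0) hy; rewrite mulr_ge0_le0 ?subr_le0 ?subr_ge0 //.
exact: le_trans h1.
Qed.

Lemma bump_base_eq0 x : `|x| <= a -> bump_base x = 0.
Proof.
move=> xa; apply/eqP; rewrite eq_le bump_base_ge0 andbT leNgt.
by apply/negP => /bump_base_gt0 /andP[]; rewrite ltNge xa.
Qed.

Lemma bump_near0 m i j x : `|x| <= a -> shell_bump m.+1 i j x = 0.
Proof. by move=> xa; rewrite /shell_bump bump_base_eq0 // expr0n !mul0r. Qed.

Lemma bump_base_pow_derive m (x : R) : is_derive x 1 (fun y => bump_base y ^+ m.+2)
  (m.+2%:R * bump_base x ^+ m.+1 * (2 * (a ^+ 2 + b ^+ 2) * x - 4 * x ^+ 3)).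
Proof.
have h : is_derive x 1 (fun x => (x ^+ 2 - a ^+ 2) * (b ^+ 2 - x ^+ 2))
    (2 * (a ^+ 2 + b ^+ 2) * x - 4 * x ^+ 3).
  by apply: is_derive_eq; rewrite -![_ *: _]/(_ * _) /= ?expr1; ring.
exact: (@is_derive1_comp R (fun t => Num.max 0 t ^+ m.+2) _ x _ _ (max_pow_derive m _) h).
Qed.

Lemma bump_derive m i j (x : R) : is_derive x 1 (shell_bump m.+2 i j)
  (2 * m.+2%:R * (a ^+ 2 + b ^+ 2) * shell_bump m.+1 i.+1 j x
   + - (4 * m.+2%:R) * shell_bump m.+1 (i + 3) j x
   + (i%:R - j%:R) * shell_bump m.+2 i j.+1 x).
Proof.
have [->|x0] := eqVneq x 0.
  rewrite !bump_near0 ?normr0 ?ltW // !mulr0 !addr0.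
  have hc : is_derive (0 : R) 1 (fun _ : R => (0 : R)) (0 : R) by exact: is_derive_cst.
  apply: near_eq_is_derive hc; exists a => // y /=.
  by rewrite sub0r normrN => /ltW ya; rewrite bump_near0.
have hX : is_derive x 1 (fun y : R => y ^+ i) (i%:R * x ^+ i.-1).
  exact: pow_derive.
have hV0 : is_derive x 1 (fun y : R => y^-1) (- x^-1 ^+ 2).
  apply: is_derive_eq; first exact: is_deriveV.
  by rewrite -![_ *: _]/(_ * _) mulr1 exprVn.
have hV : is_derive x 1 (fun y : R => y^-1 ^+ j) (- j%:R * x^-1 ^+ j.+1).
  case: j => [|j].
    by rewrite oppr0 mul0r; apply: is_derive_cst.
  have h := @is_derive1_comp R (fun y : R => y ^+ j.+1) _ x _ _ (pow_derive j.+1 _) hV0.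
  by apply: (is_derive_eq h); rewrite /= !exprS; ring.
have hb := bump_base_pow_derive m x.
apply: is_derive_eq; rewrite -![_ *: _]/(_ * _) /shell_bump addn3.
have xx : x * x^-1 = 1 by rewrite mulfV.
case: i {hX} => [|i] /=.
  rewrite !exprS !expr0; move: (bump_base x) (bump_base x ^+ m) (x^-1 ^+ j) => p q r; ring.
have -> : x^-1 ^+ j.+1 = x^-1 * x^-1 ^+ j by rewrite exprS.
have -> : x ^+ i.+1 = x * x ^+ i by rewrite exprS.
rewrite !exprS; move: (bump_base x) (bump_base x ^+ m) (x^-1 ^+ j) (x ^+ i) => p q r s.
field.
exact: x0.
Qed.

(** On the support, [|x| >= a] bounds the negative powers and the Gaussian is at least
    [exp (- b^2 / 2)]; it serves as a fixed majorant, integrable against the weight. [C] must be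
    independent of [n], hence the splitting of the exponent as [j0 + n]. *)
Lemma bump_bound m i j0 : exists2 C, 0 <= C & forall n x,
  `|shell_bump m.+1 i (j0 + n) x| <= C * (a^-1) ^+ n * gaussian 1 x.
Proof.
have b0 : 0 < b by exact: lt_trans ab.
pose C := (b ^+ 4) ^+ m.+1 * b ^+ i * (a^-1) ^+ j0 * expR (b ^+ 2 / 2).
have C0 : 0 <= C by rewrite !mulr_ge0 ?exprn_ge0 ?invr_ge0 ?expR_ge0 // ltW.
exists C => // n x.
have := bump_base_ge0 x; rewrite le_eqVlt => /predU1P[e|bx].
  rewrite /shell_bump -e expr0n !mul0r normr0 !mulr_ge0 ?exprn_ge0 ?invr_ge0 ?expR_ge0 ?(ltW b0) ?(ltW a0) //.
have /andP[xa xb] := bump_base_gt0 bx.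
have nx0 : 0 < `|x| by exact: lt_trans xa.
have g : expR (b ^+ 2 / 2) * gaussian 1 x >= 1.
  rewrite /gaussian -expRD -[leLHS]expR0 ler_expR mul1r -mulrBl divr_ge0 // subr_ge0.
  by rewrite -(real_normK (num_real x)); apply: lerXn2r; rewrite ?nnegrE // ltW.
have bb : bump_base x <= b ^+ 4.
  rewrite ge_max exprn_ge0 ?(ltW b0) //=.
  have e : x ^+ 2 = `|x| ^+ 2 by rewrite real_normK ?num_real.
  rewrite e; move: (`|x|) xa xb => y ya yb.
  have -> : b ^+ 4 = b ^+ 2 * b ^+ 2 by ring.
  have y2 : y ^+ 2 <= b ^+ 2 by apply: lerXn2r; rewrite ?nnegrE ltW // (lt_trans a0).
  have a2 : a ^+ 2 <= y ^+ 2 by apply: lerXn2r; rewrite ?nnegrE ltW // (lt_trans a0).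
  have := sqr_ge0 a; have := sqr_ge0 y.
  by move=> y0 aa0; apply: ler_pM; rewrite ?subr_ge0 //; lra.
have e1 : `|shell_bump m.+1 i (j0 + n) x| <= (b ^+ 4) ^+ m.+1 * b ^+ i * (a^-1) ^+ (j0 + n).
  rewrite /shell_bump !normrM !normrX normfV (ger0_norm (bump_base_ge0 x)).
  apply: ler_pM; rewrite ?mulr_ge0 ?exprn_ge0 ?invr_ge0 ?bump_base_ge0 //.
    apply: ler_pM; rewrite ?exprn_ge0 ?bump_base_ge0 //.
      by apply: lerXn2r; rewrite ?nnegrE ?bump_base_ge0 // exprn_ge0 // ltW.
    by apply: lerXn2r; rewrite ?nnegrE // ltW.
  apply: lerXn2r; rewrite ?nnegrE ?invr_ge0 // ?(ltW a0) //.
  by rewrite lef_pV2 ?posrE // ltW.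
apply: (le_trans e1); rewrite exprD.
have -> : C * a^-1 ^+ n * gaussian 1 x = (b ^+ 4) ^+ m.+1 * b ^+ i * (a^-1 ^+ j0 * a^-1 ^+ n) *
   (expR (b ^+ 2 / 2) * gaussian 1 x) by rewrite /C; ring.
by rewrite ler_peMr // !mulr_ge0 ?exprn_ge0 ?invr_ge0 // ltW.
Qed.

End Bump.

Section BumpSpan.
Context {R : realType}.
Variables a b : R.
Hypotheses (a0 : 0 < a) (ab : a < b).
Variable k : R[i].
Hypothesis hk : 0 <= complex.Re k.
Local Notation mu := (@lebesgue_measure R).
Local Notation w := (dunkl_weight k).
Local Notation ii := (0 +i* 1 : R[i]).
Local Notation D := (dunkl_integral k).
Local Notation T := (dunkl k).
Local Notation bump := (shell_bump a b).
Implicit Types f g : R -> R[i].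

Definition bumpc m i j (x : R) : R[i] := (bump m i j x)%:C.

(* [bumpspan m] consists of functions of class [C^(m-1)]; [T] maps
   [bumpspan m.+2] to [bumpspan m.+1]. *)
Inductive bumpspan m : (R -> R[i]) -> Prop :=
| bumpspan_bump c m' i j : (m <= m')%N -> bumpspan m (fun x => c * bumpc m' i j x)
| bumpspanD f g : bumpspan m f -> bumpspan m g -> bumpspan m (fun x => f x + g x).

Lemma bumpspan_le m n f : (m <= n)%N -> bumpspan n f -> bumpspan m f.
Proof.
move=> mn; elim=> [c m' i j nm'|g h _ hg _ hh]; last exact: bumpspanD.
by apply: bumpspan_bump; exact: leq_trans nm'.
Qed.

Lemma bumpspan_bumpc m n i j : (m <= n)%N -> bumpspan m (bumpc n i j).
Proof.
move=> mn; have -> : bumpc n i j = (fun x => 1 * bumpc n i j x).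
  by apply/funext => x; rewrite mul1r.
exact: bumpspan_bump.
Qed.

Lemma bumpspan_rapid m f : bumpspan m.+1 f -> rapid f.
Proof.
elim=> [c [|m'] i j // _|g h _ hg _ hh]; last exact: rapidD.
apply: rapidZ; have [C C0 hC] := bump_bound a0 ab m' i j.
apply: (rapid_le (M := C) (gaussian_rapid ltr01)) => x.
rewrite !cmod_real (ger0_norm (gaussian_ge0 _ _)).
by have := hC 0%N x; rewrite addn0 expr0 mulr1.
Qed.

Lemma bumpc_derive m i j x : is_derivec x (bumpc m.+2 i j)
  ((2 * m.+2%:R * (a ^+ 2 + b ^+ 2))%:C * bumpc m.+1 i.+1 j x
   + (- (4 * m.+2%:R))%:C * bumpc m.+1 (i + 3) j x
   + (i%:R - j%:R)%:C * bumpc m.+2 i j.+1 x).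
Proof.
apply: (is_derivec_eq (is_derivec_real (bump_derive a0 ab m i j x))).
by rewrite /bumpc -!real_complexM -!real_complexD.
Qed.

Lemma bumpspan_derive m f : bumpspan m.+2 f ->
  exists2 f', forall x, is_derivec x f (f' x) & bumpspan m.+1 f'.
Proof.
elim=> [c [|[|m']] i j // mm'|g h _ [g' dg sg] _ [h' dh sh]]; last first.
  exists (fun x => g' x + h' x); last exact: bumpspanD.
  by move=> x; exact: is_derivecD.
exists (fun x => c * (2 * m'.+2%:R * (a ^+ 2 + b ^+ 2))%:C * bumpc m'.+1 i.+1 j x
   + c * (- (4 * m'.+2%:R))%:C * bumpc m'.+1 (i + 3) j x
   + c * (i%:R - j%:R)%:C * bumpc m'.+2 i j.+1 x).
  move=> x; apply: (is_derivec_eq (is_derivecZ c (bumpc_derive m' i j x))).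
  by rewrite !mulrDr !mulrA.
by apply: bumpspanD; [apply: bumpspanD|]; apply: bumpspan_bump; [exact: mm'|exact: mm'|exact: ltnW].
Qed.

Lemma bumpspan_continuous m f : bumpspan m.+2 f -> continuousc f.
Proof. by move=> /bumpspan_derive[f' df _]; exact: is_derivec_continuous df. Qed.

(** The bump has the parity of [i + j], so its reflection part is a multiple of the bump divided by
    [x], which is the bump with [j + 1]. At 0 everything vanishes, since the support stays away from
    0. *)
Lemma dunkl_bumpc m i j : T (bumpc m.+2 i j) = fun x =>
  (2 * m.+2%:R * (a ^+ 2 + b ^+ 2))%:C * bumpc m.+1 i.+1 j x
  + (- (4 * m.+2%:R))%:C * bumpc m.+1 (i + 3) j x
  + ((i%:R - j%:R)%:C + k * (1 - (-1) ^+ (i + j))) * bumpc m.+2 i j.+1 x.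
Proof.
apply/funext => x; rewrite (dunklE _ _ (bumpc_derive m i j)).
have z m' i' j' : bumpc m'.+1 i' j' 0 = 0.
  by rewrite /bumpc bump_near0 ?normr0 ?ltW.
have bN : bumpc m.+2 i j (- x) = ((-1) ^+ (i + j))%:C * bumpc m.+2 i j x.
  by rewrite /bumpc bumpN real_complexM.
rewrite !z !(mulr0, addr0) bN.
have -> : ((-1) ^+ (i + j))%:C = (-1) ^+ (i + j) :> R[i].
  elim: (i + j)%N => [|n IH]; first by [].
  by rewrite !exprS real_complexM IH real_complexN.
have -> : bumpc m.+2 i j.+1 x = bumpc m.+2 i j x * (x^-1)%:C.
  by rewrite /bumpc -real_complexM; congr _%:C; rewrite /shell_bump (exprSr x^-1) mulrA.
by move: (bumpc _ _ _ _) (bumpc _ _ _ _) (bumpc _ _ _ _) (x^-1)%:C ((-1) ^+ _) => *; ring.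
Qed.

Lemma bumpspan_dunkl m f : bumpspan m.+2 f -> bumpspan m.+1 (T f).
Proof.
elim=> [c [|[|m']] i j // mm'|g h sg hg sh hh].
  have -> : T (fun x => c * bumpc m'.+2 i j x) = (fun x =>
     c * (2 * m'.+2%:R * (a ^+ 2 + b ^+ 2))%:C * bumpc m'.+1 i.+1 j x
     + c * (- (4 * m'.+2%:R))%:C * bumpc m'.+1 (i + 3) j x
     + c * ((i%:R - j%:R)%:C + k * (1 - (-1) ^+ (i + j))) * bumpc m'.+2 i j.+1 x).
    apply/funext => x; rewrite (dunklZ _ _ _ (bumpc_derive m' i j)) dunkl_bumpc.
    by rewrite [LHS](mulrDr c) (mulrDr c (_ * _)) !mulrA.
  by apply: bumpspanD; [apply: bumpspanD|]; apply: bumpspan_bump; [exact: mm'|exact: mm'|exact: ltnW].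
have [g' dg _] := bumpspan_derive sg; have [h' dh _] := bumpspan_derive sh.
have -> : T (fun x => g x + h x) = (fun x => T g x + T h x).
  by apply/funext => x; exact: dunklD dg dh.
exact: bumpspanD.
Qed.

Lemma dunkl_iterD q f g : bumpspan q.+1 f -> bumpspan q.+1 g ->
  iter q T (fun x => f x + g x) = (fun x => iter q T f x + iter q T g x).
Proof.
elim: q f g => [//|q IH] f g sf sg.
have [f' df _] := bumpspan_derive sf; have [g' dg _] := bumpspan_derive sg.
have e : T (fun x => f x + g x) = (fun x => T f x + T g x).
  by apply/funext => x; exact: dunklD df dg.
by rewrite !iterSr e IH //; exact: bumpspan_dunkl.
Qed.

Lemma dunkl_iterZ q c f : bumpspan q.+1 f ->
  iter q T (fun x => c * f x) = (fun x => c * iter q T f x).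
Proof.
elim: q f => [//|q IH] f sf; have [f' df _] := bumpspan_derive sf.
have e : T (fun x => c * f x) = (fun x => c * T f x).
  by apply/funext => x; exact: dunklZ df.
by rewrite !iterSr e IH //; exact: bumpspan_dunkl.
Qed.

(** Each application of [T] consumes one power of [bump_base], whence [q < m], and costs one factor
    [n + 1], coming from the derivative of the power of exponent [- (j + n)]. *)
Lemma dunkl_iter_bump_bound q m i j : (q < m)%N -> exists2 C, 0 <= C & forall n x,
  cmod (iter q T (bumpc m i (j + n)) x) <= C * n.+1%:R ^+ q * (a^-1) ^+ n * gaussian 1 x.
Proof.
elim: q m i j => [|q IH] [//|m] i j qm.
  have [C C0 hC] := bump_bound a0 ab m i j; exists C => // n x.
  by rewrite expr0 mulr1 cmod_real.
case: m qm => [//|m] qm; rewrite ltnS in qm.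
have [C1 C10 h1] := IH m.+1 i.+1 j qm.
have [C2 C20 h2] := IH m.+1 (i + 3)%N j qm.
have [C3 C30 h3] := IH m.+2 i j.+1 (ltnW qm).
pose c1 : R[i] := (2 * m.+2%:R * (a ^+ 2 + b ^+ 2))%:C.
pose c2 : R[i] := (- (4 * m.+2%:R))%:C.
(* [K * (n + 1)] bounds the coefficient [c3] below, as [|i - (j + n)| <= i + j + n] and the parity
   factor is at most 2. *)
pose K := i%:R + j%:R + 1 + 2 * cmod k.
have K0 : 0 <= K by rewrite !addr_ge0 ?mulr_ge0 ?cmod_ge0.
exists (cmod c1 * C1 + cmod c2 * C2 + K * C3).
  by rewrite !addr_ge0 ?mulr_ge0 ?cmod_ge0.
move=> n x; pose c3 : R[i] := (i%:R - (j + n)%:R)%:C + k * (1 - (-1) ^+ (i + (j + n))).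
have s1 : bumpspan q.+1 (bumpc m.+1 i.+1 (j + n)) by apply: bumpspan_bumpc.
have s2 : bumpspan q.+1 (bumpc m.+1 (i + 3) (j + n)) by apply: bumpspan_bumpc.
have s3 : bumpspan q.+1 (bumpc m.+2 i (j.+1 + n)) by apply: bumpspan_bumpc; exact: ltnW.
have sZ c p i' j' : (q < p)%N -> bumpspan q.+1 (fun x => c * bumpc p i' j' x).
  by move=> qp; exact: bumpspan_bump.
have -> : iter q.+1 T (bumpc m.+2 i (j + n)) x =
    c1 * iter q T (bumpc m.+1 i.+1 (j + n)) x + c2 * iter q T (bumpc m.+1 (i + 3) (j + n)) x
    + c3 * iter q T (bumpc m.+2 i (j.+1 + n)) x.
  rewrite iterSr dunkl_bumpc -/c1 -/c2 -/c3 -addSn.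
  rewrite dunkl_iterD; [|apply: bumpspanD; exact: sZ|by apply: sZ; exact: ltnW].
  by rewrite dunkl_iterD ?dunkl_iterZ //; exact: sZ.
have n1 : (1 : R) <= n.+1%:R by rewrite ler1n.
have c3le : cmod c3 <= K * n.+1%:R.
  apply: (@le_trans _ _ (i%:R + j%:R + n%:R + 2 * cmod k)).
    apply: (le_trans (ler_cmodD _ _)); apply: lerD.
      rewrite cmod_real natrD; apply: (le_trans (ler_normB _ _)).
      by rewrite !ger0_norm ?addr_ge0 // addrA.
    rewrite cmodM mulrC ler_wpM2r ?cmod_ge0 // (le_trans (ler_cmodB _ _)) //.
    by rewrite cmodX cmodN (cmod_nat 1) expr1n.
  have h0 : 0 <= i%:R + j%:R + 2 * cmod k by rewrite !addr_ge0 ?mulr_ge0 ?cmod_ge0.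
  have : i%:R + j%:R + 2 * cmod k <= (i%:R + j%:R + 2 * cmod k) * n.+1%:R.
    by rewrite ler_peMr.
  rewrite /K -!natr1; nra.
have g0 := gaussian_ge0 1 x.
pose Q := n.+1%:R ^+ q * (a^-1) ^+ n * gaussian 1 x.
have Q0 : 0 <= Q by rewrite !mulr_ge0 ?exprn_ge0 ?invr_ge0 // ltW.
have Q1 : Q <= n.+1%:R * Q by rewrite ler_peMl.
have -> : (cmod c1 * C1 + cmod c2 * C2 + K * C3) * n.+1%:R ^+ q.+1 * a^-1 ^+ n * gaussian 1 x =
   cmod c1 * C1 * (n.+1%:R * Q) + cmod c2 * C2 * (n.+1%:R * Q) + K * n.+1%:R * (C3 * Q).
  by rewrite /Q exprS; ring.
have hh (C y : R) : y <= C * n.+1%:R ^+ q * a^-1 ^+ n * gaussian 1 x -> y <= C * Q.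
  by rewrite /Q !mulrA.
apply: (le_trans (ler_cmodD _ _)); apply: lerD; last first.
  by rewrite cmodM; apply: ler_pM; rewrite ?cmod_ge0 //; apply: hh.
apply: (le_trans (ler_cmodD _ _)).
by apply: lerD; rewrite cmodM -mulrA ler_wpM2l ?cmod_ge0 //;
  (apply: (le_trans (hh _ _ _)); [exact: h1||exact: h2|by rewrite ler_wpM2l]).
Qed.

Lemma dunkl_integral_iter_bumpspan q f l : bumpspan q.+2 f ->
  D (iter q T f) l = (ii * l%:C) ^+ q * D f l.
Proof.
elim: q f => [|q IH] f sf; first by rewrite expr0 mul1r.
have sf3 : bumpspan 3 f by exact: bumpspan_le sf.
have [f' df sf'] := bumpspan_derive sf3.
rewrite iterSr IH; last exact: bumpspan_dunkl.
rewrite (dunkl_integral_dunkl hk l df (bumpspan_continuous sf') (bumpspan_rapid sf3) (bumpspan_rapid sf')).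
by rewrite exprSr mulrA.
Qed.

Lemma dunkl_integral_gaussian_le f C l : measurablec f -> 0 <= C ->
  (forall x, cmod (f x) <= C * gaussian 1 x) ->
  cmod (D f l) <= C * (2 * \int[mu]_x (2 * cmod ((gaussian 1 x)%:C * w x))).
Proof.
move=> mf C0 hf.
have rf : rapid f.
  apply: (rapid_le (M := C) (gaussian_rapid ltr01)) => x.
  by rewrite cmod_real (ger0_norm (gaussian_ge0 _ _)).
have ig := rapid_weight_integrable hk (gaussian_measurable 1) (gaussian_rapid ltr01).
have ih : integrableR (fun x => 2 * cmod ((gaussian 1 x)%:C * w x)).
  by apply: integrableRZ; exact: integrablec_cmod.
rewrite mulrCA -RintegralZl // dunkl_integralE; apply: cmod_integralc_le.
- exact: dunkl_integrand_integrable.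
- move=> x; rewrite !cmodM cmod_real (ger0_norm (gaussian_ge0 _ _)).
  have -> : C * (2 * (gaussian 1 x * cmod (w x))) = C * gaussian 1 x * 2 * cmod (w x) by ring.
  rewrite ler_wpM2r ?cmod_ge0 //; apply: ler_pM; rewrite ?cmod_ge0 //.
  exact: dunkl_wave_bound.
- exact: integrableRZ.
Qed.

Lemma dunkl_integral_bump_decay q m i : (q.+2 <= m)%N ->
  exists2 C, 0 <= C & forall n l,
  `|l| ^+ q * cmod (D (bumpc m i n) l) <= C * n.+1%:R ^+ q * (a^-1) ^+ n.
Proof.
move=> qm; have [C C0 hC] := dunkl_iter_bump_bound i 0 (ltnW qm).
pose G := 2 * \int[mu]_x (2 * cmod ((gaussian 1 x)%:C * w x)).
have G0 : 0 <= G.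
  by rewrite mulr_ge0 // Rintegral_ge0 // => x _; rewrite mulr_ge0 ?cmod_ge0.
exists (C * G); first exact: mulr_ge0.
move=> n l; have sn : bumpspan q.+2 (bumpc m i n) by exact: bumpspan_bumpc.
have -> : `|l| ^+ q * cmod (D (bumpc m i n) l) = cmod (D (iter q T (bumpc m i n)) l).
  by rewrite dunkl_integral_iter_bumpspan // cmodM cmodX cmodM cmodi mul1r cmod_real.
have si p g : bumpspan (p + 2) g -> bumpspan 2 (iter p T g).
  elim: p g => [//|p IH] g sg; rewrite iterSr; apply: IH.
  by rewrite addn2; apply: bumpspan_dunkl; rewrite -addn2.
have mi : measurablec (iter q T (bumpc m i n)).
  apply: continuous_measurablec; apply: (@bumpspan_continuous 0).
  by apply: si; rewrite addn2.
have B0 : 0 <= C * n.+1%:R ^+ q * a^-1 ^+ n.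
  by rewrite !mulr_ge0 ?exprn_ge0 ?invr_ge0 // ltW.
apply: le_trans (dunkl_integral_gaussian_le l mi B0 (hC n)) _.
by rewrite -/G le_eqVlt; apply/orP; left; apply/eqP; ring.
Qed.

End BumpSpan.

Section LowerBound.
Context {R : realType}.
Variable k : R[i].
Hypothesis hk : 0 <= complex.Re k.
Local Notation mu := (@lebesgue_measure R).
Local Notation w := (dunkl_weight k).
Local Notation ii := (0 +i* 1 : R[i]).
Local Notation D := (dunkl_integral k).
Local Notation T := (dunkl k).
Implicit Types f g : R -> R[i].

(* [growth L ^-1] is integrable for [dunkl_weight k] as soon as
   [|x| `^ (2 Re k) <= 1 + |x| ^ L]. *)
Definition growth (L : nat) (x : R) : R := (1 + x ^+ 2) * (1 + `|x| ^+ L).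

Lemma growth_ge1 L x : 1 <= growth L x.
Proof.
rewrite -[leLHS]mulr1; apply: ler_pM => //; rewrite lerDl ?sqr_ge0 ?exprn_ge0 //.
Qed.

Lemma growth_gt0 L x : 0 < growth L x.
Proof. exact: lt_le_trans (growth_ge1 L x). Qed.

(** These monomials are matched one by one with decay bounds of order 0, 2, [L] and [L + 2]. *)
Lemma growthE L x :
  growth L x = `|x| ^+ 0 + `|x| ^+ 2 + `|x| ^+ L + `|x| ^+ L.+2.
Proof.
rewrite /growth -(real_normK (num_real x)) expr0 (exprS _ L.+1) (exprS _ L).
by move: (`|x| ^+ L) (`|x|) => p q; ring.
Qed.

Lemma growthV_measurable L : measurable_fun setT (fun x => (growth L x)^-1).
Proof.
apply: continuous_measurable_fun => x.
apply: cvgV; first by rewrite gt_eqF // growth_gt0.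
have cn : {for x, continuous (fun x : R => `|x|)} by exact: norm_continuous.
have cX n : {for x, continuous (fun x : R => `|x| ^+ n)}.
  by apply: (@continuous_comp _ _ _ (fun x : R => `|x|) (fun y => y ^+ n)) => //; exact: exprn_continuous.
apply: cvgM; apply: cvgD; try exact: cvg_cst; last exact: cX.
exact: exprn_continuous.
Qed.

Lemma growthV_weight_integrable L : (forall x, cmod (w x) <= 1 + `|x| ^+ L) ->
  integrableR (fun x => (growth L x)^-1 * cmod (w x)).
Proof.
move=> hL; apply: (integrableR_le (g := fun x => (1 + x ^+ 2)^-1)); last exact: integrableR_oneDsqrV.
  apply: measurable_funM; last by apply: measurablec_cmod; exact: weight_measurable.
  exact: growthV_measurable.
move=> x; have g0 := growth_gt0 L x.
have p0 : 0 < 1 + x ^+ 2 by rewrite ltr_pwDl // sqr_ge0.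
rewrite ger0_norm ?mulr_ge0 ?invr_ge0 ?(ltW g0) ?cmod_ge0 //.
rewrite mulrC ler_pdivrMr // mulKf ?gt_eqF //.
Qed.

(* On the support of the bump, [bumpc a b m i 0 l = l^n * bumpc a b m i n l],
   and [(i l)^n * D f l = D (T^n f) l]. *)
Lemma bump_pairing_bound f a b i L : 0 < a -> a < b ->
  (forall x, cmod (w x) <= 1 + `|x| ^+ L) -> tower_schwartz f ->
  exists2 C, 0 <= C & forall n,
  cmod (integralc (fun l => D f l * bumpc a b (L + 4) i 0 l * w l)) <=
  C * n.+1%:R ^+ L.+2 * (a^-1) ^+ n *
  \int[mu]_x (cmod (iter n T f x) * ((growth L x)^-1 * cmod (w x))).
Proof.
move=> a0 ab hL hf.
have decay q : (q <= L.+2)%N -> exists2 C, 0 <= C & forall n l,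
    `|l| ^+ q * cmod (D (bumpc a b (L + 4) i n) l) <= C * (n.+1%:R ^+ L.+2 * (a^-1) ^+ n).
  (* The exponent [L + 4] exceeds the largest order [L + 2] by the 2 that
     [dunkl_integral_bump_decay] asks for. *)
  move=> qL; have qm : (q.+2 <= L + 4)%N by rewrite addn4.
  have [C C0 hC] := dunkl_integral_bump_decay a0 ab hk i qm; exists C => // n l.
  apply: (le_trans (hC n l)); rewrite -mulrA ler_wpM2l // ler_wpM2r ?exprn_ge0 ?invr_ge0 ?(ltW a0) //.
  by apply: ler_weXn2l; rewrite ?ler1n.
have [C0 C00 h0] := decay 0%N isT; have [C2 C20 h2] := decay 2%N isT.
have [C3 C30 h3] := decay L (leqW (leqnSn L)); have [C4 C40 h4] := decay L.+2 (leqnn _).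
pose C := C0 + C2 + C3 + C4.
exists (2 * C); first by rewrite mulr_ge0 // !addr_ge0.
move=> n; set g := iter n T f; set phi := bumpc a b (L + 4) i n.
have hg : tower_schwartz g by exact: tower_schwartz_iter.
have mg := tower_schwartz_measurable hg; have rg := tower_schwartz_rapid hg.
have sphi : bumpspan a b (L + 4) phi by exact: bumpspan_bumpc.
have rphi : rapid phi.
  by apply: (bumpspan_rapid a0 ab (m := 0)); apply: bumpspan_le sphi; rewrite addn4.
have cphi : continuousc phi.
  by apply: (bumpspan_continuous a0 ab (m := 0)); apply: bumpspan_le sphi; rewrite addn4.
have mphi := continuous_measurablec cphi.
have i1 : ii != 0 by rewrite eq_complex /= oner_eq0 andbF.
have e : (fun l => D f l * bumpc a b (L + 4) i 0 l * w l) =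
    (fun l => (ii ^+ n)^-1 * (D g l * phi l * w l)).
  apply/funext => l; rewrite /g dunkl_integral_iter // exprMn.
  suff -> : bumpc a b (L + 4) i 0 l = l%:C ^+ n * phi l.
    have : ii ^+ n != 0 by rewrite expf_neq0.
    by move: (w l) (phi l) (D f l) (l%:C ^+ n) (ii ^+ n) => *; field.
  have -> : l%:C ^+ n = (l ^+ n)%:C.
    by elim: (n) => [|p IH]; rewrite ?expr0 // !exprS IH -real_complexM.
  rewrite /phi /bumpc -real_complexM; congr _%:C.
  (* For [|l| <= a], in particular at 0 where [l * l^-1] is not 1, both sides vanish. *)
  have [la|la] := leP `|l| a; first by rewrite addn4 !bump_near0 // mulr0.
  have l0 : l != 0 by rewrite -normr_gt0 (lt_trans a0).
  have ll : l ^+ n * l^-1 ^+ n = 1 by rewrite -exprMn divff // expr1n.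
  by rewrite /shell_bump expr0 (mulrCA (l ^+ n)) ll.
have iDg : integrablec (fun l => D g l * phi l * w l).
  have [M M0 hM] := dunkl_integral_bound hk mg rg.
  have mD := continuous_measurablec (dunkl_integral_continuous hk mg rg).
  apply: (rapid_weight_integrable hk); first exact: measurablecM.
  have := rapidMl rphi hM; congr rapid; apply/funext => l; exact: mulrC.
have -> : cmod (integralc (fun l => D f l * bumpc a b (L + 4) i 0 l * w l)) =
    cmod (integralc (fun x => g x * D phi x * w x)).
  rewrite e integralcZ // cmodM cmodV cmodX cmodi expr1n invr1 mul1r.
  by rewrite dunkl_integral_adjoint.
have cmp l : cmod (D phi l) <= C * (n.+1%:R ^+ L.+2 * a^-1 ^+ n) * (growth L l)^-1.
  rewrite ler_pdivlMr ?growth_gt0 // mulrC growthE /C.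
  move: (h0 n l) (h2 n l) (h3 n l) (h4 n l); rewrite -/phi.
  move: (cmod _) (n.+1%:R ^+ L.+2 * a^-1 ^+ n) (`|l| ^+ 0) (`|l| ^+ 2) (`|l| ^+ L) (`|l| ^+ L.+2) => *; lra.

have iw := growthV_weight_integrable hL.
have ig : integrableR (fun x => cmod (g x) * ((growth L x)^-1 * cmod (w x))).
  have [M M0 hM] := rapid_bounded rg.
  apply: (@integrableR_le _ _ (fun x => M * ((growth L x)^-1 * cmod (w x)))).
  - apply: measurable_funM; first exact: measurablec_cmod.
    exact: integrableR_measurable iw.
  - move=> x; have h : 0 <= (growth L x)^-1 * cmod (w x).
      by rewrite mulr_ge0 ?cmod_ge0 // invr_ge0 ltW // growth_gt0.
    by rewrite ger0_norm; [exact: ler_wpM2r|rewrite mulr_ge0 ?cmod_ge0].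
  - exact: integrableRZ.
have mDphi := continuous_measurablec (dunkl_integral_continuous hk mphi rphi).
have [M M0 hM] := dunkl_integral_bound hk mphi rphi.
apply: (@le_trans _ _ (2 * \int[mu]_x (C * (n.+1%:R ^+ L.+2 * a^-1 ^+ n) *
    (cmod (g x) * ((growth L x)^-1 * cmod (w x)))))).
  apply: cmod_integralc_le; last exact: integrableRZ.
    apply: (rapid_weight_integrable hk); first exact: measurablecM.
    exact: rapidMl rg hM.
  move=> x; rewrite !cmodM.
  have -> : C * (n.+1%:R ^+ L.+2 * a^-1 ^+ n) * (cmod (g x) * ((growth L x)^-1 * cmod (w x))) =
      cmod (g x) * (C * (n.+1%:R ^+ L.+2 * a^-1 ^+ n) * (growth L x)^-1) * cmod (w x) by ring.
  apply: ler_wpM2r; first exact: cmod_ge0.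
  by apply: ler_wpM2l; [exact: cmod_ge0|exact: cmp].
by rewrite RintegralZl // le_eqVlt; apply/orP; left; apply/eqP; ring.
Qed.

(** The integral is folded onto the half line, where the bump of parity [i] selects the even or the
    odd part of [D f]; one of them is nonzero at [|l0|]. After a rotation of the phase the folded
    integrand is nonnegative, and bounded below by a positive constant near [|l0|]. *)
Lemma bump_pairing_neq0 f r l0 m : tower_schwartz f -> 0 <= r < `|l0| ->
  D f l0 != 0 -> exists a b i, [/\ r < a, a < b &
    integralc (fun l => D f l * bumpc a b m.+2 i 0 l * w l) != 0].
Proof.
move=> hf /andP[r0 rl] Dl.
have mf := tower_schwartz_measurable hf; have rf := tower_schwartz_rapid hf.
pose h (i : nat) x := D f x + (-1) ^+ i * D f (- x).
pose mu0 := `|l0|; have mu0p : 0 < mu0 by exact: le_lt_trans rl.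
have [i hi] : exists i, h i mu0 != 0.
  have [h0|] := eqVneq (h 0%N mu0) 0; last by exists 0%N.
  have [h1|] := eqVneq (h 1%N mu0) 0; last by exists 1%N.
  move: h0 h1; rewrite /h expr0 expr1 mul1r mulN1r => h0 h1.
  have D2 : 2 * D f mu0 = 0.
    transitivity (D f mu0 + D f (- mu0) + (D f mu0 - D f (- mu0))); last by rewrite h0 h1 addr0.
    by move: (D f mu0) (D f (- mu0)) => *; ring.
  have two0 : (2 : R[i]) != 0 by rewrite (pnatr_eq0 _ 2).
  have D0 : D f mu0 = 0 by apply: (mulfI two0); rewrite mulr0.
  move: h0; rewrite D0 add0r => D0'; move: Dl.
  have [l0p|l0n] := leP 0 l0.
    by rewrite -(ger0_norm l0p) -/mu0 D0 eqxx.
  by rewrite -[l0]opprK -(ltr0_norm l0n) -/mu0 D0' eqxx.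
pose q x := h i x * w x; pose z := q mu0.
have z0 : z != 0 by rewrite mulf_neq0 // weight_neq0 // gt_eqF.
pose c := cmod z ^+ 2.
have c0 : 0 < c by rewrite exprn_gt0 // lt_neqAle cmod_ge0 eq_sym cmod_eq0 z0.
(* The real part of [q x] times the conjugate of [z]; its value at [mu0] is [c > 0]. *)
pose p x := complex.Re z * Rec q x + complex.Im z * Imc q x.
have cD := dunkl_integral_continuous hk mf rf.
have cq : continuousc_at mu0 q.
  apply: continuousc_atM; last exact: is_derivec_continuous_at (weight_derive k mu0p).
  have cDN : continuousc (fun x => (-1) ^+ i * D f (- x)).
    apply: continuouscM; first exact: continuousc_cst.
    by apply: continuousc_comp => // x; apply: cvgN; exact: cvg_id.
  have [h1 h2] := continuouscD cD cDN; split; [exact: h1|exact: h2].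
have cp : {for mu0, continuous p}.
  by apply: cvgD; apply: cvgM; try exact: cvg_cst; [exact: cq.1|exact: cq.2].
have pmu : p mu0 = c by rewrite /p /Rec /Imc -/z /c cmod_sqr !expr2.
have [d /andP[d0 dr] hd] : exists2 d, 0 < d <= mu0 - r & forall x, `|mu0 - x| < d -> c / 2 < p x.
  have /cvgrPdist_lt := cp => /(_ (c / 2)); rewrite divr_gt0 // => /(_ isT).
  move=> [e /= e0 he]; exists (Num.min e (mu0 - r)).
    by rewrite lt_min e0 subr_gt0 rl /= ge_min lexx orbT.
  move=> x; rewrite lt_min => /andP[xe _].
  have := he x xe => /=; rewrite pmu ltr_distlC => /andP[+ _]; lra.
(* On [x > 0] the support of the bump lies where [p] exceeds [c / 2], and [d <= mu0 - r] keeps [a]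
   above [r]. *)
pose a := mu0 - d / 2; pose b := mu0 + d / 2.
have ra : r < a by rewrite /a; lra.
have ab : a < b by rewrite /a /b; lra.
have a0 : 0 < a by exact: le_lt_trans ra.
exists a, b, i; split => //; apply/eqP => H.
pose phi := shell_bump a b m.+2 i 0.
have phiN x : phi (- x) = (-1) ^+ i * phi x by rewrite /phi bumpN addn0.
have phi_ge0 x : 0 < x -> 0 <= phi x.
  move=> /ltW x0; apply: mulr_ge0; [apply: mulr_ge0|]; apply: exprn_ge0; rewrite ?invr_ge0 //.
  exact: bump_base_ge0.
have phi_mu : 0 < phi mu0.
  have am : a < mu0 by rewrite /a; lra.
  have mb : mu0 < b by rewrite /b; lra.
  have b0 : 0 <= b by exact: ltW (lt_trans mu0p mb).
  have bm : 0 < bump_base a b mu0.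
    rewrite /bump_base lt_max; apply/orP; right.
    by rewrite mulr_gt0 // subr_gt0; apply: ltrXn2r; rewrite ?nnegrE ?(ltW a0) ?(ltW mu0p).
  by apply: mulr_gt0; [apply: mulr_gt0|]; apply: exprn_gt0; rewrite ?invr_gt0.
have cphi : {for mu0, continuous phi}.
  apply: differentiable_continuous; apply/derivable1_diffP.
  by case: (bump_derive a0 ab m i 0 mu0).
have [e e0 he] : exists2 e, 0 < e & forall x, `|mu0 - x| < e -> phi mu0 / 2 < phi x.
  have pm2 : 0 < phi mu0 / 2 by apply: divr_gt0; [exact: phi_mu|].
  have /cvgrPdist_lt := cphi => /(_ _ pm2).
  move=> [e /= e0 he]; exists e; first exact: e0.
  by move=> y ye; have := he y ye => /=; rewrite ltr_distlC => /andP[+ _]; lra.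
pose F x := D f x * bumpc a b m.+2 i 0 x * w x.
have sphi : bumpspan a b 2 (bumpc a b m.+2 i 0) by exact: bumpspan_bumpc.
have iF : integrablec F.
  have [M M0 hM] := dunkl_integral_bound hk mf rf.
  apply: (rapid_weight_integrable hk).
    apply: measurablecM; first exact: continuous_measurablec.
    exact/continuous_measurablec/(bumpspan_continuous a0 ab sphi).
  have := rapidMl (bumpspan_rapid a0 ab sphi) hM; congr rapid; apply/funext => l; exact: mulrC.
pose G x := complex.Re z * Rec F x + complex.Im z * Imc F x.
have iG : integrableR G by apply: integrableRD; apply: integrableRZ; [exact: iF.1|exact: iF.2].
have intG : \int[mu]_x G x = 0.
  rewrite RintegralD //; try (apply: integrableRZ; [exact: iF.1]); last by apply: integrableRZ; exact: iF.2.
  rewrite !RintegralZl //; [|exact: iF.2|exact: iF.1].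
  have := congr1 (@complex.Re R) H; have := congr1 (@complex.Im R) H.
  by rewrite /integralc /= -/(Rec _) -/(Imc _) => -> ->; rewrite !mulr0 addr0.
have foldE x : G x + G (- x) = phi x * p x.
  have FE : F x + F (- x) = (phi x)%:C * q x.
    have bN : bumpc a b m.+2 i 0 (- x) = ((-1) ^+ i)%:C * (phi x)%:C.
      by rewrite /bumpc -/(phi _) phiN real_complexM.
    have bE : bumpc a b m.+2 i 0 x = (phi x)%:C by [].
    rewrite /F /q /h weightN bN bE.
    have -> : ((-1) ^+ i)%:C = (-1) ^+ i :> R[i].
      by elim: (i) => [|n IH]; rewrite ?expr0 // !exprS real_complexM IH real_complexN.
    by move: (w x) (D f x) (D f (- x)) ((-1) ^+ i) (phi x)%:C => *; ring.
  have e2 : Rec F x + Rec F (- x) = phi x * Rec q x.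
    rewrite /Rec -cReD FE; have -> := cReM (phi x)%:C (q x).
    by rewrite /= mul0r subr0.
  have e1 : Imc F x + Imc F (- x) = phi x * Imc q x.
    rewrite /Imc -cImD FE; have -> := cImM (phi x)%:C (q x).
    by rewrite /= mul0r addr0.
  transitivity (complex.Re z * (Rec F x + Rec F (- x)) + complex.Im z * (Imc F x + Imc F (- x))).
    by rewrite /G; ring.
  by rewrite e2 e1 /p; ring.
have near_mu x : 0 < x -> phi x != 0 -> `|mu0 - x| < d.
  move=> x0 px; have bx : 0 < bump_base a b x.
    rewrite lt_neqAle bump_base_ge0 eq_sym andbT; apply: contraNneq px => bx.
    by rewrite /phi /shell_bump bx expr0n !mul0r.
  have := bump_base_gt0 a0 ab bx; rewrite (gtr0_norm x0) /a /b => /andP[h1 h2].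
  by rewrite ltr_distlC; apply/andP; split; lra.
(* At most [mu0], so that the interval stays in the half line. *)
pose s := Num.min e mu0.
have s0 : 0 < s by rewrite lt_min e0.
pose I : set R := `]mu0 - s, mu0 + s[%classic.
have iI : integrableR (\1_I : R -> R) by exact: integrable_indic_itv.
have intI : \int[mu]_x (\1_I x : R) = s + s.
  rewrite /Rintegral integral_indic; [|exact: measurableT|exact: measurable_itv].
  rewrite setIT; have := @lebesgue_measure_itv R `]mu0 - s, mu0 + s[.
  rewrite -/I /= lte_fin => ->.
  by rewrite ltrD2l gtrN // -EFinB /=; ring.
pose K := phi mu0 / 2 * (c / 2).
have K0 : 0 < K by apply: mulr_gt0; apply: divr_gt0.
have low x : K * \1_I x <= if 0 < x then G x + G (- x) else 0.
  have pos : 0 < x -> 0 <= phi x * p x.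
    move=> x0; have [->|px] := eqVneq (phi x) 0; first by rewrite mul0r.
    rewrite mulr_ge0 ?phi_ge0 // ltW // (lt_trans _ (hd _ (near_mu _ x0 px))) // divr_gt0 //.
  rewrite indicE; have [xI|_] := boolP (x \in I); last first.
    by rewrite mulr0; case: ifP => // /pos; rewrite foldE.
  have xs : `|mu0 - x| < s.
    by move: xI; rewrite inE /I /= in_itv /= distrC ltr_distl.
  move: xs; rewrite lt_min => /andP[xe xm].
  have x0 : 0 < x by move: xm; rewrite ltr_distlC subrr => /andP[].
  have px := he _ xe.
  have px0 : phi x != 0 by rewrite gt_eqF // (lt_trans _ px) // divr_gt0.
  rewrite x0 mulr1 foldE /K; apply: ler_pM; rewrite ?divr_ge0 ?(ltW c0) ?(ltW phi_mu) ?(ltW px) //.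
  exact: ltW (hd _ (near_mu _ x0 px0)).
have : K * (s + s) <= 0.
  rewrite -intI -RintegralZl // -intG (Rintegral_fold iG).
  by apply: le_Rintegral => //; [exact: integrableRZ|exact: integrableR_fold].
by rewrite leNgt mulr_gt0 // addr_gt0.
Qed.

End LowerBound.

(** * Weighted norms *)

Section WeightedMeasure.
Context {R : realType}.
Variable a : R.
Local Notation mu := (@lebesgue_measure R).
Local Notation wm := (weighted_measure a : {measure set (measurableTypeR R) -> \bar R}).
Local Open Scope ereal_scope.

Let rho (x : R) : \bar R := (`|x| `^ (2 * a))%:E.

Let rho0 x : 0 <= rho x.
Proof. by rewrite lee_fin powR_ge0. Qed.

Let mrho : measurable_fun setT rho.
Proof.
apply/measurable_EFinP.
exact: (measurableT_comp (measurable_powR _)).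
Qed.

Import HBNNSimple.

Lemma weighted_integral_nnsfun (h : {nnsfun (measurableTypeR R) >-> R}) :
  \int[wm]_x (h x)%:E = \int[mu]_x ((h x)%:E * rho x).
Proof.
rewrite integralT_nnsfun sintegralE.
transitivity (\int[mu]_x (\sum_(y \in range h) (y * \1_(h @^-1` [set y]) x)%:E * rho x)).
  rewrite ge0_integral_fsum //; first last.
  - move=> y x _; rewrite mule_ge0 //.
    exact: nnfun_muleindic_ge0.
  - move=> y; apply: emeasurable_funM => //; apply/measurable_EFinP.
    exact: measurable_funM.
  apply: eq_fsbigr => y /[1!inE] -[z _ <-].
  have hz0 : (0 <= h z)%R by exact: fun_ge0.
  transitivity ((h z)%:E * \int[mu]_(x in h @^-1` [set h z]) rho x) => //.
  rewrite -ge0_integralZl_EFin //; last exact: measurable_funTS.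
  rewrite [LHS]integral_mkcond; apply: eq_integral => x _; rewrite patchE indicE.
  by case: ifP => _; rewrite ?mulr1 // mulr0 mul0e.
apply: eq_integral => x _.
rewrite -ge0_mule_fsuml; last by move=> y; exact: nnfun_muleindic_ge0.
by rewrite fsumEFin // -(fimfunE _ x).
Qed.

(** The measure is given by its density set by set; this yields the formula for simple functions,
    and monotone convergence the general case. *)
Lemma weighted_integral (f : R -> \bar R) : (forall x, 0 <= f x) ->
  measurable_fun setT f -> \int[wm]_x f x = \int[mu]_x (f x * rho x).
Proof.
move=> f0 mf; pose h := nnsfun_approx (@measurableT _ (measurableTypeR R)) mf.
have hf x : (EFin \o h^~ x) @ \oo --> f x by exact: cvg_nnsfun_approx.
have nh : nondecreasing_seq (h : (measurableTypeR R -> R)^nat) by exact: nd_nnsfun_approx.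
have mh n : measurable_fun setT (EFin \o h n) by exact/measurable_EFinP.
have c1 : \int[wm]_x (h n x)%:E @[n --> \oo] --> \int[wm]_x f x.
  have -> : \int[wm]_x f x = \int[wm]_x lim ((h n x)%:E @[n --> \oo]).
    by apply: eq_integral => x _; apply/esym/cvg_lim => //; exact: hf.
  apply: (@cvg_monotone_convergence _ _ _ wm setT measurableT (fun n x => (h n x)%:E)).
  - exact: mh.
  - by move=> n x _; rewrite lee_fin.
  - by move=> x _ m n mn; rewrite lee_fin; exact/lefP/nh.
have c2 : \int[mu]_x ((h n x)%:E * rho x) @[n --> \oo] --> \int[mu]_x (f x * rho x).
  have -> : \int[mu]_x (f x * rho x) = \int[mu]_x lim ((h n x)%:E * rho x @[n --> \oo]).
    apply: eq_integral => x _; apply/esym/cvg_lim => //.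
    by apply: cvgeZr => //; exact: hf.
  apply: (@cvg_monotone_convergence _ _ _ mu setT measurableT (fun n x => (h n x)%:E * rho x)).
  - by move=> n; apply: emeasurable_funM => //; exact: mh.
  - by move=> n x _; rewrite mule_ge0 // lee_fin.
  - by move=> x _ m n mn; rewrite lee_wpmul2r // lee_fin; exact/lefP/nh.
have e : (fun n => \int[wm]_x (h n x)%:E) = (fun n => \int[mu]_x ((h n x)%:E * rho x)).
  by apply/funext => n; exact: weighted_integral_nnsfun.
rewrite e in c1.
exact: etrans (esym (cvg_lim (@ereal_hausdorff R) c1)) (cvg_lim (@ereal_hausdorff R) c2).
Qed.

(** For [p = +oo] the definition of [Lnorm] distinguishes whether the total measure is positive. The
    density is at least 1 on [[1, 2]]. *)
Lemma weighted_measureT_gt0 : (0 <= a)%R -> 0 < wm setT.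
Proof.
move=> a0; apply: (@lt_le_trans _ _ (\int[mu]_(x in `[1%R, 2%R]%classic) 1)).
  rewrite integral_cst; last exact: measurable_itv.
  have := @lebesgue_measure_itv R `[1%R, 2%R] => /= ->.
  by rewrite lte_fin ltr1n mul1e -EFinB lte_fin subr_gt0 ltr1n.
rewrite /= /weighted_measure integral_mkcond; apply: ge0_le_integral => //.
- by move=> x _; rewrite patchE; case: ifP.
- apply/(measurable_restrictT _ _).1; first exact: measurable_itv.
  exact: measurable_cst.
- move=> x _; rewrite patchE; case: ifPn => [|_]; last by rewrite lee_fin powR_ge0.
  rewrite inE /= in_itv /= => /andP[x1 _]; rewrite lee_fin -(powRr0 `|x|).
  by apply: ler_powR; [rewrite (le_trans x1) // ler_norm|rewrite mulr_ge0].
Qed.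

End WeightedMeasure.

Section NormComparison.
Context {R : realType}.
Variable k : R[i].
Hypothesis hk : 0 <= complex.Re k.
Local Notation mu := (@lebesgue_measure R).
Local Notation w := (dunkl_weight k).
Local Notation a := (complex.Re k).
Local Notation wm := (weighted_measure a : {measure set (measurableTypeR R) -> \bar R}).
Variable L : nat.
Hypothesis hL : forall x, cmod (w x) <= 1 + `|x| ^+ L.
Variable p : \bar R.
Hypothesis hp : (1 <= p)%E.
Implicit Types g : R -> R[i].

Local Notation v := (fun x : R => (growth L x)^-1).
Let I := \int[mu]_x (v x * cmod (w x)).

Let v0 x : 0 <= v x.
Proof. by rewrite invr_ge0 ltW // growth_gt0. Qed.

Let v1 x : v x <= 1.
Proof. by rewrite invf_le1 ?growth_gt0 // growth_ge1. Qed.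

Let I0 : 0 <= I.
Proof. by apply: Rintegral_ge0 => x _; rewrite mulr_ge0 // cmod_ge0. Qed.

Let mv : measurable_fun setT v.
Proof. exact: growthV_measurable. Qed.

Let mcp g r : measurablec g ->
  measurable_fun setT (fun x => (`|(cmod (g x))%:E| `^ r)%E).
Proof.
move=> mg; apply/measurable_EFinP; apply: measurableT_comp (measurable_powR _) _.
by apply: measurableT_comp; [exact: normr_measurable|exact: measurablec_cmod].
Qed.

Lemma weighted_integral_growthV : (\int[wm]_x (v x)%:E = I%:E)%E.
Proof.
rewrite weighted_integral; last 2 first.
- by move=> x; rewrite lee_fin.
- exact/measurable_EFinP.
have iv := growthV_weight_integrable hL.
rewrite /I /Rintegral fineK; last exact: integrable_fin_num iv.
by apply: eq_integral => x _; rewrite -EFinM cmod_weight.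
Qed.

(** Since [v <= 1] and a finite exponent [r] is at least 1, [v^r <= v]; hence the integral of
    [(S v)^r] is at most [S^r * I]. *)
Lemma weighted_norm_le : exists2 K, 0 <= K & forall g S, 0 <= S -> measurablec g ->
  (forall x, cmod (g x) <= S * v x) -> (weighted_norm a p g <= (K * S)%:E)%E.
Proof.
move: hp; rewrite /weighted_norm Lnorm.unlock; case: p => [r||//].
- rewrite lee_fin => r1; have r0 : 0 < r by exact: lt_le_trans r1.
  exists (I `^ r^-1); first exact: powR_ge0.
  move=> g S S0 mg gS.
  have mcg : measurable_fun setT (fun x => cmod (g x)) by exact: measurablec_cmod.
  have le1 : (\int[wm]_x (`|(cmod (g x))%:E| `^ r) <= (S `^ r * I)%:E)%E.
    rewrite EFinM -weighted_integral_growthV -ge0_integralZl_EFin //; last 3 first.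
    - by move=> x _; rewrite lee_fin.
    - exact/measurable_EFinP.
    - exact: powR_ge0.
    apply: ge0_le_integral => //.
    - by move=> x _; exact: poweR_ge0.
    - exact: mcp.
    - by apply: measurable_funeM; exact/measurable_EFinP.
    - move=> x _; rewrite abse_EFin ger0_norm ?cmod_ge0 // poweR_EFin -EFinM lee_fin.
      apply: (@le_trans _ _ ((S * v x) `^ r)).
        by apply: ge0_ler_powR; rewrite ?nnegrE ?(ltW r0) ?mulr_ge0 ?cmod_ge0.
      rewrite powRM // ler_wpM2l ?powR_ge0 //.
      have [->|vx] := eqVneq (v x) 0; first by rewrite powR0 ?gt_eqF.
      by rewrite -[leRHS]powRr1 //; apply: ger_powR => //; rewrite lt_neqAle eq_sym vx v0 v1.
  apply: (@le_trans _ _ ((S `^ r * I)%:E `^ r^-1)%E).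
    have h1 : (0 <= \int[wm]_x (`|(cmod (g x))%:E| `^ r))%E.
      by apply: integral_ge0 => x _; exact: poweR_ge0.
    have h2 : (0 <= (S `^ r * I)%:E)%E by rewrite lee_fin mulr_ge0 // powR_ge0.
    apply: gt0_ler_poweR le1; rewrite ?invr_ge0 ?(ltW r0) // in_itv /= leey andbT //.
  rewrite poweR_EFin powRM ?powR_ge0 // -powRrM divff ?gt_eqF // powRr1 //.
  by rewrite mulrC.
- move=> _; exists 1 => // g S S0 mg gS.
  rewrite mul1r weighted_measureT_gt0 //; apply/ess_supP; apply: nearW => x.
  change (`|(cmod (g x))%:E| <= S%:E)%E.
  rewrite abse_EFin lee_fin (ger0_norm (cmod_ge0 (g x))).
  by apply: le_trans (gS x) _; exact: ler_piMr.
Qed.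

(** A substitute for the Hoelder inequality, with the constant [I + 1] for all [p]. For finite
    [p = r], a Young inequality gives [|g| v <= s v + s^(1-r) |g|^r] pointwise, and for [s] above
    the norm the right side has integral at most [(I + 1) s]. *)
Lemma weighted_norm_ge : exists2 K, 0 < K & forall g, measurablec g -> rapid g ->
  ((\int[mu]_x (cmod (g x) * (v x * cmod (w x))))%:E <= K%:E * weighted_norm a p g)%E.
Proof.
exists (I + 1); first by rewrite ltr_wpDl.
move=> g mg rg.
have mcg : measurable_fun setT (fun x => cmod (g x)) by exact: measurablec_cmod.
have iw := growthV_weight_integrable hL.
have ig : integrableR (fun x => cmod (g x) * (v x * cmod (w x))).
  have [M M0 hM] := rapid_bounded rg.
  apply: (@integrableR_le _ _ (fun x => M * (v x * cmod (w x)))).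
  - apply: measurable_funM; first exact: mcg.
    exact: integrableR_measurable iw.
  - move=> x; have h : 0 <= v x * cmod (w x) by rewrite mulr_ge0 ?cmod_ge0.
    by rewrite ger0_norm; [exact: ler_wpM2r|rewrite mulr_ge0 ?cmod_ge0].
  - exact: integrableRZ.
have -> : ((\int[mu]_x (cmod (g x) * (v x * cmod (w x))))%:E =
    \int[wm]_x (cmod (g x) * v x)%:E)%E.
  rewrite weighted_integral; last 2 first.
  - by move=> x; rewrite lee_fin mulr_ge0 ?cmod_ge0.
  - by apply/measurable_EFinP; exact: measurable_funM.
  rewrite /Rintegral fineK; last exact: integrable_fin_num ig.
  by apply: eq_integral => x _; rewrite -EFinM cmod_weight mulrA.
have N0 : (0 <= weighted_norm a p g)%E by exact: Lnorm_ge0.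
have [Ny|Nfin] := eqVneq (weighted_norm a p g) +oo%E.
  by rewrite Ny gt0_muley ?leey // lte_fin ltr_wpDl.
have : weighted_norm a p g \is a fin_num by rewrite ge0_fin_numE // ltey.
move: N0; case NE : (weighted_norm a p g) => [N||] // + _; rewrite lee_fin => N0.
move: NE hp; rewrite /weighted_norm Lnorm.unlock; case: p => [r||//]; last first.
  rewrite weighted_measureT_gt0 // => NE _.
  apply: (@le_trans _ _ (\int[wm]_x (N%:E * (v x)%:E))%E).
    apply: ae_ge0_le_integral => //.
    - by move=> x _; rewrite lee_fin mulr_ge0 ?cmod_ge0.
    - by apply/measurable_EFinP; exact: measurable_funM.
    - by move=> x _; rewrite -EFinM lee_fin mulr_ge0.
    - by apply: measurable_funeM; exact/measurable_EFinP.
    have := @ess_sup_ge _ _ _ wm (abse \o (fun x => (cmod (g x))%:E)); rewrite NE.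
    apply: filterS => x /=; rewrite ger0_norm ?cmod_ge0 // lee_fin => h _.
    by rewrite -EFinM lee_fin ler_wpM2r.
  rewrite ge0_integralZl_EFin //; last 2 first.
  - by move=> x _; rewrite lee_fin.
  - exact/measurable_EFinP.
  by rewrite weighted_integral_growthV -!EFinM lee_fin mulrC ler_wpM2r // lerDl.
move=> NE; rewrite lee_fin => r1; have r0 : 0 < r by exact: lt_le_trans r1.
set A := (\int[wm]_x _)%E in NE.
have A0 : (0 <= A)%E by apply: integral_ge0 => x _; exact: poweR_ge0.
have AE : A = (N `^ r)%:E.
  by rewrite -poweR_EFin -NE -poweRrM mulVf ?gt_eqF // poweRe1.
(* A strictly larger [s] is positive even if [N = 0], so the negative powers of [s] make sense;
   letting [s] tend to [N] concludes. *)
suff main s : N < s -> (\int[wm]_x (cmod (g x) * v x)%:E <= ((I + 1) * s)%:E)%E.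
  apply/lee_addgt0Pr => e e0.
  have I1 : 0 < I + 1 by rewrite ltr_wpDl.
  apply: le_trans (main (N + e / (I + 1)) _) _; first by rewrite ltrDl divr_gt0.
  by rewrite -EFinM -EFinD lee_fin mulrDr (mulrC _ (e / _)) divfK ?gt_eqF.
move=> Ns; have s0 : 0 < s by exact: le_lt_trans Ns.
(* Young: [t <= s + s^(1-r) t^r] *)
have young t : 0 <= t -> t <= s + s `^ (1 - r) * t `^ r.
  move=> t0; have [ts|st] := leP t s.
    by rewrite (le_trans ts) // lerDl mulr_ge0 // powR_ge0.
  have tp : 0 < t by exact: lt_trans st.
  rewrite (@le_trans _ _ (s `^ (1 - r) * t `^ r)) //; last by rewrite lerDr ltW.
  have e : t `^ (1 + (r - 1)) = t `^ 1 * t `^ (r - 1).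
    by apply: powRD; rewrite (gt_eqF tp) implybT.
  have r11 : 1 + (r - 1) = r by rewrite addrC subrK.
  rewrite r11 (powRr1 t0) in e; rewrite e.
  rewrite mulrCA ler_peMr // -[1 - r]opprB powRN mulrC ler_pdivlMr ?powR_gt0 // mul1r.
  by apply: ge0_ler_powR; rewrite ?nnegrE ?subr_ge0 ?(ltW st) ?(ltW s0).
apply: (@le_trans _ _ (\int[wm]_x (s%:E * (v x)%:E + (s `^ (1 - r))%:E * (`|(cmod (g x))%:E| `^ r)))%E).
  apply: ge0_le_integral => //.
  - by move=> x _; rewrite lee_fin mulr_ge0 ?cmod_ge0.
  - by apply/measurable_EFinP; exact: measurable_funM.
  - apply: emeasurable_funD; apply: measurable_funeM; first exact/measurable_EFinP.
    exact: mcp.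
  - move=> x _; rewrite abse_EFin ger0_norm ?cmod_ge0 // poweR_EFin -!EFinM -EFinD lee_fin.
    have := young _ (cmod_ge0 (g x)); move: (v0 x) (v1 x) (cmod_ge0 (g x)).
    have : 0 <= s `^ (1 - r) * cmod (g x) `^ r by rewrite mulr_ge0 // powR_ge0.
    move: (v x) (cmod (g x)) (_ * _) => y t q q0 y0 y1 t0 tq.
    apply: (@le_trans _ _ ((s + q) * y)); first by rewrite ler_wpM2r.
    by rewrite mulrDl lerD2l ler_piMr.
have mA : measurable_fun setT (fun x => (`|(cmod (g x))%:E| `^ r)%E).
  exact: mcp.
rewrite ge0_integralD //; last 4 first.
- by move=> x _; rewrite -EFinM lee_fin mulr_ge0 // ltW.
- by apply: measurable_funeM; exact/measurable_EFinP.
- by move=> x _; rewrite mule_ge0 ?poweR_ge0 // lee_fin powR_ge0.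
- exact: measurable_funeM.
rewrite ge0_integralZl_EFin //; last 3 first.
- by move=> x _; rewrite lee_fin.
- exact/measurable_EFinP.
- exact: ltW.
rewrite ge0_integralZl_EFin //; last 2 first.
- by move=> x _; exact: poweR_ge0.
- exact: powR_ge0.
rewrite weighted_integral_growthV -/A AE -!EFinM -EFinD lee_fin mulrDl mul1r mulrC lerD2l.
apply: (@le_trans _ _ (s `^ (1 - r) * s `^ r)).
  by rewrite ler_wpM2l ?powR_ge0 //; apply: ge0_ler_powR; rewrite ?nnegrE ?(ltW r0) ?(ltW s0) ?(ltW Ns).
have e : s `^ (1 - r + r) = s `^ (1 - r) * s `^ r.
  by apply: powRD; rewrite (gt_eqF s0) implybT.
by rewrite -e subrK powRr1 // ltW.
Qed.

End NormComparison.

(** * Limits of roots *)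

Section RootLimit.
Context {R : realType}.

(** Half of the geometric decay, [r^n] with [r = sqrt q], pays for one factor [n + 1]; the other
    half is left to the induction on [M]. *)
Lemma poly_geometric_bounded (q : R) M : 0 <= q < 1 ->
  exists2 B, 0 <= B & forall n, n.+1%:R ^+ M * q ^+ n <= B.
Proof.
elim: M q => [|M IH] q /andP[q0 q1].
  by exists 1 => // n; rewrite expr0 mul1r exprn_ile1 // ltW.
pose r := Num.sqrt q.
have r0 : 0 <= r by exact: sqrtr_ge0.
have rr : r ^+ 2 = q by rewrite sqr_sqrtr.
have r1 : r < 1 by rewrite -sqrtr1 ltr_sqrt.
have [B B0 hB] : exists2 B, 0 <= B & forall n, n.+1%:R ^+ M * r ^+ n <= B.
  by apply: IH; rewrite r0.
(* This is [(n + 1) r^n <= 1 + r + ... + r^n], multiplied by [1 - r]. *)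
have lin n : n.+1%:R * r ^+ n * (1 - r) + r ^+ n.+1 <= 1.
  elim: n => [|n hn]; first by rewrite expr0 expr1; lra.
  have rn : 0 <= r ^+ n.+1 by rewrite exprn_ge0.
  have rn1 : r ^+ n.+1 <= 1 by rewrite exprn_ile1 // ltW.
  have -> : n.+2%:R * r ^+ n.+1 * (1 - r) + r ^+ n.+2 =
      r * (n.+1%:R * r ^+ n * (1 - r) + r ^+ n.+1) + r ^+ n.+1 * (1 - r).
    by rewrite -(@natr1 R n.+1) !exprS; ring.
  nra.
exists (B / (1 - r)); first by rewrite divr_ge0 // subr_ge0 ltW.
move=> n; rewrite ler_pdivlMr ?subr_gt0 // -rr -exprM mulnC exprM.
have -> : n.+1%:R ^+ M.+1 * (r ^+ n) ^+ 2 * (1 - r) =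
   n.+1%:R ^+ M * r ^+ n * (n.+1%:R * r ^+ n * (1 - r)).
  by rewrite exprS expr2; ring.
rewrite -[leRHS]mulr1; apply: ler_pM.
- by rewrite mulr_ge0 ?exprn_ge0.
- by rewrite !mulr_ge0 ?exprn_ge0 // subr_ge0 ltW.
- exact: hB.
- by apply: le_trans (lin n); rewrite lerDl exprn_ge0.
Qed.

(** Boundedness with exponent [M + 1] leaves a factor [1 / (n + 1)]. *)
Lemma poly_geometric_small (q e : R) M : 0 <= q < 1 -> 0 < e ->
  \forall n \near \oo, n.+1%:R ^+ M * q ^+ n <= e.
Proof.
move=> hq e0; have [B B0 hB] := poly_geometric_bounded M.+1 hq.
near=> n.
have nB : B / e <= n.+1%:R.
  apply: (@le_trans _ _ n%:R); last by rewrite ler_nat.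
  by near: n; exact: nbhs_infty_ger.
have := hB n; rewrite exprS -mulrA mulrC -ler_pdivlMr // => /le_trans; apply.
by rewrite ler_pdivrMr // mulrC -ler_pdivrMr.
Unshelve. all: by end_near. Qed.

(** A number inserted strictly between [sigma] and the bound to be proved leaves a geometric
    sequence that beats constants and powers of [n + 1]. For [sigma = 0] the lower hypothesis is
    void and for [sigma = +oo] the upper one, so that these cases need no separate estimates. *)
Lemma root_cvg (N : nat -> \bar R) (sigma : \bar R) :
  (0 <= sigma)%E -> (forall n, 0 <= N n)%E ->
  (forall s : R, (sigma < s%:E)%E -> exists C M, 0 <= C /\
     forall n, (N n <= (C * n.+1%:R ^+ M * s ^+ n)%:E)%E) ->
  (forall r : R, 0 <= r -> (r%:E < sigma)%E -> exists c M, 0 < c /\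
     forall n, ((c * r ^+ n)%:E <= (n.+1%:R ^+ M)%:E * N n)%E) ->
  (N n `^ (n%:R^-1))%E @[n --> \oo] --> sigma.
Proof.
move=> sg0 N0 up low.
have rootX (s : R) n : (0 < n)%N -> 0 <= s -> (s ^+ n) `^ (n%:R^-1) = s.
  move=> n0 s0; rewrite -powR_mulrn // -powRrM divff ?powRr1 //.
  by rewrite pnatr_eq0 -lt0n.
have up' (s : R) : (sigma < s%:E)%E -> \forall n \near \oo, (N n `^ (n%:R^-1) <= s%:E)%E.
  move=> ss; have [t st ts] : exists2 t : R, (sigma < t%:E)%E & t < s.
    move: sigma ss sg0 {up low} => [y||] //; rewrite lte_fin lee_fin => ys y0.
    by exists ((y + s) / 2); rewrite ?lte_fin; lra.
  have t0 : 0 < t by rewrite -lte_fin; exact: le_lt_trans st.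
  have s0 : 0 < s by exact: lt_trans ts.
  have [C [M [C0 hN]]] := up t st.
  have q01 : 0 <= t / s < 1 by rewrite divr_ge0 ?ltW //= ltr_pdivrMr // mul1r.
  have C1 : 0 < (C + 1)^-1 by rewrite invr_gt0 ltr_wpDl.
  near=> n.
  have n0 : (0 < n)%N by near: n; exact: nbhs_infty_gt.
  have sm : n.+1%:R ^+ M * (t / s) ^+ n <= (C + 1)^-1.
    by near: n; exact: poly_geometric_small.
  have le : (N n <= (s ^+ n)%:E)%E.
    apply: (le_trans (hN n)); rewrite lee_fin.
    have sn : 0 < s ^+ n by rewrite exprn_gt0.
    move: sm; rewrite expr_div_n mulrA ler_pdivrMr // => sm.
    rewrite -mulrA; apply: (le_trans (ler_wpM2l C0 sm)); rewrite mulrA.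
    by rewrite ler_piMl ?(ltW sn) // ler_pdivrMr ?mul1r ?lerDl // ltr_wpDl.
  rewrite -[X in (_ <= X%:E)%E](rootX s n n0 (ltW s0)) -poweR_EFin.
  apply: gt0_ler_poweR le; rewrite ?invr_ge0 ?in_itv /= ?leey ?andbT //.
  by rewrite lee_fin exprn_ge0 // ltW.
have low' (r : R) : 0 <= r -> (r%:E < sigma)%E ->
    \forall n \near \oo, (r%:E <= N n `^ (n%:R^-1))%E.
  move=> r0 rs; have [t rt ts] : exists2 t : R, r < t & (t%:E < sigma)%E.
    move: sigma rs {sg0 up low up'} => [y||] //; last by exists (r + 1); rewrite ?ltry // ltrDl.
    rewrite lte_fin => ry.
    by exists ((y + r) / 2); rewrite ?lte_fin; lra.
  have t0 : 0 < t by exact: le_lt_trans rt.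
  have [c [M [c0 hN]]] := low t (ltW t0) ts.
  have q01 : 0 <= r / t < 1 by rewrite divr_ge0 ?(ltW t0) //= ltr_pdivrMr // mul1r.
  near=> n.
  have n0 : (0 < n)%N by near: n; exact: nbhs_infty_gt.
  have sm : n.+1%:R ^+ M * (r / t) ^+ n <= c.
    by near: n; exact: poly_geometric_small.
  have P0 : 0 < n.+1%:R ^+ M :> R by rewrite exprn_gt0.
  have le : ((r ^+ n)%:E <= N n)%E.
    rewrite -(@lee_pmul2l R (n.+1%:R ^+ M)%:E) ?lte_fin //.
    apply: le_trans (hN n); rewrite -EFinM lee_fin.
    move: sm; rewrite expr_div_n mulrA ler_pdivrMr ?exprn_gt0 //.
  rewrite -[X in (X%:E <= _)%E](rootX r n n0 r0) -poweR_EFin.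
  apply: gt0_ler_poweR le; rewrite ?invr_ge0 ?in_itv /= ?leey ?andbT //.
  by rewrite lee_fin exprn_ge0.
case: sigma sg0 up low up' low' => [y||] // sg0 _ _ up low; last first.
  apply/cvgeyPge => A; near=> n.
  apply: (@le_trans _ _ (Num.max 0 A)%:E); first by rewrite lee_fin le_max lexx orbT.
  by near: n; apply: low; rewrite ?ltry // le_max lexx.
have fin : \forall n \near \oo, (N n `^ (n%:R^-1))%E \is a fin_num.
  near=> n; rewrite ge0_fin_numE ?poweR_ge0 //.
  apply: (@le_lt_trans _ _ (y + 1)%:E); last by rewrite ltry.
  by near: n; apply: up; rewrite lte_fin ltrDl.
apply/fine_cvgP; split => //.
apply/cvgrPdist_le => e e0.
have low0 : \forall n \near \oo, ((y - e)%:E <= N n `^ (n%:R^-1))%E.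
  have [ye|ye] := leP 0 (y - e).
    by apply: low; rewrite // lte_fin ltrBlDr ltrDl.
  by apply: nearW => n; apply: (@le_trans _ _ 0%E); [rewrite lee_fin ltW|exact: poweR_ge0].
near=> n.
have nfin : (N n `^ (n%:R^-1))%E \is a fin_num by near: n.
have h1 : (N n `^ (n%:R^-1) <= (y + e)%:E)%E.
  by near: n; apply: up; rewrite lte_fin ltrDl.
have h2 : ((y - e)%:E <= N n `^ (n%:R^-1))%E by near: n.
rewrite /=; move: nfin h1 h2; case: (N n `^ _)%E => // z _; rewrite !lee_fin /=.
by move=> h1 h2; rewrite ler_distl; apply/andP; split; lra.
Unshelve. all: by end_near. Qed.

End RootLimit.

(** * The two bounds for the norms of the iterates *)

Section Main.
Context {R : realType}.
Variable k : R[i].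
Hypothesis hk : 0 <= complex.Re k.
Local Notation mu := (@lebesgue_measure R).
Local Notation w := (dunkl_weight k).
Local Notation D := (dunkl_integral k).
Local Notation T := (dunkl k).
Local Notation a := (complex.Re k).
Variable p : \bar R.
Hypothesis hp : (1 <= p)%E.
Variable f : R -> R[i].
Hypothesis hf : tower_schwartz f.
Local Notation sigma := (sup_abs (supp (dunkl_transform k f))).

Lemma dunkl_transform_neq0 l : (dunkl_transform k f l != 0) = (D f l != 0).
Proof.
by rewrite dunkl_transformE // mulf_eq0 invr_eq0 (negbTE (dunkl_const_neq0 hk)).
Qed.

Lemma weight_exponentc : exists L, forall x, cmod (w x) <= 1 + `|x| ^+ L.
Proof.
by have [L hL] := weight_exponent hk; exists L => x; rewrite cmod_weight.
Qed.

Lemma weighted_norm_iter_le (s : R) : (sigma < s%:E)%E -> exists C M, 0 <= C /\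
  forall n, (weighted_norm a p (iter n T f) <= (C * n.+1%:R ^+ M * s ^+ n)%:E)%E.
Proof.
move=> ss; have [L hL] := weight_exponentc.
have s0 : 0 < s by rewrite -lte_fin; apply: le_lt_trans ss; rewrite le_max lexx.
have hs l : s < `|l| -> D f l = 0.
  move=> sl; apply/eqP; apply: contraTT sl => Dl; rewrite -leNgt -lee_fin.
  apply: le_trans (ltW ss); rewrite le_max; apply/orP; right.
  apply: ereal_sup_ubound; exists l => //; apply: subset_closure => /=.
  by rewrite dunkl_transform_neq0.
have decay m : (m <= L.+2)%N -> exists2 C, 0 <= C & forall n x,
    `|x| ^+ m * cmod (iter n T f x) <= C * (n.+1%:R ^+ L.+2 * s ^+ n).
  move=> mL; have [C C0 hC] := band_limited_decay hk m hf s0 hs; exists C => // n x.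
  apply: (le_trans (hC n x)); rewrite -mulrA ler_wpM2l // ler_wpM2r ?exprn_ge0 ?(ltW s0) //.
  by apply: ler_weXn2l; rewrite ?ler1n.
have [C0 C00 h0] := decay 0%N isT; have [C2 C20 h2] := decay 2%N isT.
have [C3 C30 h3] := decay L (leqW (leqnSn L)); have [C4 C40 h4] := decay L.+2 (leqnn _).
have [K K0 hK] := weighted_norm_le hk hL hp.
pose C := C0 + C2 + C3 + C4.
have Cp : 0 <= C by rewrite !addr_ge0.
exists (K * C), L.+2; split; first exact: mulr_ge0.
move=> n; pose Q := n.+1%:R ^+ L.+2 * s ^+ n.
have -> : K * C * n.+1%:R ^+ L.+2 * s ^+ n = K * (C * Q) by rewrite /Q; ring.
have Q0 : 0 <= Q by rewrite mulr_ge0 ?exprn_ge0 // ltW.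
apply: hK; first exact: mulr_ge0.
  by apply: tower_schwartz_measurable; exact: tower_schwartz_iter.
move=> x; rewrite ler_pdivlMr ?growth_gt0 // mulrC growthE /C.
move: (h0 n x) (h2 n x) (h3 n x) (h4 n x); rewrite -/Q.
move: (cmod _) Q {Q0} (`|x| ^+ 0) (`|x| ^+ 2) (`|x| ^+ L) (`|x| ^+ L.+2) => *; lra.
Qed.

Lemma weighted_norm_iter_ge (r : R) : 0 <= r -> (r%:E < sigma)%E ->
  exists c M, 0 < c /\ forall n, ((c * r ^+ n)%:E <=
    (n.+1%:R ^+ M)%:E * weighted_norm a p (iter n T f))%E.
Proof.
move=> r0 rs; have [L hL] := weight_exponentc.
have [l Dl rl] : exists2 l, D f l != 0 & r < `|l|.
  move: rs; rewrite lt_max => /orP[|]; first by rewrite lte_fin ltNge r0.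
  move=> /ereal_sup_gt[_ [x sx <-]]; rewrite lte_fin => rx.
  (* The support is a closure, while the bump needs a point where [D f] itself is nonzero: one is
     found near [x], since [r < |y|] is an open condition. *)
  have [y []] : ([set x | dunkl_transform k f x != 0] `&` [set y | r < `|y|]) !=set0.
    apply: sx; have cn : {for x, continuous (fun y : R => `|y|)} by exact: norm_continuous.
    exact: (cvgr_gt _ cn _ rx).
  by move=> Dy ry; exists y => //; rewrite -dunkl_transform_neq0.
have rl' : 0 <= r < `|l| by rewrite r0.
have [b [c [i [rb bc Ineq]]]] := bump_pairing_neq0 hk (L + 2) hf rl' Dl.
have b0 : 0 < b by exact: le_lt_trans rb.
have [C C0 hC] := bump_pairing_bound hk i b0 bc hL hf.
have [K K0 hK] := weighted_norm_ge hk hL hp.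
have L4 : (L + 4 = (L + 2).+2)%N by rewrite !addnS.
rewrite L4 in hC; move: Ineq hC; set J := integralc _ => Jn hC.
have J0 : 0 < cmod J by rewrite lt_neqAle cmod_ge0 eq_sym cmod_eq0 Jn.
have C1 : 0 < C + 1 by rewrite ltr_wpDl.
(* [C] may vanish, hence [C + 1] in the denominator. The inner radius of the bump is called [b]
   here, and [r < b] lets [b^n] be replaced by [r^n]. *)
exists (cmod J / ((C + 1) * K)), L.+2; split; first by rewrite divr_gt0 // mulr_gt0.
move=> n; have hg := tower_schwartz_iter k n hf.
have := hK _ (tower_schwartz_measurable hg) (tower_schwartz_rapid hg).
have := hC n; set Y := \int[mu]_x _ => hY.
set N := weighted_norm _ _ _ => hN.
have Y0 : 0 <= Y.
  by apply: Rintegral_ge0 => x _; rewrite !mulr_ge0 ?cmod_ge0 // invr_ge0 ltW // growth_gt0.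
have P0 : 0 <= n.+1%:R ^+ L.+2 :> R by rewrite exprn_ge0.
have step : cmod J / (C + 1) * r ^+ n <= n.+1%:R ^+ L.+2 * Y.
  apply: (@le_trans _ _ (cmod J / (C + 1) * b ^+ n)).
    rewrite ler_wpM2l ?divr_ge0 ?(ltW C1) ?cmod_ge0 //.
    by apply: lerXn2r; rewrite ?nnegrE ?(ltW b0) ?(ltW rb).
  have bn : 0 < b ^+ n by rewrite exprn_gt0.
  apply: (@le_trans _ _ (C * n.+1%:R ^+ L.+2 * b^-1 ^+ n * Y / (C + 1) * b ^+ n)).
    by apply: ler_wpM2r; [exact: ltW|apply: ler_wpM2r; [rewrite invr_ge0 ltW|]].
  have -> : C * n.+1%:R ^+ L.+2 * b^-1 ^+ n * Y / (C + 1) * b ^+ n =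
      C / (C + 1) * (n.+1%:R ^+ L.+2 * Y).
    by rewrite exprVn; field; rewrite !gt_eqF.
  by apply: ler_piMl; [exact: mulr_ge0|rewrite ler_pdivrMr // mul1r lerDl].
have -> : ((cmod J / ((C + 1) * K) * r ^+ n)%:E =
    (K^-1)%:E * (cmod J / (C + 1) * r ^+ n)%:E)%E.
  by rewrite -EFinM; congr _%:E; field; rewrite !gt_eqF.
apply: (@le_trans _ _ ((K^-1)%:E * ((n.+1%:R ^+ L.+2)%:E * Y%:E))%E).
  by rewrite -!EFinM lee_fin ler_wpM2l // invr_ge0 ltW.
rewrite muleCA; apply: lee_wpmul2l; first by rewrite lee_fin.
apply: (@le_trans _ _ ((K^-1)%:E * (K%:E * N))%E).
  by apply: lee_wpmul2l => //; rewrite lee_fin invr_ge0 ltW.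
by rewrite muleA -EFinM mulVf ?mul1e // gt_eqF.
Qed.

End Main.

Theorem theorem8 (R : realType) (k : R[i]) (hk : 0 <= complex.Re k)
    (p : \bar R) (hp : (1 <= p)%E) (f : R -> R[i]) (hf : schwartz f) :
  (weighted_norm (complex.Re k) p (iter n (dunkl k) f) `^ (n%:R^-1))%E
    @[n --> \oo] -->
  sup_abs (supp (dunkl_transform k f)).
Proof.
have tf := schwartz_tower hf.
apply: (@root_cvg R (fun n => weighted_norm (complex.Re k) p (iter n (dunkl k) f))).
- by rewrite le_max lexx.
- by move=> n; exact: Lnorm_ge0.
- exact: weighted_norm_iter_le.
- exact: weighted_norm_iter_ge.
Qed.
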